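(* Let $m,n$ be positive integers and let $\mathcal M$ be a positive definite symmetric half-integral $m\times m$ matrix. Let $\Gamma_L=\{(\lambda,\mu,\kappa)\in G\mid\lambda,\mu\in\mathbb Z^{(m,n)},\ \kappa\in\mathbb R^{(m,m)}\}$ and let $\varphi_{\mathcal M}$ be the character of $\Gamma_L$ defined by $\varphi_{\mathcal M}((\lambda,\mu,\kappa))=e^{2\pi i\,\sigma(\mathcal M\kappa)}$ for all $(\lambda,\mu,\kappa)\in\Gamma_L$. Then the representation $$\pi_{\mathcal M}:=\mathrm{Ind}_{\Gamma_L}^G\,\varphi_{\mathcal M}$$ induced from the character $\varphi_{\mathcal M}$ is unitarily equivalent to the direct sum $$\bigoplus U_{\mathcal M}:=\bigoplus\mathrm{Ind}_K^G\,\sigma_{\mathcal M}\qquad((\det 2\mathcal M)^n\ \text{copies}),$$ where $K=\{(0,\mu,\kappa)\in G\mid \mu\in\mathbb R^{(m,n)},\ \kappa={}^t\kappa\in\mathbb R^{(m,m)}\}$ and $\sigma_{\mathcal M}$ is the one-dimensional unitary representation of $K$ given by $\sigma_{\mathcal M}((0,\mu,\kappa))=e^{2\pi i\,\sigma(\mathcal M\kappa)}$.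
   Context: $\sigma$ denotes the trace (and $\sigma_{\mathcal M}$ the one-dimensional representation named in the claim), ${}^tM$ the transpose, $F^{(k,l)}$ the $k\times l$ matrices over $F$. A symmetric matrix $\mathcal M=(\mathcal M_{kl})$ is half-integral if $\mathcal M_{kk}\in\mathbb Z$ and $2\mathcal M_{kl}\in\mathbb Z$ for all $k,l$. The Heisenberg group is $G=H_{\mathbb R}^{(n,m)}=\{(\lambda,\mu,\kappa)\mid\lambda,\mu\in\mathbb R^{(m,n)},\ \kappa\in\mathbb R^{(m,m)},\ \kappa+\mu\,{}^t\lambda\text{ symmetric}\}$ with multiplication $(\lambda,\mu,\kappa)\circ(\lambda_0,\mu_0,\kappa_0)=(\lambda+\lambda_0,\mu+\mu_0,\kappa+\kappa_0+\lambda\,{}^t\mu_0-\mu\,{}^t\lambda_0)$. The lattice is $L=\mathbb Z^{(m,n)}\times\mathbb Z^{(m,n)}$. For a closed subgroup $H\subset G$ with $G$-invariant measure on $H\backslash G$ and a unitary character $\chi$ of $H$, $\mathrm{Ind}_H^G\chi$ is right translation $(\pi(g_0)\phi)(g)=\phi(gg_0)$ on the Hilbert space of measurable $\phi:G\to\mathbb C$ with $\phi(hg)=\chi(h)\phi(g)$ for $h\in H$, $g\in G$, and $\int_{H\backslash G}|\phi|^2<\infty$. The representation $U_{\mathcal M}$ (the Schrödinger representation) is realized on $L^2(\mathbb R^{(m,n)},d\xi)$ by $(U_{\mathcal M}(\lambda,\mu,\kappa)f)(\xi)=e^{2\pi i\,\sigma\{\mathcal M(\kappa+\mu\,{}^t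\lambda+2\,\xi\,{}^t\mu)\}}f(\xi+\lambda)$.
   Formalization: The formula for φ_M is multiplicative on Γ_L only when all entries of M are integers (it fails for M=[[1,1/2],[1/2,1]]); the theorem assumes that φ_M is a unitary character of Γ_L, so it has content for integral M only. *)

(* Defs.v *)
From HB Require Import structures.
From mathcomp Require Import all_boot all_order all_algebra.
From mathcomp Require Import generic_quotient.
From mathcomp Require Import all_classical all_reals all_analysis.
From mathcomp Require Import complex ring.

Set Implicit Arguments.
Unset Strict Implicit.
Unset Printing Implicit Defensive.

Import Order.TTheory GRing.Theory Num.Theory.
Import numFieldNormedType.Exports.

Local Open Scope classical_set_scope.
Local Open Scope ring_scope.
Local Open Scope complex_scope.
Local Open Scope quotient_scope.

Section matrices.
Context {R : realType} {m : nat}.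
Implicit Type M : 'M[R]_m.

Definition posdef M := forall v : 'rV[R]_m, v != 0 -> 0 < (v *m M *m v^T) 0 0.

Definition half_integral M :=
  (forall k, M k k \is a Num.int) /\ (forall k l, 2 * M k l \is a Num.int).

End matrices.

Section complex_functions.
Context {R : realType}.

(* e^{2 pi i t} *)
Definition expi2pi (t : R) : R[i] := cos (2 * pi * t) +i* sin (2 * pi * t).

Definition sqnormC (z : R[i]) : R := complex.Re z ^+ 2 + complex.Im z ^+ 2.

Definition cmeasurable d (T : measurableType d) (f : T -> R[i]) :=
  measurable_fun setT (fun x => complex.Re (f x)) /\
  measurable_fun setT (fun x => complex.Im (f x)).

Definition cintegral d (T : measurableType d) (mu : {measure set T -> \bar R})
    (f : T -> R[i]) : R[i] :=
  Rintegral mu setT (fun x => complex.Re (f x)) +i*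
  Rintegral mu setT (fun x => complex.Im (f x)).

End complex_functions.

(* A (semi-)Hilbert space with operators indexed by G: the vectors are the
   elements of [rspace] inside a complex vector space [rvec] (of functions), with
   the semi-inner product [rdot]; the Hilbert space is the quotient of [rspace]
   by the null vectors, i.e. x and y are the same vector when [req x y].  For
   functions this is equality almost everywhere. *)
Record rep (R : realType) (G : Type) := Rep {
  rvec : lmodType R[i] ;
  rspace : set rvec ;
  rdot : rvec -> rvec -> R[i] ;
  ract : G -> rvec -> rvec }.

Definition req (R : realType) (G : Type) (rho : rep R G) (x y : rvec rho) :=
  rdot (x - y) (x - y) = 0.

(* T induces a surjective linear isometry, commuting with G, of the Hilbert
   space of rho onto that of tau. *)
Definition unitary_intertwiner (R : realType) (G : Type) (rho tau : rep R G)
    (T : rvec rho -> rvec tau) :=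
  [/\ forall x, rspace x -> rspace (T x),
      forall a x y, rspace x -> rspace y ->
        req (T (a *: x + y)) (a *: T x + T y),
      forall x y, rspace x -> rspace y -> rdot (T x) (T y) = rdot x y,
      forall z, rspace z -> exists2 x, rspace x & req (T x) z &
      forall g x, rspace x -> req (T (ract g x)) (ract g (T x))].

Definition unitarily_equivalent (R : realType) (G : Type) (rho tau : rep R G) :=
  exists T : rvec rho -> rvec tau, unitary_intertwiner T.

Definition copies (R : realType) (G : Type) (N : nat) (rho : rep R G) :
    rep R G :=
  @Rep R G {ffun 'I_N -> rvec rho}
    [set x | forall k, rspace (x k)]
    (fun x y => \sum_k rdot (x k) (y k))
    (fun g x => [ffun k => ract g (x k)]).

Section heisenberg.
Context (R : realType) (m n : nat).

Definition heis_pred : pred ('M[R]_(m, n) * 'M[R]_(m, n) * 'M[R]_m) :=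
  fun t => let S := t.2 + t.1.2 *m t.1.1^T in S^T == S.

Record heis := Heis { hval : 'M[R]_(m, n) * 'M[R]_(m, n) * 'M[R]_m;
                      hvalP : heis_pred hval }.

HB.instance Definition _ := [isSub for hval].
HB.instance Definition _ := [Choice of heis by <:].

Definition hlam (g : heis) := (hval g).1.1.
Definition hmu (g : heis) := (hval g).1.2.
Definition hkap (g : heis) := (hval g).2.

Lemma heisP g h : hlam g = hlam h -> hmu g = hmu h -> hkap g = hkap h -> g = h.
Proof.
rewrite /hlam /hmu /hkap => e1 e2 e3; apply/val_inj => /=.
by case: (hval g) (hval h) e1 e2 e3 => [[? ?] ?] [[? ?] ?] /= -> -> ->.
Qed.

Lemma heis_sym g : (hkap g + hmu g *m (hlam g)^T)^T = hkap g + hmu g *m (hlam g)^T.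
Proof. exact: (eqP (hvalP g)). Qed.

Fact trmx_add p q (a b : 'M[R]_(p, q)) : (a + b)^T = a^T + b^T.
Proof. exact: raddfD. Qed.

Fact trmx_opp p q (a : 'M[R]_(p, q)) : (- a)^T = - a^T.
Proof. exact: raddfN. Qed.

Fact one_subproof : heis_pred (0, 0, 0).
Proof. by rewrite /heis_pred/= mul0mx addr0 linear0. Qed.

Fact mul_subproof g h : heis_pred (hlam g + hlam h, hmu g + hmu h,
  hkap g + hkap h + hlam g *m (hmu h)^T - hmu g *m (hlam h)^T).
Proof.
rewrite /heis_pred/=.
have -> : hkap g + hkap h + hlam g *m (hmu h)^T - hmu g *m (hlam h)^T +
    (hmu g + hmu h) *m (hlam g + hlam h)^T =
  (hkap g + hmu g *m (hlam g)^T) + (hkap h + hmu h *m (hlam h)^T) +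
  (hlam g *m (hmu h)^T + hmu h *m (hlam g)^T).
  rewrite trmx_add mulmxDl !mulmxDr.
  move: (hlam g *m _) (hmu g *m (hlam h)^T) (hmu g *m _) => a b c.
  move: (hmu h *m (hlam g)^T) (hmu h *m _) => d e.
  by apply/matrixP => i j; rewrite !mxE; ring.
apply/eqP; rewrite trmx_add trmx_add !heis_sym; congr (_ + _).
by rewrite trmx_add !trmx_mul !trmxK addrC.
Qed.


Fact inv_subproof g : heis_pred (- hlam g, - hmu g,
  - hkap g + hlam g *m (hmu g)^T - hmu g *m (hlam g)^T).
Proof.
rewrite /heis_pred/=.
have -> : - hkap g + hlam g *m (hmu g)^T - hmu g *m (hlam g)^T +
    - hmu g *m (- hlam g)^T =
  - (hkap g + hmu g *m (hlam g)^T) +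
  (hlam g *m (hmu g)^T + hmu g *m (hlam g)^T).
  rewrite trmx_opp mulNmx mulmxN.
  move: (hlam g *m _) (hmu g *m _) => a b.
  by apply/matrixP => i j; rewrite !mxE; ring.
apply/eqP; rewrite trmx_add trmx_opp heis_sym; congr (_ + _).
by rewrite trmx_add !trmx_mul !trmxK addrC.
Qed.

Definition heis_one := Heis one_subproof.
Definition heis_mul g h := Heis (mul_subproof g h).
Definition heis_inv g := Heis (inv_subproof g).

Lemma hlamM g h : hlam (heis_mul g h) = hlam g + hlam h. Proof. by []. Qed.
Lemma hmuM g h : hmu (heis_mul g h) = hmu g + hmu h. Proof. by []. Qed.
Lemma hkapM g h : hkap (heis_mul g h) =
  hkap g + hkap h + hlam g *m (hmu h)^T - hmu g *m (hlam h)^T.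
Proof. by []. Qed.

Fact heis_mulA : associative heis_mul.
Proof.
move=> x y z; apply: heisP; rewrite ?hlamM ?hmuM ?addrA// !hkapM !hlamM !hmuM.
rewrite !trmx_add !mulmxDl !mulmxDr.
do ![move: (_ *m _) => ?].
by apply/matrixP => i j; rewrite !mxE; ring.
Qed.

Fact heis_mul1g : left_id heis_one heis_mul.
Proof.
move=> x; apply: heisP; rewrite ?hlamM ?hmuM ?hkapM/= ?add0r//.
by rewrite !mul0mx subr0 addr0.
Qed.

Fact heis_mulg1 : right_id heis_one heis_mul.
Proof.
move=> x; apply: heisP; rewrite ?hlamM ?hmuM ?hkapM/= ?addr0//.
by rewrite !trmx0 !mulmx0 subr0 addr0.
Qed.

Fact heis_mulVg : left_inverse heis_one heis_inv heis_mul.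
Proof.
move=> x; apply: heisP; rewrite ?hlamM ?hmuM ?hkapM/= ?addNr// !mulNmx.
rewrite [hkap (heis_inv x)]/(- hkap x + hlam x *m (hmu x)^T - hmu x *m (hlam x)^T).
do ![move: (_ *m _) => ?].
by apply/matrixP => i j; rewrite !mxE; ring.
Qed.

Fact heis_mulgV : right_inverse heis_one heis_inv heis_mul.
Proof.
move=> x; apply: heisP; rewrite ?hlamM ?hmuM ?hkapM/= ?addrN// !trmx_opp !mulmxN.
rewrite [hkap (heis_inv x)]/(- hkap x + hlam x *m (hmu x)^T - hmu x *m (hlam x)^T).
do ![move: (_ *m _) => ?].
by apply/matrixP => i j; rewrite !mxE; ring.
Qed.

HB.instance Definition _ := isGroup.Build heis
  heis_mulA heis_mul1g heis_mulg1 heis_mulVg heis_mulgV.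

Lemma hlam1 : hlam (1%g : heis) = 0. Proof. by []. Qed.
Lemma hmu1 : hmu (1%g : heis) = 0. Proof. by []. Qed.
Lemma hkap1 : hkap (1%g : heis) = 0. Proof. by []. Qed.
Lemma hlamV (g : heis) : hlam g^-1%g = - hlam g. Proof. by []. Qed.
Lemma hmuV (g : heis) : hmu g^-1%g = - hmu g. Proof. by []. Qed.
Lemma hkapV (g : heis) : hkap g^-1%g =
  - hkap g + hlam g *m (hmu g)^T - hmu g *m (hlam g)^T.
Proof. by []. Qed.

HB.instance Definition _ := isPointed.Build heis (1%g : heis).
(* G carries the topology induced from the ambient space of triples, and the
   corresponding Borel sigma-algebra. *)
HB.instance Definition _ := PointedTopological.copy heis (initial_topology hval).
HB.instance Definition _ := @isMeasurable.Build (sigma_display (@open heis))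
  heis <<s open >> (@sigma_algebra0 _ setT open) (@sigma_algebraC _ open)
  (@sigma_algebra_bigcup _ setT open).

End heisenberg.

Arguments heis_one {R m n}.

Section cosets.
Context (R : realType) (m n : nat) (H : groupClosed (heis R m n)).
Local Notation G := (heis R m n).

(* Hx = Hy *)
Definition coset_rel : rel G := fun x y => (x * y^-1)%g \in H.

Fact coset_refl : reflexive coset_rel.
Proof. by move=> x; rewrite /coset_rel mulgV gpred1. Qed.

Fact coset_sym : symmetric coset_rel.
Proof. by move=> x y; rewrite /coset_rel -gpredV invgM invgK. Qed.

Fact coset_trans : transitive coset_rel.
Proof.
move=> y x z xy yz; rewrite /coset_rel.
suff -> : (x * z^-1 = (x * y^-1) * (y * z^-1))%g by exact: gpredM.
by rewrite !mulgA mulgVK.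
Qed.

Canonical coset_equiv := EquivRel coset_rel coset_refl coset_sym coset_trans.

(* H\G, with the quotient sigma-algebra (for closed H, the Borel sigma-algebra
   of the quotient topology). *)
Definition cosets := {eq_quot coset_equiv}.

HB.instance Definition _ := Choice.on cosets.
HB.instance Definition _ := EqQuotient.on cosets.
HB.instance Definition _ := isPointed.Build cosets (\pi_cosets 1%g).

Definition cosets_measurable : set (set cosets) :=
  [set A | measurable (\pi_cosets @^-1` A : set G)].

Fact cosets_measurable0 : cosets_measurable set0.
Proof. by rewrite /cosets_measurable/= preimage_set0. Qed.

Fact cosets_measurableC A : cosets_measurable A -> cosets_measurable (~` A).
Proof. by rewrite /cosets_measurable/= preimage_setC; exact: measurableC. Qed.

Fact cosets_measurable_bigcup (F : (set cosets)^nat) :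
  (forall i, cosets_measurable (F i)) -> cosets_measurable (\bigcup_i F i).
Proof.
by move=> mF; rewrite /cosets_measurable/= preimage_bigcup; exact: bigcupT_measurable.
Qed.

HB.instance Definition _ := @isMeasurable.Build (sigma_display cosets_measurable)
  cosets cosets_measurable cosets_measurable0 cosets_measurableC
  cosets_measurable_bigcup.

(* (Hx) g = H(xg) *)
Definition coset_mul (q : cosets) (g : G) : cosets := \pi_cosets (repr q * g)%g.

(* nonzero G-invariant Radon measures on H\G; these are unique up to a positive
   factor. *)
Definition invariant_measure (nu : {measure set cosets -> \bar R}) :=
  [/\ nu setT != 0%E,
      forall C : set G, compact C -> (nu (\pi_cosets @` C) < +oo)%E &
      forall g A, measurable A -> nu (coset_mul^~ g @^-1` A) = nu A].

(* Only the restriction of [uchar] to H matters. *)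
Record unitary_character := UnitaryCharacter {
  uchar :> G -> R[i] ;
  ucharM : {in H &, forall g h, uchar (g * h)%g = uchar g * uchar h} ;
  uchar_norm : {in H, forall h, `|uchar h| = 1} ;
  uchar_continuous :
    {within [set` H], continuous (fun g => complex.Re (uchar g))} /\
    {within [set` H], continuous (fun g => complex.Im (uchar g))} }.

(* |phi|^2 and phi * psi^* are left H-invariant: as functions on H\G they are
   evaluated at representatives. *)
Definition Ind (chi : unitary_character) (nu : {measure set cosets -> \bar R}) :
    rep R G :=
  @Rep R G (G -> R[i]^o)
    [set phi : G -> R[i] | [/\ cmeasurable phi,
       forall h g, h \in H -> phi (h * g)%g = chi h * phi g &
       (\int[nu]_q (sqnormC (phi (repr q)))%:E < +oo)%E]]
    (fun phi psi => cintegral nu (fun q => phi (repr q) * (psi (repr q))^*))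
    (fun g0 phi g => phi (g * g0)%g).

End cosets.

Section subgroups.
Context (R : realType) (m n : nat).
Local Notation G := (heis R m n).

Definition GammaL : {pred G} :=
  [pred g | (hlam g \is a mxOver Num.int) && (hmu g \is a mxOver Num.int)].

Definition K : {pred G} :=
  [pred g | (hlam g == 0) && ((hkap g)^T == hkap g)].

Fact GammaL1 : (1%g : G) \in GammaL.
Proof. by apply/andP; split; apply/mxOverP => i j; rewrite mxE rpred0. Qed.

Fact GammaLM : mulg_closed GammaL.
Proof.
move=> g h /andP[/mxOverP lg /mxOverP mg] /andP[/mxOverP lh /mxOverP mh].
by apply/andP; split; apply/mxOverP => i j; rewrite mxE rpredD.
Qed.

Fact GammaLV : invg_closed GammaL.
Proof.
move=> g /andP[/mxOverP lg /mxOverP mg].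
by apply/andP; split; apply/mxOverP => i j; rewrite mxE rpredN.
Qed.

HB.instance Definition _ := isMulClosed.Build G GammaL GammaLM.
HB.instance Definition _ := isMul1Closed.Build G GammaL GammaL1.
HB.instance Definition _ := isInvClosed.Build G GammaL GammaLV.

Fact K1 : (1%g : G) \in K.
Proof. by rewrite inE/= hlam1 hkap1 eqxx/= trmx0. Qed.

Fact KM : mulg_closed K.
Proof.
move=> g h; rewrite !inE/= => /andP[/eqP lg /eqP kg] /andP[/eqP lh /eqP kh].
rewrite hlamM hkapM lg lh addr0 eqxx/= trmx0 mul0mx mulmx0 subr0 addr0.
by rewrite raddfD/= kg kh.
Qed.

Fact KV : invg_closed K.
Proof.
move=> g; rewrite !inE => /andP[/eqP lg /eqP kg].
rewrite hlamV hkapV lg oppr0 eqxx/=.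
by rewrite trmx0 mul0mx mulmx0 subr0 addr0 raddfN/= kg.
Qed.

HB.instance Definition _ := isMulClosed.Build G K KM.
HB.instance Definition _ := isMul1Closed.Build G K K1.
HB.instance Definition _ := isInvClosed.Build G K KV.

Section sigma.
Variable M : 'M[R]_m.

Definition sigma_fun (g : G) : R[i] := expi2pi (\tr (M *m hkap g)).

Fact sigmaM : {in K &, forall g h, sigma_fun (g * h)%g = sigma_fun g * sigma_fun h}.
Proof.
move=> g h; rewrite !inE/= => /andP[/eqP lg _] /andP[/eqP lh _].
rewrite /sigma_fun/expi2pi hkapM lg lh trmx0 mul0mx mulmx0 subr0 addr0.
rewrite mulmxDr mxtraceD mulrDr cosD sinD.
by apply/eqP; rewrite eq_complex/= eqxx/= addrC.
Qed.

Fact sigma_norm : {in K, forall h, `|sigma_fun h| = 1}.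
Proof.
move=> h _; rewrite /sigma_fun /expi2pi normc_def/= cos2Dsin2 sqrtr1.
by [].
Qed.

Fact sigma_continuous :
    {within [set` K], continuous (fun g => complex.Re (sigma_fun g))} /\
    {within [set` K], continuous (fun g => complex.Im (sigma_fun g))}.
Proof.
have c : continuous (fun g : G => 2 * pi * \tr (M *m hkap g)).
  move=> g; apply: (@continuousM R G (fun=> 2 * pi)); first exact: cst_continuous.
  rewrite (_ : (fun _ => _) = fun g : G => \sum_i \sum_j M i j * hkap g j i); last first.
    by apply/funext => h; apply: eq_bigr => i _; rewrite mxE.
  have cs (I : finType) (f : I -> G -> R) :
      (forall i, {for g, continuous (f i)}) ->
      {for g, continuous (fun h => \sum_i f i h)}.
    move=> cf; apply: (@cvg_big _ _ _ _ _ _ _ (nbhs g)) => [|i _]; last exact: cf.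
    exact: add_continuous.
  apply: (cs) => i; apply: (cs) => j.
  apply: (@continuousM R G (fun=> M i j)); first exact: cst_continuous.
  apply: (continuous_comp (f := @hkap R m n) (g := fun N : 'M[R]_m => N j i)).
    apply: (continuous_comp (f := @hval R m n) (g := snd)); last exact: cvg_snd.
    exact: initial_continuous.
  exact: coord_continuous.
split; apply: continuous_subspaceT => g; rewrite /sigma_fun/=.
  by apply: continuous_comp; [exact: c|exact: continuous_cos].
by apply: continuous_comp; [exact: c|exact: continuous_sin].
Qed.

Definition sigma : unitary_character K :=
  UnitaryCharacter sigmaM sigma_norm sigma_continuous.

End sigma.

(* R^{(m,n)} with its Borel sigma-algebra *)
Definition borelM := g_sigma_algebraType (@open 'M[R]_(m, n)).

HB.instance Definition _ := Measurable.on borelM.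

(* Lebesgue measure is the unique Borel measure with the right value on boxes. *)
Definition is_lebesgue (leb : {measure set borelM -> \bar R}) :=
  forall a b : 'M[R]_(m, n), (forall i j, a i j <= b i j) ->
    leb [set x : 'M[R]_(m, n) | forall i j, a i j <= x i j <= b i j] =
    (\prod_i \prod_j (b i j - a i j))%:E.

(* The representation U_M on L^2(R^{(m,n)}) *)
Definition schrodinger (M : 'M[R]_m) (leb : {measure set borelM -> \bar R}) :
    rep R G :=
  @Rep R G (borelM -> R[i]^o)
    [set f : borelM -> R[i] |
       cmeasurable f /\ (\int[leb]_x (sqnormC (f x))%:E < +oo)%E]
    (fun f h => cintegral leb (fun x => f x * (h x)^*))
    (fun g f (xi : 'M[R]_(m, n)) =>
       expi2pi (\tr (M *m (hkap g + hmu g *m (hlam g)^T + 2 *: (xi *m (hmu g)^T))))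
       * f (xi + hlam g)).

End subgroups.

Arguments GammaL {R m n}.
Arguments K {R m n}.

(* Main.v *)
Require Import Defs.
From HB Require Import structures.
From mathcomp Require Import all_boot all_order all_algebra.
From mathcomp Require Import generic_quotient.
From mathcomp Require Import all_classical all_reals all_analysis.
From mathcomp Require Import measurable_realfun.
From mathcomp Require Import complex ring lra.

Set Implicit Arguments.
Unset Strict Implicit.
Unset Printing Implicit Defensive.

Import Order.TTheory GRing.Theory Num.Theory.
Import numFieldNormedType.Exports.

Local Open Scope classical_set_scope.
Local Open Scope ring_scope.

(** A function [f] of the space of Ind_{Gamma_L} is determined by
    F(lambda, mu) = f(lambda, mu, - mu lambda^T), which is periodic in mu and satisfies
    F(lambda + N, mu) = e^{-2 pi i tr(2 M N mu^T)} F(lambda, mu) for integral N.  So its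
    Fourier coefficients in mu satisfy c_k(lambda + N) = c_{k + 2MN}(lambda): those with
    index in a set a_1, ..., a_r of representatives of Z^(m,n) / 2M Z^(m,n), where
    r = (det 2M)^n by the Smith normal form, determine all the others.  By Plancherel on the
    torus and the unfolding of the integral over R^(m,n) into translates of the unit cube,
    f |-> (xi |-> c_{a_j}(xi - alpha_j))_j, with 2M alpha_j = a_j, is up to a constant an
    isometry onto r copies of L^2(R^(m,n)), and the translations by alpha_j make it
    intertwine right translation with U_M.  The invariant measures on the coset spaces are
    identified, up to a constant, with Lebesgue measure by uniqueness of Haar measure, and a
    function of the space of Ind_K is likewise determined by its values at (lambda, 0, 0). *)

(** * Borel structures on matrices and on the Heisenberg group *)

Section borel_matrix.
Context (R : realType).

(** Vectors of a [rep] are functions, not classes, and the intertwiner is a formula applied to every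
    function. Fourier coefficients of a slice that is not integrable are default values, so
    linearity and equivariance are proved only up to null vectors, by almost-everywhere arguments.
    For the same reason only squared norms are compared: they are integrals of nonnegative
    functions, for which Tonelli's theorem, unfolding and the comparison of invariant measures need
    no integrability; polarization then recovers the inner products.

    The analytic core is that a function on the torus whose Fourier coefficients all vanish is zero
    almost everywhere. The sets by whose indicators one may multiply without creating a nonzero
    coefficient form a sigma-algebra; it contains the sublevel sets of the sine and cosine of each
    coordinate, hence all Borel sets of the torus. Surjectivity needs a function with prescribed
    coefficients, hence the completeness of L2 in a quantitative form; Plancherel's identity
    combines both. *)

Lemma measurable_preimage_open d (T : measurableType d) (S : topologicalType)
    (I : countType) (B : I -> set S) (f : T -> S) (O : set S) :
  (forall x (U : set S), nbhs x U -> exists i, B i x /\ B i `<=` U) ->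
  (forall i, measurable (f @^-1` B i)) -> open O -> measurable (f @^-1` O).
Proof.
move=> Bb mB oO.
have -> : f @^-1` O = \bigcup_(i in [set i | B i `<=` O]) (f @^-1` B i).
  apply/seteqP; split => [t Ot|t [i /= iO Bi]]; last exact: iO.
  have [i [Bi iO]] := Bb (f t) O (open_nbhs_nbhs (conj oO Ot)).
  by exists i.
rewrite bigcup_mkcond; apply: countable_bigcupT_measurable => // i.
by case: ifP => _; [exact: mB|exact: measurable0].
Qed.

Definition obox m n (r : 'M[rat]_(m, n) * 'M[rat]_(m, n)) : set 'M[R]_(m, n) :=
  [set x | forall i j, ratr (r.1 i j) < x i j < ratr (r.2 i j)].

Definition cbox m n (a b : 'M[R]_(m, n)) : set 'M[R]_(m, n) :=
  [set x | forall i j, a i j <= x i j <= b i j].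

(** One choice of rational corners serves twice: the open boxes form a countable base, and the
    closed boxes are the sets on which [is_lebesgue] prescribes values. *)
Lemma nbhs_cbox m n (x : 'M[R]_(m, n)) (U : set 'M[R]_(m, n)) :
  nbhs x U -> exists r, obox r x /\ cbox (map_mx ratr r.1) (map_mx ratr r.2) `<=` U.
Proof.
move=> /nbhs_ballP[e /= e0 xeU].
have Hr i j : exists r : rat * rat,
    (x i j - e < ratr r.1 < x i j) /\ (x i j < ratr r.2 < x i j + e).
  have [|a ae] := @rat_in_itvoo R (x i j - e) (x i j); first by lra.
  have [|b be] := @rat_in_itvoo R (x i j) (x i j + e); first by lra.
  by exists (a, b); move: ae be; rewrite !in_itv/=.
have {Hr} Hr : forall p : 'I_m * 'I_n, exists r : rat * rat,
    (x p.1 p.2 - e < ratr r.1 < x p.1 p.2) /\ (x p.1 p.2 < ratr r.2 < x p.1 p.2 + e).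
  by move=> p; exact: Hr.
have [r rP] := choice Hr.
exists (\matrix_(i, j) (r (i, j)).1, \matrix_(i, j) (r (i, j)).2); split.
  by move=> i j /=; rewrite !mxE; have /= := rP (i, j); lra.
move=> y ry; apply: xeU; split => // i j.
have := ry i j; rewrite /= !mxE -ball_normE/= => yr.
by have /= := rP (i, j); rewrite ltr_norml; lra.
Qed.

Lemma nbhs_obox m n (x : 'M[R]_(m, n)) (U : set 'M[R]_(m, n)) :
  nbhs x U -> exists r, obox r x /\ obox r `<=` U.
Proof.
move=> /nbhs_cbox[r [rx rU]]; exists r; split => // y ry; apply: rU => i j.
by rewrite !mxE; case/andP: (ry i j) => /ltW -> /ltW ->.
Qed.

Lemma measurable_preimage_obox d (T : measurableType d) m n
    (f : T -> 'M[R]_(m, n)) r :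
  (forall i j, measurable_fun setT (fun t => f t i j)) ->
  measurable (f @^-1` obox r).
Proof.
move=> mf; have -> : f @^-1` obox r = \bigcap_(p : 'I_m * 'I_n)
    ((fun t => f t p.1 p.2) @^-1` `]ratr (r.1 p.1 p.2), ratr (r.2 p.1 p.2)[%classic).
  apply/seteqP; split => [t tr p _ /=|t tr i j]; first by rewrite in_itv/=; exact: tr.
  by have := tr (i, j) I; rewrite /= in_itv.
apply: fin_bigcap_measurable => // p _.
by rewrite -[X in measurable X]setTI; apply: mf.
Qed.

Lemma measurable_fun_borelM d (T : measurableType d) m n (f : T -> borelM R m n) :
  (forall i j, measurable_fun setT (fun t => f t i j)) -> measurable_fun setT f.
Proof.
move=> mf; refine (@measurability _ _ T (borelM R m n) setT f (@open ('M[R]_(m, n))) _ _) => //.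
move=> _ [V oV <-]; rewrite setTI.
by apply: (measurable_preimage_open (@nbhs_obox m n) _ oV) => r; exact: measurable_preimage_obox.
Qed.

Lemma open_measurable_fun d (T : measurableType d) (S : topologicalType)
    (h : T -> S) (f : S -> R) :
  (forall U, open U -> measurable (h @^-1` U)) -> continuous f ->
  measurable_fun setT (fun t => f (h t)).
Proof.
move=> oS cf; apply: (measurability _ (RGenOInfty.measurableE R)) => _ [_ [x ->] <-].
rewrite setTI; apply: (oS (f @^-1` `]x, +oo[%classic)).
by move/continuousP : cf; apply; exact: rray_open.
Qed.

Lemma measurable_coord m n i j :
  measurable_fun setT (fun x : borelM R m n => x i j).
Proof.
apply: (@open_measurable_fun _ (borelM R m n) 'M[R]_(m, n) id (fun x => x i j)).
  by move=> U oU; exact: sub_sigma_algebra.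
exact: coord_continuous.
Qed.

Section heis.
Context (m n : nat).
Local Notation G := (heis R m n).

Lemma continuous_hval : continuous (@hval R m n : G -> _).
Proof. exact: initial_continuous. Qed.

Lemma continuous_hlam : continuous (@hlam R m n).
Proof.
move=> g; apply: (@continuous_comp _ _ _ (@hval R m n) (fun t => t.1.1)).
  exact: continuous_hval.
apply: (@continuous_comp _ _ _ fst fst); exact: cvg_fst.
Qed.

Lemma continuous_hmu : continuous (@hmu R m n).
Proof.
move=> g; apply: (@continuous_comp _ _ _ (@hval R m n) (fun t => t.1.2)).
  exact: continuous_hval.
apply: (@continuous_comp _ _ _ fst snd); [exact: cvg_fst|exact: cvg_snd].
Qed.

Lemma continuous_hkap : continuous (@hkap R m n).
Proof.
move=> g; apply: (@continuous_comp _ _ _ (@hval R m n) snd).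
  exact: continuous_hval.
exact: cvg_snd.
Qed.

Lemma measurable_heis_coord p q (f : G -> 'M[R]_(p, q)) i j : continuous f ->
  measurable_fun setT (fun g : G => f g i j).
Proof.
move=> cf; apply: (@open_measurable_fun _ G _ id (fun g => f g i j)).
  by move=> U oU; exact: sub_sigma_algebra.
move=> g; apply: (continuous_comp (f := f) (g := fun N : 'M[R]_(p, q) => N i j)).
  exact: cf.
exact: coord_continuous.
Qed.

Lemma measurable_hlam i j : measurable_fun setT (fun g : G => hlam g i j).
Proof. by apply: measurable_heis_coord; exact: continuous_hlam. Qed.

Lemma measurable_hmu i j : measurable_fun setT (fun g : G => hmu g i j).
Proof. by apply: measurable_heis_coord; exact: continuous_hmu. Qed.

Lemma measurable_hkap i j : measurable_fun setT (fun g : G => hkap g i j).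
Proof. by apply: measurable_heis_coord; exact: continuous_hkap. Qed.

Lemma measurable_fun_heis d (T : measurableType d) (f : T -> G) :
  (forall i j, measurable_fun setT (fun t => hlam (f t) i j)) ->
  (forall i j, measurable_fun setT (fun t => hmu (f t) i j)) ->
  (forall i j, measurable_fun setT (fun t => hkap (f t) i j)) ->
  measurable_fun setT f.
Proof.
move=> ml mm mk; refine (@measurability _ _ T G setT f (@open G) _ _) => //.
move=> _ [_ [V oV <-] <-]; rewrite setTI.
pose B r : set ('M[R]_(m, n) * 'M[R]_(m, n) * 'M[R]_m) :=
  (obox r.1.1 `*` obox r.1.2) `*` obox r.2.
apply: (@measurable_preimage_open _ T _ _ B (fun t => hval (f t))) => //.
- move=> [[x y] z] U [[V0 W]] /= [[[V1 V2]] /= [V1x V2y] VV Wz] WU.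
  have [r [rx rV1]] := nbhs_obox V1x.
  have [s [sy sV2]] := nbhs_obox V2y.
  have [t [tz tW]] := nbhs_obox Wz.
  exists (r, s, t); split => //= -[[x' y'] z'] [[/= rx' sy'] tz']; apply: WU.
  by split => /=; [apply: VV; split => /=; [exact: rV1|exact: sV2]|exact: tW].
- move=> [[r s] t]; rewrite (_ : _ @^-1` _ =
      ((fun t => hlam (f t)) @^-1` obox r `&` (fun t => hmu (f t)) @^-1` obox s)
      `&` (fun t => hkap (f t)) @^-1` obox t)//.
  by apply: measurableI; [apply: measurableI|]; exact: measurable_preimage_obox.
Qed.

End heis.
End borel_matrix.

(** * Lebesgue measure, the unit cube and the torus *)

Section lebesgue.
Context (R : realType) (m n : nat).
Local Notation X := (borelM R m n).
Local Notation M_ := 'M[R]_(m, n).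

Definition translate (t : M_) (x : X) : X := (x : M_) + t.

Lemma measurable_translate t : measurable_fun setT (translate t).
Proof.
apply: measurable_fun_borelM => i j; under eq_fun do rewrite mxE.
by apply: measurable_funD; [exact: measurable_coord|exact: measurable_cst].
Qed.

Lemma measurable_cbox (a b : M_) : measurable (cbox a b : set X).
Proof.
have -> : cbox a b = \bigcap_(p : 'I_m * 'I_n)
    ((fun x : X => x p.1 p.2) @^-1` `[a p.1 p.2, b p.1 p.2]%classic).
  apply/seteqP; split => [t tr p _ /=|t tr i j]; first by rewrite in_itv/=; exact: tr.
  by have := tr (i, j) I; rewrite /= in_itv.
apply: fin_bigcap_measurable => // p _.
by rewrite -[X in measurable X]setTI; apply: measurable_coord.
Qed.

Definition cboxes : set (set X) := [set A | exists a b : M_, A = cbox a b].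

Lemma setI_closed_cboxes : setI_closed cboxes.
Proof.
move=> _ _ [a [b ->]] [c [d ->]].
exists (\matrix_(i, j) Num.max (a i j) (c i j)), (\matrix_(i, j) Num.min (b i j) (d i j)).
apply/seteqP; split=> x /=.
  by move=> [ab cd] i j; rewrite !mxE ge_max le_min; move/andP: (ab i j) (cd i j) => [-> ->] /andP[-> ->].
move=> H; split=> i j; have := H i j; rewrite !mxE ge_max le_min.
  by move=> /andP[/andP[-> _] /andP[-> _]].
by move=> /andP[/andP[_ ->] /andP[_ ->]].
Qed.

Lemma borelM_cboxes : @measurable _ X = <<s cboxes >>.
Proof.
apply/seteqP; split; last first.
  apply: smallest_sub; first exact: sigma_algebra_measurable.
  by move=> _ [a [b ->]]; exact: measurable_cbox.
apply: smallest_sub; first exact: smallest_sigma_algebra.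
move=> U oU.
have -> : U = \bigcup_(r in [set r : 'M[rat]_(m, n) * 'M[rat]_(m, n) |
    (cbox (map_mx ratr r.1) (map_mx ratr r.2) : set M_) `<=` U])
    cbox (map_mx ratr r.1) (map_mx ratr r.2).
  apply/seteqP; split=> [x Ux|x [r rU]]; last exact: rU.
  have [r [rx rU]] := nbhs_cbox (open_nbhs_nbhs (conj oU Ux)).
  exists r => // i j; rewrite !mxE.
  by case/andP: (rx i j) => /ltW -> /ltW ->.
rewrite bigcup_mkcond.
apply: (@countable_bigcupT_measurable _ (g_sigma_algebraType cboxes)) => // r.
case: ifP => _; last exact: measurable0.
by apply: sub_sigma_algebra; eexists; eexists.
Qed.

Lemma bigcup_cbox : \bigcup_k (cbox (const_mx (- k%:R)) (const_mx k%:R) : set X) = setT.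
Proof.
apply/seteqP; split=> // x _.
pose k := (\sum_(p : 'I_m * 'I_n) Num.bound (x p.1 p.2))%N.
exists k => // i j; rewrite !mxE -ler_norml.
apply: (le_trans (ltW (archi_boundP (normr_ge0 _)))).
rewrite ler_nat /k (bigD1 (i, j))//= /Num.bound normr_id; exact: leq_addr.
Qed.

Lemma is_lebesgue_unique (mu1 mu2 : {measure set X -> \bar R}) :
  is_lebesgue mu1 -> is_lebesgue mu2 -> forall A, measurable A -> mu1 A = mu2 A.
Proof.
move=> l1 l2 A mA.
(* [is_lebesgue] prescribes boxes with ordered corners; any other box is empty. *)
have e12 (a b : M_) : mu1 (cbox a b) = mu2 (cbox a b).
  have [ab|nab] := pselect (forall i j, a i j <= b i j); first by rewrite l1// l2.
  suff -> : cbox a b = set0 by rewrite !measure0.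
  rewrite -subset0 => x /= xab; apply: nab => i j.
  by have /andP[] := xab i j; exact: le_trans.
apply: (measure_unique cboxes
  (fun k => cbox (const_mx (- k%:R)) (const_mx k%:R))) => //.
- exact: borelM_cboxes.
- exact: setI_closed_cboxes.
- by move=> k; eexists; eexists.
- exact: bigcup_cbox.
- by move=> _ [a [b ->]].
- move=> k; rewrite l1 ?ltry// => i j; rewrite !mxE.
  by rewrite (@le_trans _ _ 0)// oppr_le0.
Qed.

Variable leb : {measure set X -> \bar R}.
Hypothesis lebP : is_lebesgue leb.

(** The pushforward by a translation has the same values on boxes, so uniqueness applies. *)
Lemma leb_translate t A : measurable A -> leb (translate t @^-1` A) = leb A.
Proof.
move=> mA.
pose mu : {measure set X -> \bar R} := measure_function_pushforward__canonical__measure_function_Measure leb (measurable_translate t).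
apply: (@is_lebesgue_unique mu leb) => // a b ab.
rewrite (_ : mu _ = leb (cbox (a - t) (b - t))).
  rewrite lebP; last by move=> i j; rewrite !mxE lerB.
  by congr (_%:E); apply: eq_bigr => i _; apply: eq_bigr => j _; rewrite !mxE; ring.
congr (leb _); apply/seteqP; split=> x /= H i j; have := H i j; rewrite !mxE; lra.
Qed.

Lemma leb_sigma_finite : sigma_finite setT leb.
Proof.
exists (fun k => cbox (const_mx (- k%:R)) (const_mx k%:R)); first by rewrite bigcup_cbox.
move=> k; split; first exact: measurable_cbox.
rewrite lebP ?ltry// => i j; rewrite !mxE.
by rewrite (@le_trans _ _ 0)// oppr_le0.
Qed.

(** Half-open, so that its translates by integral matrices partition the space. *)
Definition cube : set X := [set x | forall i j, 0 <= x i j < 1].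

Lemma measurable_cube : measurable cube.
Proof.
have -> : cube = \bigcap_(p : 'I_m * 'I_n)
    ((fun x : X => x p.1 p.2) @^-1` `[0, 1[%classic).
  apply/seteqP; split => [t tr p _ /=|t tr i j]; first by rewrite in_itv/=; exact: tr.
  by have := tr (i, j) I; rewrite /= in_itv.
apply: fin_bigcap_measurable => // p _.
by rewrite -[X in measurable X]setTI; apply: measurable_coord.
Qed.

(** The closed unit box exceeds [cube] by faces on which one entry equals 1; these are degenerate
    boxes, hence null. *)
Lemma leb_cube : leb cube = 1%E.
Proof.
have l1 : leb (cbox 0 (const_mx 1)) = 1%E.
  rewrite lebP; last by move=> i j; rewrite !mxE.
  by congr (_%:E); rewrite big1// => i _; rewrite big1// => j _; rewrite !mxE subr0.
rewrite -l1; apply/eqP; rewrite eq_le; apply/andP; split.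
  apply: le_measure; rewrite ?inE; [exact: measurable_cube|exact: measurable_cbox|].
  by move=> x Qx i j; rewrite !mxE; have /andP[-> /ltW ->] := Qx i j.
pose face (p : 'I_m * 'I_n) : set X := cbox (\matrix_(i, j) ((i, j) == p)%:R) (const_mx 1).
have face0 p : leb (face p) = 0%E.
  rewrite lebP; last by move=> i j; rewrite !mxE; case: eqP.
  by rewrite (bigD1 p.1)//= (bigD1 p.2)//= !mxE -surjective_pairing eqxx subrr !mul0r.
have sub : (cbox 0 (const_mx 1) : set X) `<=` cube `|` \big[setU/set0]_p face p.
  move=> x xb; have [Qx|nQ] := pselect (cube x); [by left|right].
  have [p xp] : exists p : 'I_m * 'I_n, x p.1 p.2 = 1.
    apply: contra_notP nQ => /forallNP nQ i j.
    have := xb i j; rewrite !mxE => /andP[-> /=]; rewrite le_eqVlt => /orP[/eqP x1|//].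
    by case: (nQ (i, j)).
  rewrite -bigcup_seq; exists p; rewrite /= ?mem_index_enum// => i j; rewrite !mxE.
  have := xb i j; rewrite !mxE => /andP[x0 ->]; rewrite andbT.
  by case: eqP => [ijp|_] //=; move: xp; rewrite -ijp/= => ->.
have [mf f0] : measurable (\big[setU/set0]_p face p) /\
    leb (\big[setU/set0]_p face p) = 0%E.
  apply: (big_ind (fun A : set X => measurable A /\ leb A = 0%E)).
  - by split; [exact: measurable0|exact: measure0].
  - move=> A B [mA A0] [mB B0]; split; first exact: measurableU.
    have e0 : (leb A + leb B <= 0)%E by rewrite A0 B0 adde0.
    by apply/eqP; rewrite -measure_le0; exact: le_trans (measureU2 _ mA mB) e0.
  - by move=> p _; split; [exact: measurable_cbox|exact: face0].
apply: (@le_trans _ _ (leb (cube `|` \big[setU/set0]_p face p))).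
  apply: le_measure => //; rewrite ?inE; first exact: measurable_cbox.
  by apply: measurableU => //; exact: measurable_cube.
have e0 : (leb cube + leb (\big[setU/set0]_p face p) <= leb cube)%E by rewrite f0 adde0.
exact: le_trans (measureU2 _ measurable_cube mf) e0.
Qed.
End lebesgue.

Section lattice.
Context (R : realType) (m n : nat).
Local Notation X := (borelM R m n).
Local Notation M_ := 'M[R]_(m, n).
Local Notation Z_ := 'M[int]_(m, n).

Definition intm (k : Z_) : M_ := map_mx intr k.
Definition floorm (x : M_) : Z_ := map_mx Num.floor x.
Definition fracm (x : M_) : M_ := x - intm (floorm x).

Lemma intmD k l : intm (k + l) = intm k + intm l.
Proof. by apply/matrixP => i j; rewrite !mxE rmorphD. Qed.

Lemma intmN k : intm (- k) = - intm k.
Proof. by apply/matrixP => i j; rewrite !mxE rmorphN. Qed.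

Lemma intm0 : intm 0 = 0.
Proof. by apply/matrixP => i j; rewrite !mxE. Qed.

Lemma floormD x k : floorm (x + intm k) = floorm x + k.
Proof. by apply/matrixP => i j; rewrite !mxE floorDrz ?intrKfloor// intr_int. Qed.

Lemma cube_floorm x : @cube R m n x <-> floorm x = 0.
Proof.
split=> [Qx|/matrixP fx i j].
  by apply/matrixP => i j; rewrite !mxE; apply/eqP; rewrite floor_eq; exact: Qx.
by have /eqP := fx i j; rewrite !mxE floor_eq add0r.
Qed.

Lemma cube_fracm x : @cube R m n (fracm x).
Proof. by apply/cube_floorm; rewrite /fracm -intmN floormD subrr. Qed.

Lemma fracm_id x : @cube R m n x -> fracm x = x.
Proof. by move=> /cube_floorm fx; rewrite /fracm fx intm0 subr0. Qed.

Lemma fracmDint x k : fracm (x + intm k) = fracm x.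
Proof. by rewrite /fracm floormD intmD; apply/matrixP => i j; rewrite !mxE; ring. Qed.

Lemma measurable_floorm i j : measurable_fun setT (fun x : X => ((floorm x i j)%:~R : R)).
Proof.
under eq_fun do rewrite mxE.
apply: (measurableT_comp (f := fun r : R => (Num.floor r)%:~R : R)); last exact: measurable_coord.
by apply: nondecreasing_measurable => // x y xy; rewrite ler_int le_floor.
Qed.

Lemma measurable_fracm : measurable_fun setT (fracm : X -> X).
Proof.
apply: measurable_fun_borelM => i j.
rewrite (_ : (fun _ => _) = (fun x : X => x i j - ((floorm x i j)%:~R : R))); last first.
  by apply/funext => x; rewrite !mxE.
by apply: measurable_funB; [exact: measurable_coord|exact: measurable_floorm].
Qed.

Lemma cube_translate s k x : @cube R m n (x + (s + intm k)) <-> k = - floorm (x + s).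
Proof.
rewrite addrA; split=> [/cube_floorm|->]; last by apply/cube_floorm; rewrite floormD subrr.
by rewrite floormD => /eqP; rewrite addr_eq0 => /eqP ->; rewrite opprK.
Qed.

Definition cell s k : set X := translate (s + intm k) @^-1` @cube R m n.

Lemma measurable_cell s k : measurable (cell s k).
Proof.
by rewrite -[X in measurable X]setTI; apply: measurable_translate => //; exact: measurable_cube.
Qed.

Lemma bigcup_cell (e : nat -> Z_) (e_bij : bijective e) s : \bigcup_i cell s (e i) = setT.
Proof.
apply/seteqP; split=> // x _; case: e_bij => f fe ef.
by exists (f (- floorm (x + s))) => //; apply/cube_translate; rewrite ef.
Qed.

Lemma trivIset_cell (e : nat -> Z_) (e_bij : bijective e) s : trivIset setT (fun i => cell s (e i)).
Proof.
apply/trivIsetP => i j _ _ /eqP ij; rewrite -subset0 => x [/= xi xj]; apply: ij.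
apply: (bij_inj e_bij).
by move/cube_translate : xi => ->; move/cube_translate : xj => ->.
Qed.

Variable leb : {measure set X -> \bar R}.
Hypothesis lebP : is_lebesgue leb.
Local Open Scope ereal_scope.

Lemma ge0_integral_translate t (D : set X) (f : X -> \bar R) :
  measurable D -> measurable_fun D f -> (forall x, D x -> 0 <= f x) ->
  \int[leb]_(x in translate t @^-1` D) f (x + t)%R = \int[leb]_(x in D) f x.
Proof.
move=> mD mf f0.
rewrite -(ge0_integral_pushforward (measurable_translate t) leb mD mf); last first.
  by move=> x /set_mem; exact: f0.
apply: eq_measure_integral => [|mt A mA _]; first exact: measurable_translate.
by rewrite -(leb_translate lebP t mA).
Qed.

(** Haar measure of the torus, carried by the unit cube but defined on all of [X], so that periodic
    functions are integrated without forming a quotient. The proof [H] is an argument because the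
    probability structure depends on it. *)
Definition cubeP (H : is_lebesgue leb) := mrestr leb (@measurable_cube R m n).
HB.instance Definition _ (H : is_lebesgue leb) := Measure.on (cubeP H).
Lemma cubeP_setT (H : is_lebesgue leb) : cubeP H setT = 1.
Proof. by rewrite /cubeP/mrestr setTI; exact: leb_cube. Qed.
HB.instance Definition _ (H : is_lebesgue leb) := Measure_isProbability.Build _ _ _ (cubeP H) (cubeP_setT H).
Local Notation q := (cubeP lebP).

Lemma cubeP_setC : q (~` @cube R m n) = 0.
Proof. exact: eq_trans (congr1 leb (setICl _)) (measure0 leb). Qed.

Lemma cubeP_ae : {ae q, forall x, @cube R m n x}.
Proof.
exists (~` @cube R m n); split => //; first by apply: measurableC; exact: measurable_cube.
exact: cubeP_setC.
Qed.

Lemma ge0_integral_cubeP (f : X -> \bar R) (D : set X) : measurable D ->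
  measurable_fun setT f -> (forall x, 0 <= f x) ->
  \int[q]_(x in D) f x = \int[leb]_(x in D `&` @cube R m n) f x.
Proof.
move=> mD mf f0.
transitivity (\int[q]_(x in D `&` @cube R m n) f x).
  rewrite (ge0_negligible_integral (mu := q) (N := ~` @cube R m n)) ?setDE ?setCK//.
  - by apply: measurableC; exact: measurable_cube.
  - exact: measurable_funTS.
  - exact: cubeP_setC.
apply: eq_measure_integral => A mA AQ; apply: (congr1 leb).
by apply: setIidl => x /AQ[].
Qed.

Variable e : nat -> Z_.
Hypothesis e_bij : bijective e.

Lemma ge0_integral_unfold (f : X -> \bar R) :
  measurable_fun setT f -> (forall x, 0 <= f x) ->
  \int[leb]_x f x = \sum_(i <oo) \int[q]_x f (x + intm (e i))%R.
Proof.
move=> mf f0.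
(* [cell 0 (- e i)] is the cube moved by [e i], and the opposites [- e i] still enumerate the
   lattice. *)
transitivity (\int[leb]_(x in \bigcup_i cell 0 (- e i)%R) f x).
  by rewrite (bigcup_cell (bij_comp (inv_bij (@opprK Z_)) e_bij) 0).
rewrite (ge0_integral_bigcup leb (F := fun i => cell 0 (- e i)%R) (fun i => measurable_cell 0 (- e i)%R)
  (measurable_funTS mf) (fun x _ => f0 x) (@trivIset_cell (fun i => - e i)%R (bij_comp (inv_bij (@opprK Z_)) e_bij) 0%R)).
apply: eq_eseriesr => i _; rewrite ge0_integral_cubeP//; last first.
  exact: (measurableT_comp mf (measurable_translate _)).
rewrite -(ge0_integral_translate (f := f) (intm (e i)))//; [|exact: measurable_cell|exact: measurable_funTS].
congr (integral _ _ _); rewrite setTI; apply/seteqP; split=> x.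
  by rewrite /cell/translate/= intmN add0r addrK.
by rewrite /cell/translate/= intmN add0r addrK.
Qed.

(** The cube moved by [t] is cut along the unit cells, and the cube along the cells moved by [t].
    The pieces match under integral translations, which do not change [f]. *)
Lemma ge0_integral_cubeP_translate (f : X -> \bar R) t :
  measurable_fun setT f -> (forall x, 0 <= f x) ->
  (forall x k, f (x + intm k)%R = f x) ->
  \int[q]_x f (x + t)%R = \int[q]_x f x.
Proof.
move=> mf f0 fper.
have mQt : measurable (translate (- t) @^-1` @cube R m n).
  rewrite -[X in measurable X]setTI; apply: measurable_translate => //.
  exact: measurable_cube.
rewrite ge0_integral_cubeP//; last first.
  exact: (measurableT_comp mf (measurable_translate _)).
rewrite setTI (_ : @cube R m n = translate t @^-1` (translate (- t) @^-1` @cube R m n)); last first.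
  by apply/seteqP; split=> x; rewrite /translate/= addrK.
rewrite ge0_integral_translate//; last exact: measurable_funTS.
rewrite (_ : translate (- t) @^-1` _ =
    \bigcup_i (cell 0 (- e i)%R `&` translate (- t) @^-1` @cube R m n)); last first.
  by rewrite -setI_bigcupl (bigcup_cell (bij_comp (inv_bij (@opprK Z_)) e_bij) 0) setTI.
rewrite ge0_integral_bigcup//; last 3 first.
- by move=> i; apply: measurableI => //; exact: measurable_cell.
- exact: measurable_funTS.
- exact/trivIset_setIr/(trivIset_cell (bij_comp (inv_bij (@opprK Z_)) e_bij)).
rewrite -[in RHS](bigcup_cell e_bij (- t)).
rewrite (ge0_integral_bigcup q (F := fun i => cell (- t) (e i)) (fun i => measurable_cell (- t) (e i))
  (measurable_funTS mf) (fun x _ => f0 x) (@trivIset_cell e e_bij (- t)%R)).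
apply: eq_eseriesr => i _; rewrite ge0_integral_cubeP//; last exact: measurable_cell.
rewrite -(ge0_integral_translate (intm (e i))
  (D := cell 0 (- e i)%R `&` translate (- t) @^-1` @cube R m n))//; last 2 first.
- exact: measurableI (measurable_cell _ _) mQt.
- exact: measurable_funTS.
transitivity (\int[leb]_(x in translate (intm (e i)) @^-1` (cell 0 (- e i)%R `&` translate (- t) @^-1` @cube R m n)) f x).
  by apply: eq_integral => x _; rewrite fper.
congr (integral _ _ _); apply/seteqP; split=> x; rewrite /cell/translate/= intmN add0r addrK.
  by rewrite -addrA (addrC (intm _)) => -[].
by rewrite -[(x + _ - t)%R]addrA (addrC (intm _)) => -[].
Qed.
End lattice.
Arguments fracm {R m n} x.
Arguments floorm {R m n} x.
Arguments intm {R m n} k.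

(** * Uniqueness of translation-invariant measures *)

Section sigma_finite_pack.
Context d (T : measurableType d) (R : realType).
Variable mu : {measure set T -> \bar R}.
Hypothesis mufin : sigma_finite setT mu.

(** The term keeps the proof [mufin], so that a measure known to be sigma-finite only by hypothesis
    can enter product measures. *)
Definition sigma_finite_pack of sigma_finite setT mu : set T -> \bar R := mu.
Local Notation sfp := (sigma_finite_pack mufin).
HB.instance Definition _ := Measure.on sfp.
HB.instance Definition _ := Measure_isSigmaFinite.Build _ _ _ sfp mufin.
End sigma_finite_pack.

Section haar.
Context (R : realType) (m n : nat).
Local Notation X := (borelM R m n).
Local Notation M_ := 'M[R]_(m, n).
Local Notation Z_ := 'M[int]_(m, n).
Local Open Scope ereal_scope.

(** Positivity of [m] and [n] makes the lattice infinite; otherwise it is a single point. *)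
Lemma exists_enum : (0 < m)%N -> (0 < n)%N -> exists e : nat -> Z_, bijective e.
Proof.
move=> m0 n0.
have inf : infinite_set [set: Z_].
  apply/infiniteP; rewrite -(preimage_setT (fun k : nat => const_mx k%:Z : Z_)).
  apply: card_ge_preimage => k l _ _ /matrixP/(_ (Ordinal m0) (Ordinal n0)).
  by rewrite !mxE => -[].
have /card_set_bijP[f] := eq_card_nat (countableP _) inf.
by rewrite setTT_bijective => -[g fg gf]; exists g; exists f.
Qed.

Lemma product_measure_sections d1 d2 (T1 : measurableType d1) (T2 : measurableType d2)
  (m1 : {sigma_finite_measure set T1 -> \bar R})
  (m2 : {sigma_finite_measure set T2 -> \bar R}) (B : set (T1 * T2)) :
  measurable B -> \int[m1]_x m2 (xsection B x) = \int[m2]_y m1 (ysection B y).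
Proof.
move=> mB; apply: (@product_measure_unique _ _ _ _ R m1 m2 (m1 \x^ m2) _ _ mB) => A C mA mC.
exact: product_measure2E.
Qed.

Lemma measurable_addX : measurable_fun setT (fun p : X * X => (p.1 + p.2 : M_)%R : X).
Proof.
apply: measurable_fun_borelM => i j; under eq_fun do rewrite mxE.
by apply: measurable_funD; apply: (measurableT_comp (@measurable_coord R m n i j));
  [exact: measurable_fst|exact: measurable_snd].
Qed.

Lemma measurable_subX : measurable_fun setT (fun p : X * X => (p.2 - p.1 : M_)%R : X).
Proof.
apply: measurable_fun_borelM => i j; under eq_fun do rewrite !mxE.
by apply: measurable_funB; apply: (measurableT_comp (@measurable_coord R m n i j));
  [exact: measurable_snd|exact: measurable_fst].
Qed.

Variable leb : {measure set X -> \bar R}.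
Hypothesis lebP : is_lebesgue leb.
Local Notation q := (cubeP lebP).

Lemma cubeP_fracm A : measurable A -> q ((@fracm R m n : X -> X) @^-1` A) = q A.
Proof.
move=> mA; apply: (congr1 leb); apply/seteqP; split=> x [xA Qx]; split=> //.
  by move: xA; rewrite /= fracm_id.
by rewrite /= fracm_id.
Qed.

Variable e : nat -> Z_.
Hypothesis e_bij : bijective e.

Lemma cubeP_fracm_translate t A : measurable A ->
  q ((fun x : X => fracm (x + t) : X) @^-1` A) = q A.
Proof.
move=> mA.
have mfA : measurable ((@fracm R m n : X -> X) @^-1` A).
  by rewrite -[X in measurable X]setTI; exact: measurable_fracm.
rewrite -(cubeP_fracm mA).
have qE B : measurable B -> q B = \int[q]_x (\1_B x)%:E.
  by move=> mB; rewrite integral_indic//; congr (q _); rewrite setIT.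
have mftA : measurable ((fun x : X => fracm (x + t) : X) @^-1` A).
  rewrite -[X in measurable X]setTI.
  exact: (measurableT_comp (@measurable_fracm R m n) (measurable_translate t)).
rewrite (qE _ mftA) (qE _ mfA).
apply: (ge0_integral_cubeP_translate lebP e_bij
  (f := fun x => (\1_((@fracm R m n : X -> X) @^-1` A) x)%:E) t).
- by apply/measurable_EFinP; exact: measurable_indic.
- by move=> x; rewrite lee_fin.
- by move=> x k; rewrite !indicE; congr (_%:E); congr (_%:R); congr nat_of_bool;
    apply/idP/idP; rewrite !inE/= fracmDint.
Qed.

(** The set of pairs whose sum has its fractional part in [A] is measured in both orders: invariance
    of [q] gives [q A * rho setT], invariance of [rho] gives [rho A]. *)
Lemma torus_haar (rho : {measure set X -> \bar R}) : rho setT < +oo ->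
  (forall t A, measurable A -> rho ((fun x : X => fracm (x + t)%R : X) @^-1` A) = rho A) ->
  forall A, measurable A -> rho A = rho setT * q A.
Proof.
move=> rhofin rhoT A mA.
have rhosf : sigma_finite setT rho.
  by exists (fun=> setT) => [|_]; [rewrite bigcup_const|split].
pose rho' := sigma_finite_pack rhosf.
pose B : set (X * X) := (fun p : X * X => fracm (p.1 + p.2 : M_)%R : X) @^-1` A.
have mB : measurable B.
  rewrite -[X in measurable X]setTI.
  exact: (measurableT_comp (@measurable_fracm R m n) measurable_addX).
have e1 : \int[rho]_x q (xsection B x) = q A * rho setT.
  rewrite -integral_cst//; apply: eq_integral => x _ /=.
  rewrite -[RHS](cubeP_fracm_translate x mA); apply: (congr1 q).
  by apply/seteqP; split=> y; rewrite /xsection/= inE/= addrC.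
have e2 : \int[q]_y rho (ysection B y) = rho A.
  rewrite -[RHS]mule1 -(cubeP_setT lebP) -integral_cst//; apply: eq_integral => y _ /=.
  rewrite -(rhoT y A mA); apply: (congr1 rho).
  by apply/seteqP; split=> x; rewrite /ysection/= inE/=.
by rewrite -e2 muleC -e1; exact/esym/(product_measure_sections rho' q mB).
Qed.

(* The measure of [{(x, y) | x + y \in A, y \in cube}] computed by Fubini in both
   orders, after the substitution [y := y - x]. *)
Lemma euclidean_haar (nu : {measure set X -> \bar R}) : sigma_finite setT nu ->
  (forall t A, measurable A -> nu (translate t @^-1` A) = nu A) ->
  forall A, measurable A ->
  nu A = nu ((fun x : X => (- (x : M_))%R : X) @^-1` @cube R m n) * leb A.
Proof.
move=> nusf nuT A mA.
pose nu' := sigma_finite_pack nusf.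
pose leb' := sigma_finite_pack (leb_sigma_finite lebP).
pose B1 : set (X * X) := (fun p : X * X => (p.1 + p.2 : M_)%R : X) @^-1` A `&` snd @^-1` @cube R m n.
pose B2 : set (X * X) := snd @^-1` A `&` (fun p : X * X => (p.2 - p.1 : M_)%R : X) @^-1` @cube R m n.
have mQ := @measurable_cube R m n.
have mB1 : measurable B1.
  by apply: measurableI; rewrite -[X in measurable X]setTI;
    [exact: measurable_addX|exact: measurable_snd].
have mB2 : measurable B2.
  by apply: measurableI; rewrite -[X in measurable X]setTI;
    [exact: measurable_snd|exact: measurable_subX].
have e1 := product_measure_sections nu' leb' mB1.
have e2 := product_measure_sections nu' leb' mB2.
have e3 : \int[leb']_y nu' (ysection B1 y) = \int[leb']_y nu' (ysection B2 y).
  rewrite -e1 -e2; apply: eq_integral => x _.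
  rewrite /leb'/sigma_finite_pack -(leb_translate lebP (- x) (measurable_xsection _ mB1)).
  congr (leb _); apply/seteqP; split=> y; rewrite /xsection/B1/B2/translate/= !inE/= ?inE/=.
    by rewrite addrC subrK.
  by rewrite [(x + _)%R]addrC subrK.
have ind (c : \bar R) (C : set X) (g : X -> \bar R) : measurable C -> 0 <= c ->
    (forall y, C y -> g y = c) -> (forall y, ~ C y -> g y = 0) ->
    \int[leb']_y g y = c * leb C.
  move=> mC c0 gC gN.
  rewrite -[leb C]/(leb' C) -integral_cst// [RHS]integral_mkcond.
  apply: eq_integral => y _; rewrite patchE; case: ifPn => [/set_mem/gC//|/negP yC].
  by apply: gN => Cy; apply: yC; exact: mem_set.
have lQ := ind (nu A) _ (fun y => nu' (ysection B1 y)) mQ (measure_ge0 _ _).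
have lA := ind (nu ((fun x : X => (- (x : M_))%R : X) @^-1` @cube R m n)) _
  (fun y => nu' (ysection B2 y)) mA (measure_ge0 _ _).
rewrite -lA; last 2 first.
- move=> y Ay.
  have mNQ : measurable ((fun x : X => (- (x : M_))%R : X) @^-1` @cube R m n).
    rewrite -[X in measurable X]setTI; apply: measurable_fun_borelM => // i j.
    by under eq_fun do rewrite mxE; apply: measurable_funN; exact: measurable_coord.
  rewrite -(nuT (- y)%R _ mNQ); apply: (congr1 nu).
  apply/seteqP; split=> x; rewrite /ysection/B2/translate/= inE/= opprD opprK addrC.
    by case.
  by split.
- move=> y nAy; rewrite (_ : ysection _ _ = set0) ?measure0// -subset0 => x.
  by rewrite /ysection/B2/= inE/= => -[].
rewrite -e3 lQ ?leb_cube ?mule1//.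
- move=> y Qy; rewrite -(nuT y _ mA); apply: (congr1 nu).
  by apply/seteqP; split=> x; rewrite /ysection/B1/translate/= inE/= => // -[].
- move=> y nQy; rewrite (_ : ysection _ _ = set0) ?measure0// -subset0 => x.
  by rewrite /ysection/B1/= inE/= => -[].
Qed.

End haar.

(** * Cosets of the lattice 2M Z^(m,n) *)

Section posdef.
Context (R : realType) (m : nat).

(** On the segment from the identity to [M] every matrix is positive definite, so the determinant, a
    polynomial in the parameter, has no root there; it is 1 at the start and cannot change sign. *)
Lemma posdef_det_gt0 (M : 'M[R]_m) : posdef M -> 0 < \det M.
Proof.
move=> Mpos.
have v2 (v : 'rV[R]_m) : v != 0 -> 0 < (v *m v^T) 0 0.
  move=> v0; rewrite mxE; have [j vj] : exists j, v 0 j != 0.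
    apply/not_existsP => nv; move/eqP : v0; apply; apply/rowP => j; rewrite mxE.
    by apply/eqP/negPn/negP => /(nv j).
  rewrite (bigD1 j)//= mxE ltr_wpDr//; last by rewrite -expr2 exprn_even_gt0.
  by apply: sumr_ge0 => k _; rewrite mxE -expr2 sqr_ge0.
pose P : 'M[{poly R}]_m := 'X *: map_mx polyC M + (1 - 'X) *: 1%:M.
have PE t : (\det P).[t] = \det (t *: M + (1 - t) *: 1%:M).
  rewrite -horner_evalE -det_map_mx; congr (\det _); apply/matrixP => i j.
  by rewrite !mxE/= /horner_eval !hornerE; case: (i == j); rewrite ?hornerE.
have nz t : 0 <= t <= 1 -> (\det P).[t] != 0.
  move=> /andP[t0 t1]; rewrite PE; apply/negP => /det0P[v v0 vA].
  have : (v *m (t *: M + (1 - t) *: 1%:M) *m v^T) 0 0 = 0 by rewrite vA mul0mx mxE.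
  rewrite mulmxDr mulmxDl -!scalemxAr -!scalemxAl mulmx1 mxE [X in X + _]mxE [X in _ + X]mxE.
  have := Mpos v v0; have := v2 v v0.
  move: (_ 0 0) ((v *m M *m v^T) 0 0) => a b a0 b0 ab.
  (* One of the weights [t] and [1 - t] is at least one half, which keeps the sum positive. *)
  have [t12|t12] := leP t 2^-1; nra.
have P0 : (\det P).[0] = 1 by rewrite PE scale0r add0r subr0 scale1r det1.
have P1 : (\det P).[1] = \det M by rewrite PE scale1r subrr scale0r addr0.
rewrite -P1 ltNge; apply/negP => P1le.
have [||t t01] := @poly_ivt R (- \det P) 0 1.
- exact: ler01.
- by rewrite !hornerN P0 !oppr_le0 ler01/= oppr_ge0.
rewrite rootN => /rootP t0; move: (nz t); rewrite t0 eqxx.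
by rewrite t01 => /(_ isT).
Qed.

End posdef.

Section lattice_cosets.

(** With [A = L *m D *m U] in Smith form, representatives are the [L *m r] where row [i] of [r]
    consists of remainders modulo the [i]-th diagonal entry of [D]. Each of the [n] columns
    contributes the product of the absolute values of these entries, which is that of [\det A]. *)
Lemma lattice_cosets m n (A : 'M[int]_m) : \det A != 0 ->
  exists (N : nat) (a : 'I_N -> 'M[int]_(m, n)), N = (`|\det A| ^ n)%N /\
  bijective (fun p : 'I_N * 'M[int]_(m, n) => A *m p.2 + a p.1).
Proof.
move=> dA; have [L uL [U uU [d _ AE]]] := int_Smith_normal_form A.
pose D : 'M[int]_m := diag_mx (\row_j d`_j).
have {}AE : A = L *m D *m U.
  rewrite AE; congr (_ *m _ *m _); apply/matrixP => i j; rewrite !mxE.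
  by rewrite -val_eqE/=; case: eqP => // ->.
have dD : \det D = \prod_(i < m) d`_i.
  by rewrite det_diag; apply: eq_bigr => i _; rewrite mxE.
have d0 (i : 'I_m) : d`_i != 0.
  apply: contra dA => /eqP di0; rewrite AE !det_mulmx dD (bigD1 i)//= di0.
  by rewrite mul0r mulr0 mul0r.
pose c (p : 'I_m * 'I_n) := `|(d`_p.1)%R|%N.
pose I := {dffun forall p : 'I_m * 'I_n, 'I_(c p)}.
pose rm (r : I) : 'M[int]_(m, n) := \matrix_(i, j) (r (i, j) : nat)%:Z.
have cardI : #|{: I}| = (`|\det A| ^ n)%N.
  rewrite card_dep_ffun foldrE big_image/=.
  under eq_bigr do rewrite card_ord.
  rewrite -(pair_bigA _ (fun (i : 'I_m) (_ : 'I_n) => `|(d`_i)%R|%N))/=.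
  under eq_bigr do rewrite prod_nat_const card_ord.
  rewrite -(big_morph (fun k => (k ^ n)%N) (fun x y => expnMn x y n) (exp1n n)).
  congr (_ ^ _)%N; rewrite AE !det_mulmx !abszM dD.
  have unit1 (x : int) : x \is a GRing.unit -> `|x|%N = 1%N.
    by rewrite qualifE/= => /orP[/eqP->|/eqP->].
  rewrite (unit1 (\det L)) ?(unit1 (\det U))//.
  by rewrite mul1n muln1 (big_morph absz abszM (erefl _)).
have cE (r : I) i j : (rm r i j %% d`_i)%Z = rm r i j.
  rewrite mxE -modz_abs modz_small//= ltz_nat; exact: ltn_ord.
pose f (p : I * 'M[int]_(m, n)) : 'M[int]_(m, n) := A *m p.2 + L *m rm p.1.
have f_bij : bijective f.
  have lt_rem (k : 'M[int]_(m, n)) (p : 'I_m * 'I_n) :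
      (`|((invmx L *m k) p.1 p.2 %% d`_p.1)%Z|%N < c p)%N.
    rewrite -ltz_nat gez0_abs ?modz_ge0//; exact: ltz_mod.
  (* Inverse map: division with remainder of the entries of [invmx L *m k] by the diagonal of
     [D]. *)
  pose g (k : 'M[int]_(m, n)) : I * 'M[int]_(m, n) :=
    (finfun (fun p => Ordinal (lt_rem k p)) : I,
     invmx U *m \matrix_(i, j) ((invmx L *m k) i j %/ d`_i)%Z).
  have rmg k : rm (g k).1 = \matrix_(i, j) ((invmx L *m k) i j %% d`_i)%Z.
    by apply/matrixP => i j; rewrite [LHS]mxE [RHS]mxE /= ffunE/= gez0_abs ?modz_ge0.
  have Dmul (k1 : 'M[int]_(m, n)) : D *m k1 = \matrix_(i, j) (d`_i * k1 i j).
    by apply/matrixP => i j; rewrite mul_diag_mx !mxE.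
  exists g => [[r k]|k]; last first.
    rewrite /f rmg /= AE -!mulmxA mulKVmx// -mulmxDr Dmul.
    rewrite -[RHS](mulKVmx uL); congr (L *m _); apply/matrixP => i j; rewrite !mxE.
    by rewrite [RHS](divz_eq _ d`_i) mulrC.
  have gf : invmx L *m f (r, k) = \matrix_(i, j) (d`_i * (U *m k) i j) + rm r.
    by rewrite /f /= mulmxDr mulKmx// AE -!mulmxA mulKmx// Dmul.
  rewrite /g; congr pair.
    apply/ffunP => -[i j]; rewrite ffunE; apply/val_inj => /=.
    rewrite gf [X in `|(X %% _)%Z|%N]mxE [X in (X + _)]mxE mulrC modzMDl cE.
    by rewrite mxE.
  rewrite gf -[RHS](mulKmx uU); congr (_ *m _); apply/matrixP => i j; rewrite !mxE.
  rewrite mulrC divzMDl// divz_small ?addr0//.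
  by rewrite /= ltz_nat; exact: (ltn_ord (r (i, j))).
exists #|{: I}|, (fun i => L *m rm (enum_val i)); split => //.
have h_bij : bijective (fun p : 'I_#|{: I}| * 'M[int]_(m, n) => (enum_val p.1, p.2) : I * 'M[int]_(m, n)).
  exists (fun p : I * 'M[int]_(m, n) => (enum_rank p.1 : 'I_#|{: I}|, p.2)) => -[x y] /=.
    by rewrite enum_valK.
  by rewrite enum_rankK.
exact: (bij_comp f_bij h_bij).
Qed.

End lattice_cosets.

(** * Invariant measures on the coset spaces *)

Section sections.
Context (R : realType) (m n : nat).
Local Notation X := (borelM R m n).
Local Notation M_ := 'M[R]_(m, n).
Local Notation G := (heis R m n).

Fact hel_subproof (l u : M_) (s : 'M[R]_m) : s^T = s -> heis_pred (l, u, s - u *m l^T).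
Proof. by move=> ss; rewrite /heis_pred/= subrK; apply/eqP. Qed.

(** The symmetric matrix [s] is [hkap + hmu *m hlam^T], so [l], [u], [s] are independent coordinates
    on the group; [hsec] is the slice [s = 0]. *)
Definition hel l u s (ss : s^T = s) : G := Heis (@hel_subproof l u s ss).
Definition hsec (l u : M_) : G := hel l u (trmx0 R m m).

Lemma hlam_hsec l u : hlam (hsec l u) = l. Proof. by []. Qed.
Lemma hmu_hsec l u : hmu (hsec l u) = u. Proof. by []. Qed.
Lemma hkap_hsec l u : hkap (hsec l u) = - (u *m l^T).
Proof. exact: sub0r. Qed.

Lemma mx_continuous (T : topologicalType) p r (f : T -> 'M[R]_(p, r)) :
  (forall i j, continuous (fun t => f t i j)) -> continuous f.
Proof.
move=> cf t A [P tP PA].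
have : \forall x \near t, forall ij : 'I_p * 'I_r, P ij.1 ij.2 (f x ij.1 ij.2).
  by apply: filter_forall => -[i j]; exact: (cf i j t _ (tP i j)).
by apply: filterS => x H; apply: PA => i j; exact: (H (i, j)).
Qed.

Lemma continuous_sum (T : topologicalType) (I : finType) (f : I -> T -> R) :
  (forall i, continuous (f i)) -> continuous (fun t => \sum_i f i t).
Proof.
move=> cf t; apply: (@cvg_big _ _ _ _ _ _ _ (nbhs t)) => [|i _]; last exact: cf.
exact: add_continuous.
Qed.

Definition hbox (k : nat) : set G :=
  [set g | exists l u : M_, [/\ forall i j, `|l i j| <= k%:R, forall i j, `|u i j| <= k%:R & g = hsec l u]].

(** Invariant measures are only assumed finite on images of compact sets; these images supply the
    sigma-finiteness over [K] and the finiteness over [GammaL]. *)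
Lemma compact_hbox k : compact (hbox k).
Proof.
pose N := (m * n + m * n)%N.
pose D : set 'rV[R]_N := [set v | forall i, `[- k%:R, k%:R]%classic (v ord0 i)].
have cD : compact D.
  apply: (@rV_compact R N (fun=> `[- k%:R, k%:R]%classic)) => i; exact: segment_compact.
pose l (v : 'rV[R]_N) : M_ := vec_mx (lsubmx v).
pose u (v : 'rV[R]_N) : M_ := vec_mx (rsubmx v).
have cl i j : continuous (fun v => l v i j).
  by move=> v; rewrite (_ : (fun v => _) = fun v : 'rV[R]_N => v 0 (lshift _ (mxvec_index i j)));
    [exact: coord_continuous|apply/funext => w; rewrite /l !mxE].
have cu i j : continuous (fun v => u v i j).
  by move=> v; rewrite (_ : (fun v => _) = fun v : 'rV[R]_N => v 0 (rshift _ (mxvec_index i j)));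
    [exact: coord_continuous|apply/funext => w; rewrite /u !mxE].
pose f v := hsec (l v) (u v).
have cf : continuous f.
  have chf : continuous (fun v => hval (f v)).
    have chk : continuous (fun v => hkap (f v)); last first.
      move=> v; pose lu v := (l v, u v).
      have clu : lu v @[v --> v] --> lu v by exact: (cvg_pair (mx_continuous cl (x := v)) (mx_continuous cu (x := v))).
      exact: (cvg_pair clu (chk v)).
    apply: mx_continuous => i j w.
    rewrite (_ : (fun t => _) = fun v => - \sum_p u v i p * l v j p); last first.
      apply/funext => t; rewrite hkap_hsec mxE mxE; congr (- _).
      by apply: eq_bigr => p _; rewrite [X in _ * X]mxE.
    have cs : continuous (fun v => \sum_p u v i p * l v j p).
      apply: (@continuous_sum _ _ (fun p v => u v i p * l v j p)) => p z.
      exact: (@continuousM R _ (fun v => u v i p) (fun v => l v j p) z (cu i p z) (cl j p z)).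
    exact: (@continuousN _ _ _ (fun v => \sum_p u v i p * l v j p) w (cs w)).
  apply/continuousP => _ [V oV <-].
  by move/continuousP : chf => /(_ V oV).
have -> : hbox k = f @` D.
  apply/seteqP; split=> [_ [l' [u' [lk uk ->]]]|_ [v Dv <-]].
    exists (row_mx (mxvec l') (mxvec u')).
      move=> i /=; rewrite in_itv/= -ler_norml mxE; case: (fintype.split i) => j.
        by case/mxvec_indexP : j => a b; rewrite mxvecE.
      by case/mxvec_indexP : j => a b; rewrite mxvecE.
    by rewrite /f /l /u row_mxKl row_mxKr !mxvecK.
  exists (l v), (u v); split => // i j; rewrite /l /u !mxE ler_norml; move: (Dv) => /=.
    by move=> /(_ (lshift _ (mxvec_index i j))).
  by move=> /(_ (rshift _ (mxvec_index i j))).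
apply: continuous_compact => //.
exact: continuous_subspaceT.
Qed.

End sections.

Local Open Scope quotient_scope.

Section cosets_measure.
Context (R : realType) (m n : nat) (H : groupClosed (heis R m n)).
Local Notation G := (heis R m n).

Lemma pi_cosets_eq (g g' : G) : (g * g'^-1)%g \in H -> \pi_(cosets H) g = \pi_(cosets H) g'.
Proof. by move=> gg'; apply/eqmodP. Qed.

Lemma repr_pi (g : G) : exists2 h, h \in H & repr (\pi_(cosets H) g) = (h * g)%g.
Proof.
have : repr (\pi_(cosets H) g) = g %[mod cosets H] by rewrite reprK.
move=> /eqmodP gH; exists (repr (\pi_(cosets H) g) * g^-1)%g => //.
by rewrite mulgVK.
Qed.

Lemma measurable_cosets_fun d (T : measurableType d) (f : cosets H -> T) :
  measurable_fun setT (f \o \pi_(cosets H)) -> measurable_fun setT f.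
Proof.
by move=> mf _ A mA; rewrite setTI; have := mf measurableT A mA; rewrite setTI.
Qed.

End cosets_measure.

Section coset_integrals.
Context (R : realType) (m n : nat).
Hypotheses (m_gt0 : (0 < m)%N) (n_gt0 : (0 < n)%N).
Local Notation X := (borelM R m n).
Local Notation M_ := 'M[R]_(m, n).
Local Notation Z_ := 'M[int]_(m, n).
Local Notation G := (heis R m n).
Variable leb : {measure set X -> \bar R}.
Hypothesis lebP : is_lebesgue leb.
Local Notation q := (cubeP lebP).
Local Open Scope ereal_scope.

Lemma measurable_hlamX : measurable_fun setT (@hlam R m n : G -> X).
Proof. by apply: measurable_fun_borelM => i j; exact: measurable_hlam. Qed.

Lemma measurable_hmuX : measurable_fun setT (@hmu R m n : G -> X).
Proof. by apply: measurable_fun_borelM => i j; exact: measurable_hmu. Qed.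

Lemma measurable_hsec : measurable_fun setT (fun p : X * X => hsec p.1 p.2 : G).
Proof.
have m1 i j : measurable_fun setT (fun p : X * X => p.1 i j).
  exact: (measurableT_comp (@measurable_coord R m n i j) measurable_fst).
have m2 i j : measurable_fun setT (fun p : X * X => p.2 i j).
  exact: (measurableT_comp (@measurable_coord R m n i j) measurable_snd).
apply: measurable_fun_heis => i j; [exact: m1|exact: m2|].
under eq_fun do rewrite hkap_hsec mxE mxE.
apply: measurable_funN; apply: measurable_sum => k.
under eq_fun do rewrite [X in (_ * X)%R]mxE.
exact: measurable_funM.
Qed.

Section line.
Variable nu : {measure set (cosets (@K R m n)) -> \bar R}.
Hypothesis nu_inv : invariant_measure nu.

(** Coordinate on the coset space: once [hlam] vanishes, [hkap] is automatically symmetric, so two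
    elements with the same [hlam] lie in the same coset of [K]. *)
Let c (x : cosets (@K R m n)) : X := hlam (repr x).

Let cpi g : c (\pi_(cosets (@K R m n)) g) = hlam g.
Proof.
rewrite /c; have [h + ->] := repr_pi K g.
by rewrite inE => /andP[/eqP h0 _]; rewrite hlamM h0 add0r.
Qed.

Let mc : measurable_fun setT c.
Proof.
apply: measurable_cosets_fun; rewrite (_ : _ \o _ = @hlam R m n); first exact: measurable_hlamX.
by apply/funext => g; exact: cpi.
Qed.

Let hsecK (g : G) : exists2 h, h \in K & hsec (hlam g) 0 = (h * g)%g.
Proof.
exists (hsec (hlam g) 0 * g^-1)%g; last by rewrite mulgVK.
rewrite inE hlamM hlamV hlam_hsec subrr eqxx/=.
have := heis_sym (hsec (hlam g) 0 * g^-1)%g.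
by rewrite hlamM hlamV hlam_hsec subrr trmx0 mulmx0 addr0 => ->.
Qed.

(** The pushforward of [nu] by [c] is translation-invariant, and finite on boxes because these come
    from the compact sets [hbox]; [euclidean_haar] applies. [C] is its mass of the reflected unit
    cube, finite for the same reason and nonzero because [nu] is. *)
Lemma line_integral : exists2 C : R, (0 < C)%R & forall f : G -> \bar R,
  measurable_fun setT f -> (forall g, 0 <= f g) ->
  (forall h g, h \in K -> f (h * g)%g = f g) ->
  \int[nu]_x f (repr x) = C%:E * \int[leb]_x f (hsec x 0).
Proof.
have [nu0 nucpt nuT] := nu_inv.
pose rho : {measure set X -> \bar R} :=
  measure_function_pushforward__canonical__measure_function_Measure nu mc.
have rho_cbox k : rho (cbox (const_mx (- k%:R)%R) (const_mx k%:R%R)) < +oo.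
  apply: le_lt_trans (nucpt _ (@compact_hbox R m n k)).
  rewrite le_eqVlt; apply/orP; left; apply/eqP; congr (nu _).
  apply/seteqP; split=> [x xk|_ [_ [l [u [lk uk ->]]] <-]].
    exists (hsec (c x) 0).
      exists (c x), 0%R; split => // i j; last by rewrite mxE normr0.
      by have := xk i j; rewrite !mxE ler_norml.
    have [h hK E] := hsecK (repr x).
    rewrite -[RHS]reprK; apply: pi_cosets_eq.
    by rewrite /c E mulgK.
  by move=> i j; rewrite cpi hlam_hsec !mxE -ler_norml.
have rhosf : sigma_finite setT rho.
  exists (fun k => cbox (const_mx (- k%:R)%R) (const_mx k%:R%R)); first by rewrite bigcup_cbox.
  by move=> k; split; [exact: measurable_cbox|exact: rho_cbox].
have rhoT t A : measurable A -> rho (translate t @^-1` A) = rho A.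
  move=> mA; rewrite -[RHS](nuT (hsec t 0) (c @^-1` A)); last first.
    by rewrite -[X in measurable X]setTI; exact: mc.
  congr (nu _); apply/seteqP; split=> x /=; by rewrite /translate /coset_mul cpi hlamM.
have rhoE := euclidean_haar lebP rhosf rhoT.
set C := rho _ in rhoE.
have Cfin : C < +oo.
  apply: le_lt_trans (rho_cbox 1%N); apply: le_measure; rewrite ?inE.
  - rewrite -[X in measurable X]setTI; apply: (_ : measurable_fun _ _) => //; last exact: measurable_cube.
    apply: measurable_fun_borelM => i j; under eq_fun do rewrite mxE.
    by apply: measurable_funN; exact: measurable_coord.
  - exact: measurable_cbox.
  - move=> x Qx i j; have := Qx i j; rewrite !mxE; lra.
have C0 : 0 <= C by exact: measure_ge0.
have CE : C = (fine C)%:E by rewrite fineK// ge0_fin_numE.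
exists (fine C).
  rewrite lt_neqAle fine_ge0// andbT; apply/eqP => C00.
  move/eqP : nu0; apply; rewrite -[LHS]/(rho setT) rhoE//.
  by rewrite CE -C00 mul0e.
move=> f mf f0 fK.
have mfs : measurable_fun setT (fun x : X => f (hsec x 0)).
  have mp : measurable_fun setT (fun x : X => (x, 0%R : X)).
    by apply: measurable_fun_pair; [exact: measurable_id|exact: measurable_cst].
  exact: (measurableT_comp (measurableT_comp mf measurable_hsec) mp).
transitivity (\int[nu]_x f (hsec (c x) 0)).
  apply: eq_integral => x _; have [h hK E] := hsecK (repr x).
  by rewrite /c E fK.
rewrite -(ge0_integral_pushforward mc nu (D := setT) (f := fun x => f (hsec x 0)))//.
pose C' : {nonneg R} := NngNum (fine_ge0 C0).
rewrite -[fine C]/(C'%:num) -(ge0_integral_mscale leb measurableT C')//.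
apply: eq_measure_integral => A mA _.
exact: (etrans (rhoE A mA) (congr1 (fun z => z * leb A) CE)).
Qed.

End line.

Section torus.
Variable nu : {measure set (cosets (@GammaL R m n)) -> \bar R}.
Hypothesis nu_inv : invariant_measure nu.
Let Lcosets := cosets (@GammaL R m n).

(** [GammaL] absorbs the symmetric coordinate entirely, so the fractional parts of [hlam] and [hmu]
    identify the coset space with a product of two tori. *)
Let c (x : Lcosets) : X * X := (fracm (hlam (repr x)), fracm (hmu (repr x))).

Lemma mxOver_int (N : M_) : N \is a mxOver Num.int -> exists k : Z_, N = intm k.
Proof.
move=> /mxOverP NZ; exists (floorm N); apply/matrixP => i j; rewrite !mxE.
by apply/esym/eqP; rewrite -intrEfloor.
Qed.

Lemma intm_mxOver (k : Z_) : (intm k : M_) \is a mxOver Num.int.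
Proof. by apply/mxOverP => i j; rewrite mxE intr_int. Qed.

Let cpi g : c (\pi_Lcosets g) = (fracm (hlam g) : X, fracm (hmu g) : X).
Proof.
rewrite /c; have [h + ->] := repr_pi GammaL g.
move=> /andP[/mxOver_int[k hk] /mxOver_int[l hl]].
by rewrite hlamM hmuM hk hl ![(intm _ + _)%R]addrC !fracmDint.
Qed.

Let mc : measurable_fun setT c.
Proof.
apply: measurable_cosets_fun.
rewrite (_ : _ \o _ = fun g => (fracm (hlam g) : X, fracm (hmu g) : X)); last first.
  by apply/funext => g; exact: cpi.
apply: measurable_fun_pair.
  exact: (measurableT_comp (@measurable_fracm R m n) measurable_hlamX).
exact: (measurableT_comp (@measurable_fracm R m n) measurable_hmuX).
Qed.

Let hsecL (g : G) : exists2 h, h \in GammaL & hsec (fracm (hlam g)) (fracm (hmu g)) = (h * g)%g.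
Proof.
exists (hsec (fracm (hlam g)) (fracm (hmu g)) * g^-1)%g; last by rewrite mulgVK.
have fracmE (x : M_) : (fracm x - x)%R = intm (- floorm x)%R.
  by rewrite /fracm addrAC subrr add0r intmN.
by apply/andP; rewrite hlamM hmuM hlamV hmuV hlam_hsec hmu_hsec !fracmE !intm_mxOver.
Qed.

Let pi_c (x : Lcosets) : \pi_Lcosets (hsec (c x).1 (c x).2) = x.
Proof.
have [h hL E] := hsecL (repr x).
by rewrite -[RHS]reprK; apply: pi_cosets_eq; rewrite /c/= E mulgK.
Qed.

Let nu_fin : nu setT < +oo.
Proof.
have [_ nucpt _] := nu_inv.
apply: le_lt_trans (nucpt _ (@compact_hbox R m n 1)).
rewrite le_eqVlt; apply/orP; left; apply/eqP; congr (nu _).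
apply/seteqP; split=> // x _; exists (hsec (c x).1 (c x).2); last exact: pi_c.
exists (c x).1, (c x).2; split => // i j.
  by have /andP[a b] := cube_fracm (hlam (repr x)) i j; rewrite ger0_norm// ltW.
by have /andP[a b] := cube_fracm (hmu (repr x)) i j; rewrite ger0_norm// ltW.
Qed.

(** [torus_haar] is applied to one variable at a time, the other being confined to a measurable set;
    the resulting values on rectangles determine the pushforward [rho]. *)
Lemma torus_integral : exists2 C : R, (0 < C)%R & forall f : G -> \bar R,
  measurable_fun setT f -> (forall g, 0 <= f g) ->
  (forall h g, h \in GammaL -> f (h * g)%g = f g) ->
  \int[nu]_x f (repr x) = C%:E * \int[q \x q]_p f (hsec p.1 p.2).
Proof.
have [nu0 nucpt nuT] := nu_inv.
have [e e_bij] := exists_enum m_gt0 n_gt0.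
pose rho : {measure set (X * X) -> \bar R} :=
  measure_function_pushforward__canonical__measure_function_Measure nu mc.
have rho_fin A : measurable A -> rho A < +oo.
  move=> mA; apply: le_lt_trans nu_fin; rewrite -[rho A]/(nu (c @^-1` A)).
  apply: le_measure; rewrite ?inE//.
  by rewrite -[X in measurable X]setTI; exact: mc.
have fracD (x y : M_) : fracm (fracm x + y)%R = fracm (x + y)%R.
  by rewrite {2}/fracm addrAC -intmN fracmDint.
have rhoT1 s A : measurable A ->
    rho ((fun p : X * X => (fracm (p.1 + s)%R : X, p.2)) @^-1` A) = rho A.
  move=> mA; rewrite -[RHS](nuT (hsec s 0) (c @^-1` A)); last first.
    by rewrite -[X in measurable X]setTI; exact: mc.
  by congr (nu _); apply/seteqP; split=> x /=; rewrite /coset_mul cpi hlamM hmuM !fracD addr0.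
have rhoT2 t A : measurable A ->
    rho ((fun p : X * X => (p.1, fracm (p.2 + t)%R : X)) @^-1` A) = rho A.
  move=> mA; rewrite -[RHS](nuT (hsec 0 t) (c @^-1` A)); last first.
    by rewrite -[X in measurable X]setTI; exact: mc.
  by congr (nu _); apply/seteqP; split=> x /=; rewrite /coset_mul cpi hlamM hmuM !fracD addr0.
have mfT t : measurable_fun setT (fun x : X => fracm (x + t)%R : X).
  exact: (measurableT_comp (@measurable_fracm R m n) (measurable_translate t)).
have mfTA t D : measurable D -> measurable ((fun x : X => fracm (x + t)%R : X) @^-1` D).
  by move=> mD; rewrite -[X in measurable X]setTI; exact: mfT.
have mX12 (A B : set X) : measurable A -> measurable B -> measurable (A `*` B).
  by move=> mA mB; exact: measurableX.
have rho1 (B : set X) : measurable B -> forall A, measurable A ->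
    rho (A `*` B) = rho (setT `*` B) * q A.
  move=> mB A mA.
  pose r1 : {measure set X -> \bar R} :=
    measure_function_pushforward__canonical__measure_function_Measure
      (mrestr rho (mX12 _ _ measurableT mB)) measurable_fst.
  have r1E D : measurable D -> r1 D = rho (D `*` B).
    move=> mD; apply: (congr1 rho); apply/seteqP.
    by split=> [[x y] /= [Dx [_ By]]|[x y] /= [Dx By]].
  rewrite -r1E// -r1E//; apply: (torus_haar lebP e_bij) => //.
    by rewrite r1E//; apply: (rho_fin); exact: (mX12).
  move=> t D mD; rewrite !r1E//; last exact: mfTA.
  by rewrite -(rhoT1 t (D `*` B)) => [|]; last exact: (mX12).
have rho2 (B : set X) : measurable B -> rho (setT `*` B) = rho setT * q B.
  move=> mB.
  pose r2 : {measure set X -> \bar R} :=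
    measure_function_pushforward__canonical__measure_function_Measure rho measurable_snd.
  have r2E D : r2 D = rho (setT `*` D).
    by apply: (congr1 rho); apply/seteqP; split=> [[x y] //=|[x y] /= []].
  rewrite -r2E (_ : rho setT = r2 setT); last by rewrite r2E setXTT.
  apply: (torus_haar lebP e_bij) => //.
  move=> t D mD; rewrite !r2E.
  by rewrite -(rhoT2 t (setT `*` D)) => [|]; last exact: (mX12).
set C := rho setT in rho2.
have Cfin : C < +oo by exact: nu_fin.
have C0 : 0 <= C by exact: measure_ge0.
have CE : C = (fine C)%:E by rewrite fineK// ge0_fin_numE.
have Cpos : (0 < fine C)%R.
  rewrite lt_neqAle fine_ge0// andbT; apply/eqP => C00.
  by move/eqP : nu0; apply; rewrite -[LHS]/C CE -C00.
pose C' : {nonneg R} := NngNum (ltW Cpos).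
have Ci0 : (0 <= (fine C)^-1)%R by rewrite invr_ge0 ltW.
pose Ci : {nonneg R} := NngNum Ci0.
(* [product_measure_unique] asks for the exact product values on rectangles, so [rho] is first
   divided by [C]. *)
have rhoE A : measurable A -> rho A = C * (q \x q) A.
  move=> mA; have QE : (q \x q) A = ((fine C)^-1)%:E * rho A.
    apply: (@product_measure_unique _ _ _ _ R q q (mscale Ci rho) _ _ mA) => A1 A2 mA1 mA2.
    rewrite -[LHS]/(((fine C)^-1)%:E * rho (A1 `*` A2)) rho1// rho2//.
    by rewrite {2}CE !muleA -EFinM mulVf ?lt0r_neq0// mul1e muleC.
  by rewrite QE {1}CE muleA -EFinM mulfV ?lt0r_neq0// mul1e.
exists (fine C) => // f mf f0 fL.
transitivity (\int[nu]_x f (hsec (c x).1 (c x).2)).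
  apply: eq_integral => x _; have [h hL E] := hsecL (repr x).
  by rewrite /c/= E fL.
have mfs : measurable_fun setT (fun p : X * X => f (hsec p.1 p.2)).
  exact: (measurableT_comp mf measurable_hsec).
rewrite -(ge0_integral_pushforward mc nu (D := setT) (f := fun p => f (hsec p.1 p.2)))//.
rewrite -[fine C]/(C'%:num) -(ge0_integral_mscale (q \x q) measurableT C')//.
apply: eq_measure_integral => A mA _.
exact: (etrans (rhoE A mA) (congr1 (fun z => z * (q \x q) A) CE)).
Qed.

End torus.
End coset_integrals.

Local Open Scope complex_scope.

(** * Square-integrable complex functions *)

Section complex_algebra.
Context {R : realType}.
Implicit Types z w : R[i].

Lemma Re_add z w : complex.Re (z + w) = complex.Re z + complex.Re w.
Proof. by case: z; case: w. Qed.
Lemma Im_add z w : complex.Im (z + w) = complex.Im z + complex.Im w.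
Proof. by case: z; case: w. Qed.
Lemma Re_opp z : complex.Re (- z) = - complex.Re z.
Proof. by case: z. Qed.
Lemma Im_opp z : complex.Im (- z) = - complex.Im z.
Proof. by case: z. Qed.
Lemma Re_mul z w : complex.Re (z * w) =
  complex.Re z * complex.Re w - complex.Im z * complex.Im w.
Proof. by case: z; case: w. Qed.
Lemma Im_mul z w : complex.Im (z * w) =
  complex.Re z * complex.Im w + complex.Im z * complex.Re w.
Proof. by case: z; case: w. Qed.
Lemma Re_conj z : complex.Re (conjc z) = complex.Re z.
Proof. by case: z. Qed.
Lemma Im_conj z : complex.Im (conjc z) = - complex.Im z.
Proof. by case: z. Qed.

Definition ReImE := (Re_add, Im_add, Re_opp, Im_opp, Re_mul, Im_mul, Re_conj, Im_conj).

Lemma complex_ext z w : complex.Re z = complex.Re w -> complex.Im z = complex.Im w -> z = w.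
Proof. by case: z; case: w => a b c d /= -> ->. Qed.

Lemma sqnormC_ge0 z : 0 <= sqnormC z.
Proof. by rewrite /sqnormC addr_ge0// sqr_ge0. Qed.

Lemma sqnormCM z w : sqnormC (z * w) = sqnormC z * sqnormC w.
Proof. by rewrite /sqnormC !ReImE; ring. Qed.

Lemma sqnormCJ z : sqnormC (conjc z) = sqnormC z.
Proof. by rewrite /sqnormC !ReImE sqrrN. Qed.

Lemma sqnormC0 : sqnormC (0 : R[i]) = 0.
Proof. by rewrite /sqnormC/= expr0n/= addr0. Qed.

Lemma sqnormC_eq0 z : sqnormC z = 0 -> z = 0.
Proof.
rewrite /sqnormC => /eqP; rewrite paddr_eq0 ?sqr_ge0// !sqrf_eq0 => /andP[/eqP a /eqP b].
exact: complex_ext.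
Qed.

Lemma sqnormC1 : sqnormC (1 : R[i]) = 1.
Proof. by rewrite /sqnormC/= expr0n/= addr0 expr1n. Qed.

Lemma sqnormCD z w : sqnormC (z + w) <= 2 * (sqnormC z + sqnormC w).
Proof.
rewrite -subr_ge0 (_ : _ - _ = sqnormC (z - w)) ?sqnormC_ge0//.
by rewrite /sqnormC !ReImE; ring.
Qed.

Lemma sqnormC_Re z : complex.Re z ^+ 2 <= sqnormC z.
Proof. by rewrite lerDl sqr_ge0. Qed.

Lemma sqnormC_Im z : complex.Im z ^+ 2 <= sqnormC z.
Proof. by rewrite lerDr sqr_ge0. Qed.

Lemma expi2piD (s t : R) : expi2pi (s + t) = expi2pi s * expi2pi t.
Proof.
by apply: complex_ext; rewrite !ReImE/= mulrDr ?cosD ?sinD// addrC.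
Qed.

Lemma expi2pi0 : expi2pi (0 : R) = 1.
Proof. by apply: complex_ext; rewrite /= mulr0 ?cos0 ?sin0. Qed.

Lemma expi2piN (t : R) : expi2pi (- t) = (conjc (expi2pi t)).
Proof. by apply: complex_ext; rewrite !ReImE/= mulrN ?cosN ?sinN. Qed.

Lemma sqnormC_expi2pi (t : R) : sqnormC (expi2pi t) = 1.
Proof. exact: cos2Dsin2. Qed.

Lemma expi2pi_conj (t : R) : expi2pi t * (conjc (expi2pi t)) = 1.
Proof. by rewrite -expi2piN -expi2piD subrr expi2pi0. Qed.

Lemma expi2pi_int (k : int) : expi2pi (k%:~R : R) = 1.
Proof.
have e1 : expi2pi (1 : R) = 1.
  by apply: complex_ext; rewrite /= mulr1 mulr_natl ?cos2pi ?sin2pi.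
have en (j : nat) : expi2pi (j%:R : R) = 1.
  by elim: j => [|j IH]; rewrite ?expi2pi0// -natr1 expi2piD IH e1 mulr1.
case: k => j; first exact: en.
by rewrite NegzE mulrNz expi2piN en; apply: complex_ext; rewrite ?Re_conj ?Im_conj/= ?oppr0.
Qed.

End complex_algebra.

Section cmeasurable.
Context {R : realType} d (T : measurableType d).
Implicit Types f g : T -> R[i].

Lemma cmeasurableD f g : cmeasurable f -> cmeasurable g -> cmeasurable (fun x => f x + g x).
Proof.
move=> [rf jf] [rg jg]; split.
  by under eq_fun do rewrite Re_add; exact: measurable_funD.
by under eq_fun do rewrite Im_add; exact: measurable_funD.
Qed.

Lemma cmeasurableM f g : cmeasurable f -> cmeasurable g -> cmeasurable (fun x => f x * g x).
Proof.
move=> [rf jf] [rg jg]; split.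
  by under eq_fun do rewrite Re_mul; apply: measurable_funB; exact: measurable_funM.
by under eq_fun do rewrite Im_mul; apply: measurable_funD; exact: measurable_funM.
Qed.

Lemma cmeasurable_cst (c : R[i]) : cmeasurable (fun _ : T => c).
Proof. by split; exact: measurable_cst. Qed.

Lemma cmeasurableN f : cmeasurable f -> cmeasurable (fun x => - f x).
Proof.
move=> [rf jf]; split.
  by under eq_fun do rewrite Re_opp; exact: measurable_funN.
by under eq_fun do rewrite Im_opp; exact: measurable_funN.
Qed.

Lemma cmeasurableB f g : cmeasurable f -> cmeasurable g -> cmeasurable (fun x => f x - g x).
Proof. by move=> mf mg; apply: cmeasurableD => //; exact: cmeasurableN. Qed.

Lemma cmeasurableJ f : cmeasurable f -> cmeasurable (fun x => (conjc (f x))).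
Proof.
move=> [rf jf]; split; first by under eq_fun do rewrite Re_conj.
by under eq_fun do rewrite Im_conj; exact: measurable_funN.
Qed.

Lemma cmeasurable_sum (I : Type) (s : seq I) (F : I -> T -> R[i]) :
  (forall i, cmeasurable (F i)) -> cmeasurable (fun x => \sum_(i <- s) F i x).
Proof.
move=> mF; elim: s => [|i s IH].
  by under eq_fun do rewrite big_nil; exact: cmeasurable_cst.
by under eq_fun do rewrite big_cons; exact: cmeasurableD.
Qed.

Lemma cmeasurable_comp d' (T' : measurableType d') (h : T' -> T) f :
  measurable_fun setT h -> cmeasurable f -> cmeasurable (f \o h).
Proof. by move=> mh [rf jf]; split; [exact: (measurableT_comp rf)|exact: (measurableT_comp jf)]. Qed.

Lemma cmeasurable_expi2pi (h : T -> R) : measurable_fun setT h ->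
  cmeasurable (fun x => expi2pi (h x)).
Proof.
move=> mh.
have m2 : measurable_fun setT (fun x => 2 * pi * h x).
  by apply: measurable_funM => //; exact: measurable_cst.
split => /=.
  by apply: (measurableT_comp (f := @cos R)) => //; apply: continuous_measurable_fun; exact: continuous_cos.
by apply: (measurableT_comp (f := @sin R)) => //; apply: continuous_measurable_fun; exact: continuous_sin.
Qed.

Lemma measurable_sqnormC f : cmeasurable f -> measurable_fun setT (fun x => (sqnormC (f x))%:E).
Proof.
move=> [rf jf]; apply/measurable_EFinP.
by apply: measurable_funD; exact: measurable_funX.
Qed.

End cmeasurable.

Section cintegral.
Context {R : realType} d (T : measurableType d) (mu : {measure set T -> \bar R}).
Implicit Types f g : T -> R[i].

Definition cintegrable f :=
  mu.-integrable setT (fun x => (complex.Re (f x))%:E) /\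
  mu.-integrable setT (fun x => (complex.Im (f x))%:E).

Definition norm2 f : \bar R := \int[mu]_x (sqnormC (f x))%:E.

Lemma norm2_ge0 f : (0 <= norm2 f)%E.
Proof. by apply: integral_ge0 => x _; rewrite lee_fin sqnormC_ge0. Qed.

Lemma cintegrable_cmeasurable f : cintegrable f -> cmeasurable f.
Proof.
by move=> [/measurable_int/measurable_EFinP rf /measurable_int/measurable_EFinP jf].
Qed.

Lemma cintegrableD f g : cintegrable f -> cintegrable g -> cintegrable (fun x => f x + g x).
Proof.
move=> [rf jf] [rg jg]; split.
  by under eq_fun do rewrite Re_add EFinD; exact: integrableD.
by under eq_fun do rewrite Im_add EFinD; exact: integrableD.
Qed.

Lemma cintegrableZ f c : cintegrable f -> cintegrable (fun x => c * f x).
Proof.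
move=> [rf jf]; split.
  under eq_fun do rewrite Re_mul EFinB !EFinM.
  by apply: (integrableB measurableT); apply: (integrableZl measurableT).
under eq_fun do rewrite Im_mul EFinD !EFinM.
by apply: (integrableD measurableT); apply: (integrableZl measurableT).
Qed.

Lemma cintegralD f g : cintegrable f -> cintegrable g ->
  cintegral mu (fun x => f x + g x) = cintegral mu f + cintegral mu g.
Proof.
move=> [rf jf] [rg jg]; apply: complex_ext; rewrite !ReImE /=.
  by under [LHS]eq_Rintegral do rewrite Re_add; rewrite RintegralD.
by under [LHS]eq_Rintegral do rewrite Im_add; rewrite RintegralD.
Qed.

Lemma cintegralZ f c : cintegrable f ->
  cintegral mu (fun x => c * f x) = c * cintegral mu f.
Proof.
move=> [rf jf]; apply: complex_ext; rewrite !ReImE /=.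
  under [LHS]eq_Rintegral do rewrite Re_mul.
  rewrite RintegralB ?RintegralZl//.
  - exact: (integrableZl measurableT (complex.Re c) rf).
  - exact: (integrableZl measurableT (complex.Im c) jf).
under [LHS]eq_Rintegral do rewrite Im_mul.
rewrite RintegralD ?RintegralZl//.
- exact: (integrableZl measurableT (complex.Re c) jf).
- exact: (integrableZl measurableT (complex.Im c) rf).
Qed.

Lemma eq_cintegral f g : f =1 g -> cintegral mu f = cintegral mu g.
Proof. by move=> /funext ->. Qed.

Definition L2 f := cmeasurable f /\ (norm2 f < +oo)%E.

Lemma norm2Z f c : cmeasurable f -> norm2 (fun x => c * f x) = ((sqnormC c)%:E * norm2 f)%E.
Proof.
move=> mf; rewrite /norm2; under eq_integral do rewrite sqnormCM EFinM.
rewrite ge0_integralZl//; first exact: measurable_sqnormC.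
- by move=> x _; rewrite lee_fin sqnormC_ge0.
- by rewrite lee_fin sqnormC_ge0.
Qed.

Lemma norm2D f g : cmeasurable f -> cmeasurable g ->
  (norm2 (fun x => (f x + g x)%R) <= 2%:E * (norm2 f + norm2 g))%E.
Proof.
move=> mf mg; have mf' := measurable_sqnormC mf; have mg' := measurable_sqnormC mg.
rewrite /norm2 -ge0_integralD//; last 2 first.
- by move=> x _; rewrite lee_fin sqnormC_ge0.
- by move=> x _; rewrite lee_fin sqnormC_ge0.
rewrite -ge0_integralZl//; last 2 first.
- exact: emeasurable_funD.
- by move=> x _; rewrite -EFinD lee_fin addr_ge0// sqnormC_ge0.
apply: ge0_le_integral => //.
- by move=> x _; rewrite lee_fin sqnormC_ge0.
- by apply: measurable_sqnormC; exact: cmeasurableD.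
- by apply: measurable_funeM; exact: emeasurable_funD.
- by move=> x _; rewrite -EFinD -EFinM lee_fin sqnormCD.
Qed.

Lemma L2D f g : L2 f -> L2 g -> L2 (fun x => f x + g x).
Proof.
move=> [mf nf] [mg ng]; split; first exact: cmeasurableD.
apply: (le_lt_trans (norm2D mf mg)).
by rewrite lte_mul_pinfty// lte_add_pinfty.
Qed.

Lemma L2Z f c : L2 f -> L2 (fun x => c * f x).
Proof.
move=> [mf nf]; split; first by apply: cmeasurableM => //; exact: cmeasurable_cst.
by rewrite norm2Z// lte_mul_pinfty// ?lee_fin ?sqnormC_ge0.
Qed.

Lemma L2B f g : L2 f -> L2 g -> L2 (fun x => f x - g x).
Proof.
move=> Lf Lg; rewrite (_ : (fun x => _) = fun x => f x + -1 * g x); first exact/L2D/L2Z.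
by apply/funext => x; rewrite mulN1r.
Qed.

Lemma L2_unimodular f u : cmeasurable u -> (forall x, sqnormC (u x) = 1) ->
  L2 f -> L2 (fun x => f x * u x).
Proof.
move=> mu1 u1 [mf nf]; split; first exact: cmeasurableM.
by rewrite /norm2; under eq_integral do rewrite sqnormCM u1 mulr1.
Qed.

Lemma L2_integrable f : L2 f -> mu.-integrable setT (fun x => (sqnormC (f x))%:E).
Proof.
move=> [mf nf]; apply/integrableP; split; first exact: measurable_sqnormC.
by under eq_integral do rewrite gee0_abs ?lee_fin ?sqnormC_ge0//.
Qed.

(** A crude bound from sums of squares, enough to make products of square-integrable functions
    integrable. *)
Lemma norm_ReM_le (z w : R[i]) : `|complex.Re (z * w)| <= sqnormC z + sqnormC w.
Proof.
case: z w => [a b] [c e]; rewrite /sqnormC/= ler_norml.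
have := sqr_ge0 (a - c); have := sqr_ge0 (a + c); have := sqr_ge0 (b - e).
by have := sqr_ge0 (b + e); rewrite !sqrrD !sqrrN; lra.
Qed.

Lemma norm_ImM_le (z w : R[i]) : `|complex.Im (z * w)| <= sqnormC z + sqnormC w.
Proof.
case: z w => [a b] [c e]; rewrite /sqnormC/= ler_norml.
have := sqr_ge0 (a - e); have := sqr_ge0 (a + e); have := sqr_ge0 (b - c).
by have := sqr_ge0 (b + c); rewrite !sqrrD !sqrrN; lra.
Qed.

Lemma L2_cintegrableM f g : L2 f -> L2 g -> cintegrable (fun x => f x * g x).
Proof.
move=> Lf Lg.
have isum := integrableD measurableT (L2_integrable Lf) (L2_integrable Lg).
have [m1 m2] := cmeasurableM Lf.1 Lg.1.
have s0 x : 0 <= sqnormC (f x) + sqnormC (g x) by exact: addr_ge0 (sqnormC_ge0 _) (sqnormC_ge0 _).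
split; apply: (le_integrable measurableT _ _ isum).
- by move/measurable_EFinP : m1.
- by move=> x _; rewrite lee_fin [leRHS]ger0_norm//; exact: norm_ReM_le.
- by move/measurable_EFinP : m2.
- by move=> x _; rewrite lee_fin [leRHS]ger0_norm//; exact: norm_ImM_le.
Qed.

End cintegral.

Section probability.
Context {R : realType} d (T : measurableType d) (P : probability T R).
Implicit Types f g : T -> R[i].

Lemma L2_cst (c : R[i]) : L2 P (fun _ : T => c).
Proof.
split; first exact: cmeasurable_cst.
by rewrite /norm2 integral_cst// [X in (_ * X)%E]probability_setT mule1 ltry.
Qed.

Lemma cintegral_cst (c : R[i]) : cintegral P (fun _ : T => c) = c.
Proof.
by apply: complex_ext; rewrite /= Rintegral_cst// [X in _ * fine X]probability_setT mulr1.
Qed.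

Lemma L2_cintegrable f : L2 P f -> cintegrable P f.
Proof.
move=> Lf; rewrite (_ : f = fun x => f x * 1).
  exact: L2_cintegrableM (L2_cst 1).
by apply/funext => x; rewrite mulr1.
Qed.

(** Pythagoras for the orthogonal projection on the line spanned by [u], which has norm 1 because it
    is unimodular and [P] is a probability. *)
Lemma norm2_proj g (u : T -> R[i]) : L2 P g -> cmeasurable u ->
  (forall x, sqnormC (u x) = 1) ->
  let c := cintegral P (fun x => g x * conjc (u x)) in
  norm2 P g = (norm2 P (fun x => (g x - c * u x)%R) + (sqnormC c)%:E)%E.
Proof.
move=> Lg mu u1 c.
have u1' x : sqnormC (conjc (u x)) = 1 by rewrite sqnormCJ u1.
have Lgu : L2 P (fun x => g x * conjc (u x)).
  by apply: L2_unimodular => //; exact: cmeasurableJ.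
have [ir ii] := L2_cintegrable Lgu.
have ig := L2_integrable Lg.
set a := complex.Re c; set b := complex.Im c.
(* The bracket integrates to [2 * sqnormC c - sqnormC c], by the definition of [c]. *)
have pt x : sqnormC (g x) = sqnormC (g x - c * u x) +
    (2 * a * complex.Re (g x * conjc (u x)) + 2 * b * complex.Im (g x * conjc (u x)) - sqnormC c).
  have := u1 x; rewrite /a /b /sqnormC !ReImE.
  move: (complex.Re (u x)) (complex.Im (u x)) => s t st.
  apply/esym/eqP; rewrite -subr_eq0; apply/eqP.
  transitivity ((complex.Re c ^+ 2 + complex.Im c ^+ 2) * (s ^+ 2 + t ^+ 2 - 1)); first by ring.
  by rewrite st subrr mulr0.
have Lgc : L2 P (fun x => g x - c * u x).
  apply: L2D => //; rewrite (_ : (fun _ => _) = fun x => (- c) * u x); last first.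
    by apply/funext => x; rewrite mulNr.
  have := L2_unimodular mu u1 (L2_cst (- c)); exact.
have i1 : P.-integrable setT (fun x => (2 * a * complex.Re (g x * conjc (u x)))%:E).
  by under eq_fun do rewrite EFinM; exact: integrableZl.
have i2 : P.-integrable setT (fun x => (2 * b * complex.Im (g x * conjc (u x)))%:E).
  by under eq_fun do rewrite EFinM; exact: integrableZl.
have i0 : P.-integrable setT (fun x => (sqnormC c)%:E) by exact: finite_measure_integrable_cst.
rewrite /norm2; under eq_integral do rewrite pt EFinD EFinB EFinD.
rewrite integralD//; [|exact: L2_integrable|exact: (integrableB measurableT (integrableD measurableT i1 i2) i0)].
congr (_ + _)%E.
rewrite (integralB measurableT (integrableD measurableT i1 i2) i0).
rewrite (integralD measurableT i1 i2) integral_cst// [X in (_ - _ * X)%E]probability_setT mule1.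
under eq_integral do rewrite EFinM; rewrite integralZl//.
under [X in (_ + X - _)%E]eq_integral do rewrite EFinM; rewrite integralZl//.
rewrite -(fineK (integrable_fin_num measurableT ir)) -(fineK (integrable_fin_num measurableT ii)).
transitivity ((2 * a * a + 2 * b * b - sqnormC c)%:E); first by [].
by congr (_%:E); rewrite /sqnormC -/a -/b; ring.
Qed.

(** The integral is the coefficient of [g] on the constant function 1, so [norm2_proj] gives the
    Cauchy-Schwarz bound. *)
Lemma sqnormC_cintegral_le g : L2 P g -> ((sqnormC (cintegral P g))%:E <= norm2 P g)%E.
Proof.
have e : (fun x => g x * conjc 1) = g.
  apply/funext => x; rewrite (_ : conjc 1 = 1) ?mulr1//.
  by apply: complex_ext; rewrite ?Re_conj ?Im_conj//= oppr0.
move=> Lg; rewrite (norm2_proj Lg (cmeasurable_cst T 1)) => [|x]; last exact: sqnormC1.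
by rewrite e leeDr// norm2_ge0.
Qed.

End probability.

Section bounded.
Context {R : realType} d (T : measurableType d) (mu : {measure set T -> \bar R}).

Lemma normr_le_sqr (a C : R) : a ^+ 2 <= C -> `|a| <= C + 1.
Proof. by move=> aC; rewrite ler_norml; apply/andP; split; nra. Qed.

Lemma cintegrable_bounded (u f : T -> R[i]) (C : R) : cmeasurable u ->
  (forall x, sqnormC (u x) <= C) -> cintegrable mu f ->
  cintegrable mu (fun x => u x * f x).
Proof.
move=> mu1 uC fI; have [rf jf] := fI.
have [m1 m2] := cmeasurableM mu1 (cintegrable_cmeasurable fI).
have ru x : `|complex.Re (u x)| <= C + 1.
  by apply: normr_le_sqr; exact: le_trans (sqnormC_Re _) (uC x).
have ju x : `|complex.Im (u x)| <= C + 1.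
  by apply: normr_le_sqr; exact: le_trans (sqnormC_Im _) (uC x).
have isum := integrableZl measurableT (C + 1) (integrableD measurableT (integrable_abse rf) (integrable_abse jf)).
have bnd a b x : `|a| <= C + 1 -> `|b| <= C + 1 -> forall s t : R, `|s| = `|complex.Re (f x)| -> `|t| = `|complex.Im (f x)| ->
    `|a * s + b * t| <= `|(C + 1) * (`|complex.Re (f x)| + `|complex.Im (f x)|)|.
  move=> aC bC s t <- <-; have C0 : 0 <= C + 1 by exact: le_trans (normr_ge0 a) aC.
  rewrite [leRHS]ger0_norm; last by rewrite mulr_ge0// addr_ge0.
  by rewrite (le_trans (ler_normD _ _))// !normrM mulrDr lerD// ler_wpM2r.
split; apply: (le_integrable measurableT _ _ isum).
- by move/measurable_EFinP : m1.
- move=> x _ /=; rewrite lee_fin Re_mul -mulrN; apply: bnd => //.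
  by rewrite normrN.
- by move/measurable_EFinP : m2.
- by move=> x _; rewrite lee_fin Im_mul [X in `|X| <= _]addrC; exact: (bnd _ _ x (ju x) (ru x)).
Qed.

End bounded.

(** * Characters of the torus and their orthogonality *)

Section characters.
Context (R : realType) (m n : nat).
Local Notation X := (borelM R m n).
Local Notation M_ := 'M[R]_(m, n).
Local Notation Z_ := 'M[int]_(m, n).

Definition chr (k : M_) (x : X) : R[i] := expi2pi (\tr (k *m (x : M_)^T)).

Lemma chrD k l x : chr (k + l) x = chr k x * chr l x.
Proof. by rewrite /chr mulmxDl mxtraceD expi2piD. Qed.

Lemma chr0 x : chr 0 x = 1.
Proof. by rewrite /chr mul0mx mxtrace0 expi2pi0. Qed.

Lemma chrN k x : chr (- k) x = conjc (chr k x).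
Proof. by rewrite /chr mulNmx -expi2piN raddfN. Qed.

Lemma chr_addr k (x y : M_) : chr k (x + y) = chr k x * chr k y.
Proof. by rewrite /chr trmx_add mulmxDr mxtraceD expi2piD. Qed.

Lemma chr_intm (k l : Z_) : chr (intm k) (intm l) = 1.
Proof.
rewrite /chr (_ : \tr _ = (\tr (k *m l^T))%:~R) ?expi2pi_int//.
rewrite /mxtrace rmorph_sum; apply: eq_bigr => i _; rewrite !mxE rmorph_sum.
by apply: eq_bigr => j _; rewrite !mxE rmorphM.
Qed.

Lemma chr_periodic (k l : Z_) (x : M_) : chr (intm k) (x + intm l) = chr (intm k) x.
Proof. by rewrite chr_addr chr_intm mulr1. Qed.

Lemma sqnormC_chr k x : sqnormC (chr k x) = 1.
Proof. exact: sqnormC_expi2pi. Qed.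

Lemma cmeasurable_chr k : cmeasurable (chr k).
Proof.
apply: cmeasurable_expi2pi; rewrite /mxtrace.
apply: measurable_sum => i; under eq_fun do rewrite mxE.
apply: measurable_sum => j; under eq_fun do rewrite mxE.
by apply: measurable_funM; [exact: measurable_cst|exact: measurable_coord].
Qed.

Variable leb : {measure set X -> \bar R}.
Hypothesis lebP : is_lebesgue leb.
Variable e : nat -> Z_.
Hypothesis e_bij : bijective e.
Local Notation q := (cubeP lebP).

Lemma cintegral_translate (f : X -> R[i]) (t : M_) : cmeasurable f ->
  (forall x k, f (x + intm k) = f x) ->
  cintegral q (fun x => f (x + t)) = cintegral q f.
Proof.
move=> [rf jf] fper.
have H (g : X -> R) : measurable_fun setT g -> (forall x k, g (x + intm k) = g x) ->
    Rintegral q setT (fun x => g (x + t)) = Rintegral q setT g.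
  move=> mg gper; rewrite /Rintegral; congr fine; rewrite integralE [RHS]integralE.
  congr (_ - _)%E.
    under eq_integral do rewrite funeposE.
    under [RHS]eq_integral do rewrite funeposE.
    apply: (ge0_integral_cubeP_translate lebP e_bij (f := fun x => maxe (g x)%:E 0)) => [|x|x k].
    - by apply: measurable_maxe; [exact/measurable_EFinP|exact: measurable_cst].
    - by rewrite le_max lexx orbT.
    - by rewrite gper.
  under eq_integral do rewrite funenegE.
  under [RHS]eq_integral do rewrite funenegE.
  apply: (ge0_integral_cubeP_translate lebP e_bij (f := fun x => maxe (- (g x)%:E)%E 0)) => [|x|x k].
  - apply: measurable_maxe; last exact: measurable_cst.
    by apply: measurableT_comp => //; exact/measurable_EFinP.
  - by rewrite le_max lexx orbT.
  - by rewrite gper.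
by rewrite /cintegral (H (fun x => complex.Re (f x)))// ?(H (fun x => complex.Im (f x)))// => x k; rewrite fper.
Qed.

Lemma L2_chr k : L2 q (chr k).
Proof.
have := L2_unimodular (cmeasurable_chr k) (sqnormC_chr k) (L2_cst q 1).
by rewrite (_ : (fun x => _) = chr k)//; apply/funext => x; rewrite mul1r.
Qed.

(** For nonzero [k] some translation multiplies the character by -1; invariance makes the integral
    its own opposite. *)
Lemma cintegral_chr (k : Z_) : cintegral q (chr (intm k)) = (k == 0)%:R.
Proof.
case: eqP => [->|/eqP k0].
  rewrite intm0 (_ : chr 0 = fun=> 1); last by apply/funext => x; rewrite chr0.
  exact: cintegral_cst.
have [i [j kij]] : exists i j, k i j != 0.
  apply/not_existsP => nk; move/eqP : k0; apply; apply/matrixP => i j; rewrite mxE.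
  by apply/eqP/negPn/negP => kij; apply: (nk i); exists j.
have kR : ((k i j)%:~R : R) != 0 by rewrite intr_eq0.
(* Supported at one nonzero entry of [k] and scaled so that the exponent is exactly one half. *)
pose t : M_ := (2 * (k i j)%:~R)^-1 *: delta_mx i j.
have et : chr (intm k) t = -1.
  rewrite /chr /t linearZ/= -scalemxAr linearZ/= trmx_delta.
  rewrite (_ : \tr _ = (k i j)%:~R); last first.
    rewrite mxtrace_mulC /mxtrace (bigD1 j)//= big1 => [|l lj]; last first.
      by rewrite mxE big1// => p _; rewrite !mxE (negPf lj) mul0r.
    rewrite addr0 mxE (bigD1 i)//= big1 => [|l li]; last first.
      by rewrite !mxE (negPf li) andbF mul0r.
    by rewrite !mxE !eqxx mul1r addr0.
  rewrite invfM -mulrA mulVf// mulr1.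
  by apply: complex_ext; rewrite !ReImE/= mulrAC divff// mul1r ?cospi ?sinpi ?oppr0.
have := cintegral_translate t (cmeasurable_chr (intm k)) (fun x l => chr_periodic k l x).
rewrite (_ : (fun x => _) = (fun x => -1 * chr (intm k) x)); last first.
  by apply/funext => x; rewrite chr_addr et mulrC.
rewrite cintegralZ; last exact: L2_cintegrable (L2_chr _).
move: (cintegral _ _) => [a b] /eqP; rewrite mulN1r eq_complex/= => /andP[/eqP ? /eqP ?].
by apply: complex_ext => /=; lra.
Qed.

End characters.

(** * Uniqueness of Fourier coefficients *)

Section step.
Context (R : realType).

Lemma bernoulli_addr (a : R) n : 0 <= a -> 1 + n%:R * a <= (1 + a) ^+ n.
Proof.
move=> a0; elim: n => [|n IH]; first by rewrite mul0r addr0 expr0.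
have h0 : 0 <= n%:R * a * a by rewrite !mulr_ge0.
by rewrite exprSr -natr1; nra.
Qed.

Lemma bernoulli_subr (a : R) n : 0 <= a <= 1 -> 1 - n%:R * a <= (1 - a) ^+ n.
Proof.
move=> a01; elim: n => [|n IH]; first by rewrite mul0r subr0 expr0.
have h0 : 0 <= n%:R * a * a by rewrite !mulr_ge0//; case/andP: a01.
by rewrite exprSr -natr1; nra.
Qed.

(** With [r = s ^+ 2], Bernoulli's inequality bounds [s ^+ j] by a multiple of the inverse of
    [j + 1]; squaring leaves one such inverse to spare after multiplication by [j]. *)
Lemma natr_expr_bound (r : R) : 0 <= r < 1 ->
  exists2 K, 0 <= K & forall j, j%:R * r ^+ j <= K * harmonic j.
Proof.
move=> /andP[r0 r1]; pose s := Num.sqrt r; pose b := 1 - s.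
have s0 : 0 <= s := sqrtr_ge0 r.
have sr : s ^+ 2 = r by rewrite sqr_sqrtr.
have s1 : s < 1 by rewrite ltNge; apply/negP => s1; nra.
have b0 : 0 < b by rewrite /b; lra.
exists (b^-1 ^+ 2); first by rewrite sqr_ge0.
move=> j; rewrite -sr -exprM mulnC exprM.
have j0 : 0 < (j.+1%:R : R) by [].
have h1 : s ^+ j * (b * j.+1%:R) <= 1.
  apply: (@le_trans _ _ (s ^+ j * (1 + b) ^+ j)); last first.
    by rewrite -exprMn exprn_ile1// /b; nra.
  rewrite ler_wpM2l ?exprn_ge0//; apply: le_trans (bernoulli_addr j (ltW b0)).
  by rewrite -natr1; rewrite /b; nra.
have h2 : s ^+ j <= b^-1 * j.+1%:R^-1.
  by rewrite -invfM -[leRHS]mul1r ler_pdivlMr ?mulr_gt0.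
have h3 : 0 <= s ^+ j by rewrite exprn_ge0.
apply: (@le_trans _ _ (j.+1%:R * (b^-1 * j.+1%:R^-1) ^+ 2)).
  apply: ler_pM => //; [by rewrite sqr_ge0|by rewrite ler_nat|].
  by rewrite ler_pXn2r// nnegrE// mulr_ge0 ?invr_ge0// ltW.
rewrite /harmonic/=; move: (j.+1%:R) j0 => z z0.
rewrite le_eqVlt; apply/orP; left; apply/eqP; field.
by rewrite !lt0r_neq0.
Qed.

Lemma natr_expr_cvg0 (r : R) : 0 <= r < 1 -> (fun j : nat => j%:R * r ^+ j) @ \oo --> (0 : R).
Proof.
move=> r01; have [K K0 jr] := natr_expr_bound r01.
apply: (@squeeze_cvgr _ _ _ _ (fun=> 0) (fun j => K * harmonic j)).
- apply: nearW => j; rewrite jr andbT mulr_ge0// exprn_ge0//; by case/andP: r01.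
- exact: cvg_cst.
- rewrite -[X in _ --> X](mulr0 K); apply: cvgM; [exact: cvg_cst|exact: cvg_harmonic].
Qed.

Definition step_expt (t : R) (j : nat) : nat := (Num.trunc (j%:R * t^-1 ^+ j)).+1.

(* [(1 - y^j)^N] with [N ~ j t^-j] is the Bernstein-type approximation of a step
   at [t] used in the elementary proof of the Stone-Weierstrass theorem. *)
Lemma step_cvg (t y : R) : 0 < t <= 1 -> 0 <= y <= 1 ->
  (fun j : nat => (1 - y ^+ j) ^+ step_expt t j) @ \oo --> ((y < t)%R%:R : R).
Proof.
move=> /andP[t0 t1] /andP[y0 y1].
have tj j : 0 <= j%:R * t^-1 ^+ j :> R by rewrite mulr_ge0// exprn_ge0// invr_ge0 ltW.
have yj j : 0 <= y ^+ j <= 1 by rewrite exprn_ge0//= exprn_ile1.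
have [yt|ty] := ltP y t.
  have r01 : 0 <= y / t < 1.
    by apply/andP; split; [rewrite divr_ge0// ltW|rewrite ltr_pdivrMr// mul1r].
  (* Bernoulli gives [(1 - y ^+ j) ^+ N >= 1 - N * y ^+ j], and the exponent [N] is at most
     [j * t^-1 ^+ j + 1]. *)
  apply: (@squeeze_cvgr _ _ _ _ (fun j => 1 - (j%:R * (y / t) ^+ j + y ^+ j)) (fun=> 1)).
  - apply: nearW => j; rewrite exprn_ile1 ?andbT//; [|by case/andP: (yj j); lra|by case/andP: (yj j); lra].
    apply: le_trans (bernoulli_subr _ (yj j)).
    rewrite lerD2l lerN2 (_ : _ + _ = (j%:R * t^-1 ^+ j + 1) * y ^+ j); last first.
      by rewrite exprMn; ring.
    rewrite ler_wpM2r//; first by case/andP: (yj j).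
    by rewrite -natr1 lerD2r; case/andP: (truncn_itv (tj j)).
  - rewrite -[X in _ --> X]subr0; apply: cvgB; first exact: cvg_cst.
    rewrite -[X in _ --> X]addr0; apply: cvgD; first exact: natr_expr_cvg0.
    by apply: cvg_expr; rewrite ger0_norm//; lra.
  - exact: cvg_cst.
(* Here [N * y ^+ j >= j], so the other Bernoulli inequality makes [(1 + y ^+ j) ^+ N] at least
   [1 + j], while its product with [(1 - y ^+ j) ^+ N] is at most 1. *)
apply: (@squeeze_cvgr _ _ _ _ (fun=> 0) harmonic).
- apply: nearW => j; rewrite exprn_ge0/=; last by case/andP: (yj j); lra.
  set N := step_expt t j.
  have Ny : j%:R <= N%:R * y ^+ j.
    apply: (@le_trans _ _ (j%:R * t^-1 ^+ j * y ^+ j)).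
      rewrite -mulrA -exprMn ler_peMr// exprn_ege1// mulrC ler_pdivlMr ?mul1r//.
    rewrite ler_wpM2r//; first by case/andP: (yj j).
    by case/andP: (truncn_itv (tj j)) => _ /ltW.
  have h : (1 - y ^+ j) ^+ N * (1 + y ^+ j) ^+ N <= 1.
    rewrite -exprMn exprn_ile1//; case/andP: (yj j) => a b; nra.
  have h2 := bernoulli_addr N (proj1 (andP (yj j))).
  rewrite /harmonic/= -[leRHS]mul1r ler_pdivlMr//.
  apply: le_trans h; rewrite ler_wpM2l//; first by rewrite exprn_ge0//; case/andP: (yj j); lra.
  by apply: le_trans h2; rewrite -natr1 addrC lerD2l.
- exact: cvg_cst.
- exact: cvg_harmonic.
Qed.

End step.

Section uniqueness.
Context (R : realType) (m n : nat).
Local Notation X := (borelM R m n).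
Local Notation M_ := 'M[R]_(m, n).
Local Notation Z_ := 'M[int]_(m, n).
Variable leb : {measure set X -> \bar R}.
Hypothesis lebP : is_lebesgue leb.
Local Notation q := (cubeP lebP).
Variable h : X -> R[i].
Hypothesis hI : cintegrable q h.
Hypothesis h0 : forall k : Z_, cintegral q (fun x => h x * chr (intm k) x) = 0.

(* The functions [b] such that [b h] has zero Fourier coefficients are closed under
   multiplication by trigonometric polynomials and under bounded limits, hence under
   multiplication by indicators of Borel sets of the torus. *)
Definition annihilated (b : X -> R) := [/\ measurable_fun setT b,
  exists C, forall x, `|b x| <= C &
  forall k : Z_, cintegral q (fun x => (b x)%:C * (h x * chr (intm k) x)) = 0].

Let hchrI (k : Z_) : cintegrable q (fun x => h x * chr (intm k) x).
Proof.
rewrite (_ : (fun x => _) = (fun x => chr (intm k) x * h x)); last first.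
  by apply/funext => x; rewrite mulrC.
apply: (cintegrable_bounded (C := 1) (cmeasurable_chr _)) => // x.
by rewrite sqnormC_chr.
Qed.

Let testI (b : X -> R) (k : Z_) : measurable_fun setT b -> (exists C, forall x, `|b x| <= C) ->
  cintegrable q (fun x => (b x)%:C * (h x * chr (intm k) x)).
Proof.
move=> mb [C bC]; apply: (@cintegrable_bounded _ _ _ _ _ _ (C ^+ 2)) => //.
move=> x; rewrite /sqnormC/= expr0n addr0 -real_normK ?num_real//.
by rewrite ler_pXn2r// ?nnegrE//; exact: le_trans (bC x).
Qed.

Lemma annihilated1 : annihilated (fun=> 1).
Proof.
split; [exact: measurable_cst|by exists 1 => x; rewrite normr1|move=> k].
by rewrite -[RHS](h0 k); apply: eq_cintegral => x; rewrite mul1r.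
Qed.

Lemma annihilated_lin a (b b' : X -> R) : annihilated b -> annihilated b' ->
  annihilated (fun x => a * b x + b' x).
Proof.
move=> [mb bB b0] [mb' bB' b0']; split.
- by apply: measurable_funD => //; apply: measurable_funM => //; exact: measurable_cst.
- have [C bC] := bB; have [C' bC'] := bB'; exists (`|a| * C + C') => x.
  by rewrite (le_trans (ler_normD _ _))// lerD// normrM ler_wpM2l.
- move=> k; rewrite (_ : (fun x => _) = fun x => a%:C * ((b x)%:C * (h x * chr (intm k) x)) +
      (b' x)%:C * (h x * chr (intm k) x)); last first.
    apply/funext => x; move: (h x * _) => [c d].
    by apply: complex_ext; rewrite /=; ring.
  rewrite cintegralD; [|exact/cintegrableZ/testI|exact: testI].
  by rewrite cintegralZ ?b0 ?b0' ?mulr0 ?addr0//; exact: testI.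
Qed.

(** The real part is rescaled into [0, 1], where [step_cvg] applies; the phase [z] gives access to
    cosines and sines alike. *)
Definition trig (z : R[i]) (l : Z_) (x : X) : R := (1 + complex.Re (z * chr (intm l) x)) / 2.

Lemma trig_itv z l x : sqnormC z = 1 -> 0 <= trig z l x <= 1.
Proof.
move=> z1; have : sqnormC (z * chr (intm l) x) = 1 by rewrite sqnormCM sqnormC_chr z1 mulr1.
rewrite /trig; move: (z * _) => [a b]; rewrite /sqnormC/= => ab.
have a1 : a ^+ 2 <= 1 by rewrite -ab lerDl sqr_ge0.
by apply/andP; split; nra.
Qed.

Lemma measurable_trig z l : measurable_fun setT (trig z l).
Proof.
apply: measurable_funM; last exact: measurable_cst.
apply: measurable_funD; first exact: measurable_cst.
by have [] := cmeasurableM (cmeasurable_cst X z) (cmeasurable_chr (intm l)).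
Qed.

Lemma annihilated_trig b z l : sqnormC z = 1 -> annihilated b ->
  annihilated (fun x => b x * trig z l x).
Proof.
move=> z1 [mb bB b0]; split.
- by apply: measurable_funM => //; exact: measurable_trig.
- have [C bC] := bB; exists C => x; have := trig_itv l x z1.
  move=> /andP[t0 t1]; rewrite normrM (ger0_norm t0) (le_trans _ (bC x))//.
  by rewrite ler_piMr.
- move=> k.
  (* With [w = z * chr (intm l) x] the factor is 1/2 + (w + conj w)/4: besides the constant part, it
     shifts the Fourier index by [l] and [- l]. *)
  rewrite (_ : (fun x => _) = fun x => 2^-1%:C * ((b x)%:C * (h x * chr (intm k) x)) +
      ((z * 4^-1%:C) * ((b x)%:C * (h x * chr (intm (k + l)) x)) +
       (conjc z * 4^-1%:C) * ((b x)%:C * (h x * chr (intm (k - l)) x)))); last first.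
    apply/funext => x; rewrite !intmD intmN !chrD chrN /trig.
    move: (chr _ x) (chr _ x) (h x) (b x) => [c1 c2] [d1 d2] [h1 h2] b1.
    by apply: complex_ext; rewrite /=; case: z z1 => z1 z2 _ /=; field.
  have I k' := testI k' mb bB.
  rewrite cintegralD; [|exact/cintegrableZ|by apply: cintegrableD; exact/cintegrableZ].
  rewrite cintegralD; [|exact/cintegrableZ|exact/cintegrableZ].
  by rewrite !cintegralZ// !b0 !mulr0 !addr0.
Qed.

Lemma annihilated_poly b z l (p : {poly R}) : sqnormC z = 1 -> annihilated b ->
  annihilated (fun x => b x * p.[trig z l x]).
Proof.
move=> z1 ab; elim/poly_ind: p => [|p c IH].
  rewrite (_ : (fun x => _) = fun x => -1 * b x + b x); first exact: annihilated_lin.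
  by apply/funext => x; rewrite horner0 mulr0 mulN1r addNr.
rewrite (_ : (fun x => _) = fun x => c * b x + (b x * p.[trig z l x]) * trig z l x).
  by apply: annihilated_lin => //; exact: annihilated_trig.
by apply/funext => x; rewrite hornerMXaddC; ring.
Qed.

Lemma annihilated_lim (b_ : nat -> X -> R) b C : (forall j, annihilated (b_ j)) ->
  (forall j x, `|b_ j x| <= C) -> (forall x, b_ ^~ x @ \oo --> b x) -> annihilated b.
Proof.
move=> ab bC bl.
have mb : measurable_fun setT b.
  by apply: (@measurable_fun_cvg _ _ _ _ b_) => // j; have [] := ab j.
have bC' x : `|b x| <= C.
  have : (fun j => `|b_ j x|) @ \oo --> `|b x| by apply: cvg_norm.
  move=> /cvg_lim <-//; apply: limr_le; first by apply: is_cvg_norm; apply/cvg_ex; exists (b x).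
  by apply: nearW => j.
have dct (r : X -> R) : q.-integrable setT (EFin \o r) ->
    (forall j, (\int[q]_x (b_ j x * r x)%:E = 0)%E) -> (\int[q]_x (b x * r x)%:E = 0)%E.
  move=> rI r0; have mr : measurable_fun setT r by move/measurable_int/measurable_EFinP : rI.
  have [] := @dominated_convergence _ _ _ q setT measurableT
    (fun j x => (b_ j x * r x)%:E) (fun x => (b x * r x)%:E) (fun x => C%:E * `|(r x)%:E|)%E.
  - by move=> j; apply/measurable_EFinP; apply: measurable_funM => //; have [] := ab j.
  - by apply/measurable_EFinP; exact: measurable_funM.
  - apply: aeW => x _; apply: cvg_EFin; first exact: nearW.
    by apply: cvgM => //; exact: cvg_cst.
  - by apply: integrableZl => //; exact: integrable_abse.
  - by apply: aeW => x j _; rewrite lee_fin normrM ler_wpM2r.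
  move=> _ _; rewrite (_ : [sequence _]_n = fun=> 0%E); last by apply/funext => j; exact: r0.
  by move=> /cvg_lim <-//; rewrite lim_cst.
have dct' (r : X -> R) : q.-integrable setT (EFin \o r) ->
    (forall j, Rintegral q setT (fun x => b_ j x * r x) = 0) ->
    Rintegral q setT (fun x => b x * r x) = 0.
  move=> rI r0; rewrite /Rintegral dct// => j.
  have mr : measurable_fun setT r by move/measurable_int/measurable_EFinP : rI.
  rewrite -[LHS]fineK; first exact: (congr1 EFin (r0 j)).
  apply: integrable_fin_num => //.
  apply: (le_integrable measurableT _ _ (integrableZl measurableT C rI)).
    by apply/measurable_EFinP; apply: measurable_funM => //; have [] := ab j.
  move=> x _; rewrite lee_fin !normrM ler_wpM2r//.
  by rewrite (le_trans (bC j x))// ler_norm.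
split => //; first by exists C.
move=> k; have [rI jI] := hchrI k.
have E (f : X -> R) x : complex.Re ((f x)%:C * (h x * chr (intm k) x)) = f x * complex.Re (h x * chr (intm k) x).
  by rewrite Re_mul/= mul0r subr0.
have F (f : X -> R) x : complex.Im ((f x)%:C * (h x * chr (intm k) x)) = f x * complex.Im (h x * chr (intm k) x).
  by rewrite Im_mul/= mul0r addr0.
apply: complex_ext => /=.
  under eq_Rintegral do rewrite E; apply: dct' => // j.
  have [_ _ /(_ k)/(congr1 (@complex.Re R))/=] := ab j.
  by under eq_Rintegral do rewrite E.
under eq_Rintegral do rewrite F; apply: dct' => // j.
have [_ _ /(_ k)/(congr1 (@complex.Im R))/=] := ab j.
by under eq_Rintegral do rewrite F.
Qed.

(** Requiring that multiplication by [\1_A] preserve every annihilated function, rather than that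
    [\1_A] itself be annihilated, makes the class stable under intersection. *)
Definition annset : set (set X) := [set A | measurable A /\
  forall b, annihilated b -> annihilated (fun x => b x * \1_A x)].

(** Polynomials in [trig z l] preserve annihilated functions, and by [step_cvg] the indicator is a
    bounded pointwise limit of such polynomials. *)
Lemma annset_trig z l t : sqnormC z = 1 -> 0 < t <= 1 ->
  annset [set x | trig z l x < t].
Proof.
move=> z1 t01; split.
  rewrite -[X in measurable X]setTI.
  rewrite (_ : [set x | _] = trig z l @^-1` `]-oo, t[%classic); last first.
    by apply/seteqP; split=> x /=; rewrite in_itv.
  by apply: measurable_trig.
move=> b ab; have [_ [C bC] _] := ab.
pose p j : {poly R} := (1 - 'X^j) ^+ step_expt t j.
have pE j x : (p j).[trig z l x] = (1 - trig z l x ^+ j) ^+ step_expt t j.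
  by rewrite /p horner_exp !hornerE.
apply: (@annihilated_lim (fun j x => b x * (p j).[trig z l x]) _ C).
- by move=> j; exact: annihilated_poly.
- move=> j x; have /andP[t0 t1] := trig_itv l x z1.
  have y0 : 0 <= trig z l x ^+ j by rewrite exprn_ge0.
  have y1 : trig z l x ^+ j <= 1 by rewrite exprn_ile1.
  rewrite (le_trans _ (bC x))// normrM ler_piMr// pE ger0_norm ?exprn_ge0 ?exprn_ile1//; lra.
- move=> x; apply: cvgM; first exact: cvg_cst.
  under eq_fun do rewrite pE.
  rewrite (_ : \1__ x = (trig z l x < t)%R%:R); first exact/step_cvg/trig_itv.
  by rewrite indicE; congr (_%:R); congr nat_of_bool; apply/idP/idP; rewrite inE.
Qed.

Lemma sigma_algebra_annset : sigma_algebra setT annset.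
Proof.
have aC A : annset A -> annset (~` A).
  move=> [mA aA]; split; first exact: measurableC.
  move=> b ab; rewrite (_ : (fun x => _) = fun x => -1 * (b x * \1_A x) + b x).
    by apply: annihilated_lin => //; exact: aA.
  by apply/funext => x; rewrite !indicE in_setC; case: (x \in A) => /=; ring.
have a0 : annset set0.
  split; first exact: measurable0.
  move=> b ab; rewrite (_ : (fun x => _) = fun x => -1 * b x + b x).
    exact: annihilated_lin.
  by apply/funext => x; rewrite indic0/= mulr0 mulN1r addNr.
have aI A B : annset A -> annset B -> annset (A `&` B).
  move=> [mA aA] [mB aB]; split; first exact: measurableI.
  move=> b ab; rewrite (_ : (fun x => _) = fun x => (b x * \1_A x) * \1_B x).
    by apply: aB; exact: aA.
  by apply/funext => x; rewrite indicI/= mulrA.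
split => // [A aA|F aF]; first by rewrite setTD; exact: aC.
pose G j := ~` \big[setI/setT]_(i < j) ~` F i.
have aT : annset setT by rewrite -setC0; exact: aC.
have aG j : annset (G j).
  by apply: (aC); apply: (@big_ind _ annset) => // i _; exact: aC.
have GE j x : G j x <-> exists2 i, (i < j)%N & F i x.
  rewrite /G setC_bigsetI; under eq_bigr do rewrite setCK.
  rewrite -bigcup_mkord; split=> [[i ? ?]|[i ? ?]]; by exists i.
split; first by apply: bigcupT_measurable => i; exact: (aF i).1.
move=> b ab; have [_ [C bC] _] := ab.
apply: (@annihilated_lim (fun j x => b x * \1_(G j) x) _ C).
- by move=> j; exact: (aG j).2.
- move=> j x; rewrite (le_trans _ (bC x))// normrM ler_piMr// indicE.
  by case: (_ \in _); rewrite ?normr1 ?normr0.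
- move=> x; apply: cvgM; first exact: cvg_cst.
  have [[i _ Fi]|nF] := pselect ((\bigcup_i F i) x).
    apply: cvg_near_cst; near=> j; rewrite !indicE !mem_set//; first by exists i.
    by apply/GE; exists i => //; near: j; exact: nbhs_infty_gt.
  apply: cvg_near_cst; apply: nearW => j; rewrite !indicE !memNset//.
  by move=> /GE[i _ Fi]; apply: nF; exists i.
Unshelve. all: by end_near. Qed.

Local Notation T' := (g_sigma_algebraType annset).

(** With [annset] as the sigma-algebra of [T'], it contains the Borel sets of the torus as soon as
    the coordinates of [fracm] are measurable on [T']. *)
Lemma measurable_annset (A : set X) : measurable (A : set T') <-> annset A.
Proof. by rewrite {1}/measurable/= sigma_algebra_id//; exact: sigma_algebra_annset. Qed.

Lemma chr_fracm (i : 'I_m) (j : 'I_n) (x : M_) : chr (intm (delta_mx i j)) x = expi2pi (fracm x i j).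
Proof.
rewrite -[LHS](chr_periodic _ (- floorm x)) intmN -/(fracm x) /chr; congr expi2pi.
rewrite /mxtrace (bigD1 i)//= big1 => [|l li]; last first.
  by rewrite mxE big1// => p _; rewrite !mxE (negPf li) mul0r.
rewrite addr0 mxE (bigD1 j)//= big1 => [|l lj]; last first.
  by rewrite !mxE (negPf lj) andbF mul0r.
by rewrite !mxE !eqxx mul1r addr0.
Qed.

Lemma annset_measurable_trig (g : X -> R) z l : sqnormC z = 1 ->
  (forall x, complex.Re (z * chr (intm l) x) = g x) ->
  measurable_fun setT (g : T' -> R).
Proof.
move=> z1 gE.
have gt x : (1 + g x) / 2 = trig z l x by rewrite /trig gE.
apply: (measurability _ (RGenInftyO.measurableE R)) => _ [_ [s ->] <-]; rewrite setTI.
(* [annset_trig] wants its threshold in ]0, 1]; beyond that range the sublevel set is empty or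
   everything. *)
have [s1|s1] := leP s (-1).
  rewrite (_ : _ @^-1` _ = set0) ?measurable0// -subset0 => x /=; rewrite in_itv/= => gs.
  have := trig_itv l x z1; rewrite -gt => /andP[? _]; lra.
have [s2|s2] := ltP 1 s.
  rewrite (_ : _ @^-1` _ = setT) ?measurableT//; apply/seteqP; split=> // x _ /=.
  by rewrite in_itv/=; have := trig_itv l x z1; rewrite -gt => /andP[_ ?]; lra.
rewrite (_ : _ @^-1` _ = [set x | trig z l x < (1 + s) / 2]).
  by apply/measurable_annset; apply: annset_trig => //; apply/andP; split; lra.
by apply/seteqP; split=> x /=; rewrite in_itv/= -gt; lra.
Qed.

Lemma fracm_itv (i : 'I_m) (j : 'I_n) (x : M_) : 0 <= fracm x i j < 1.
Proof. exact: cube_fracm. Qed.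

Lemma ltr_cos2pi (x y : R) : 0 <= x <= 2^-1 -> 0 <= y <= 2^-1 ->
  (cos (2 * pi * x) < cos (2 * pi * y)) = (y < x).
Proof.
move=> x01 y01; have p0 := pi_gt0 R.
rewrite ltr_cos ?ltr_pM2l ?mulr_gt0// in_itv/=; apply/andP; split; nra.
Qed.

Lemma cos2pi_sub (x : R) : cos (2 * pi * (1 - x)) = cos (2 * pi * x).
Proof.
rewrite mulrBr mulr1 cosB (_ : 2 * pi = pi *+ 2); last by rewrite mulr_natl.
by rewrite cos2pi sin2pi mul1r mul0r addr0.
Qed.

Lemma sin2pi_ge0 (y : R) : 0 <= y < 1 -> (0 <= sin (2 * pi * y)) = (y <= 2^-1).
Proof.
move=> /andP[y0 y1]; have p0 := pi_gt0 R.
have [y2|y2] := leP y 2^-1; first by apply: sin_ge0_pi; apply/andP; split; nra.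
apply/negbTE; rewrite -ltNge (_ : 2 * pi * y = pi + pi * (2 * y - 1)); last by ring.
rewrite sinD sinpi cospi mul0r add0r mulN1r oppr_lt0; apply: sin_gt0_pi.
by apply/andP; split; nra.
Qed.

(** A coordinate is recovered from its cosine and sine. Below [r <= 1/2] means: nonnegative sine and
    cosine larger than at [r]. Below [r > 1/2] means: nonnegative sine, or cosine smaller than at
    [r]. *)
Lemma measurable_annset_fracm (i : 'I_m) (j : 'I_n) : measurable_fun setT (fun x : T' => fracm (x : M_) i j).
Proof.
pose c (x : T') := cos (2 * pi * fracm (x : M_) i j).
pose s (x : T') := sin (2 * pi * fracm (x : M_) i j).
have mc : measurable_fun setT c.
  apply: (@annset_measurable_trig c 1 (delta_mx i j)); first exact: sqnormC1.
  by move=> x; rewrite mul1r chr_fracm.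
have ms : measurable_fun setT s.
  apply: (@annset_measurable_trig s (0 -i* 1) (delta_mx i j)).
    by rewrite /sqnormC/= expr0n add0r sqrrN expr1n.
  by move=> x; rewrite chr_fracm Re_mul/= mul0r mulN1r opprK add0r.
have msge : measurable [set x : T' | 0 <= s x].
  rewrite -[X in measurable X]setTI (_ : [set x | _] = s @^-1` `[0, +oo[%classic).
    exact: ms.
  by apply/seteqP; split=> x /=; rewrite in_itv/= andbT.
have mclt r : measurable [set x : T' | r < c x].
  rewrite -[X in measurable X]setTI (_ : [set x | _] = c @^-1` `]r, +oo[%classic).
    exact: mc.
  by apply/seteqP; split=> x /=; rewrite in_itv/= andbT.
apply: (measurability _ (RGenInftyO.measurableE R)) => _ [_ [r ->] <-]; rewrite setTI.
have [r0|r0] := leP r 0.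
  rewrite (_ : _ @^-1` _ = set0) ?measurable0// -subset0 => x /=; rewrite in_itv/= => gs.
  by have /andP[] := fracm_itv i j x; lra.
have [r1|r1] := leP 1 r.
  rewrite (_ : _ @^-1` _ = setT) ?measurableT//; apply/seteqP; split=> // x _ /=.
  by rewrite in_itv/=; have /andP[] := fracm_itv i j x; lra.
have [r2|r2] := leP r 2^-1.
  rewrite (_ : _ @^-1` _ = [set x : T' | 0 <= s x] `&` [set x : T' | cos (2 * pi * r) < c x]).
    exact: measurableI.
  apply/seteqP; split=> x /=; rewrite in_itv/= /s /c sin2pi_ge0 ?fracm_itv//.
    move=> xr; have /andP[x0 x1] := fracm_itv i j x.
    have x2 : fracm (x : M_) i j <= 2^-1 by lra.
    by split => //; rewrite ltr_cos2pi//; apply/andP; split; lra.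
  move=> [x2]; have /andP[x0 x1] := fracm_itv i j x.
  by rewrite ltr_cos2pi//; apply/andP; split; lra.
rewrite (_ : _ @^-1` _ = [set x : T' | 0 <= s x] `|` c @^-1` `]-oo, cos (2 * pi * r)[%classic).
  by apply: measurableU => //; rewrite -[X in measurable X]setTI; exact: mc.
apply/seteqP; split=> x /=; rewrite !in_itv/= /s /c sin2pi_ge0 ?fracm_itv//;
    have /andP[x0 x1] := fracm_itv i j x.
  move=> xr; have [x2|x2] := leP (fracm (x : M_) i j) 2^-1; [by left|right].
  by rewrite -cos2pi_sub -(cos2pi_sub r) ltr_cos2pi; [lra|apply/andP; split; lra|apply/andP; split; lra].
move=> [x2|]; first lra.
have [x2|x2] := leP (fracm (x : M_) i j) 2^-1; first lra.
by rewrite -cos2pi_sub -(cos2pi_sub r) ltr_cos2pi; [lra|apply/andP; split; lra|apply/andP; split; lra].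
Qed.

Lemma annset_fracm A : measurable A -> annset ((@fracm R m n : X -> X) @^-1` A).
Proof.
move=> mA; apply/measurable_annset; rewrite -[X in measurable X]setTI.
have mf : measurable_fun setT (fun x : T' => fracm (x : M_) : X).
  by apply: measurable_fun_borelM => i j; exact: measurable_annset_fracm.
exact: mf.
Qed.

Lemma cube_fourier_unique : {ae q, forall x, h x = 0}.
Proof.
have [rI jI] := hI.
have [mr mj] := cintegrable_cmeasurable hI.
have P (A : set X) : measurable A ->
    Rintegral q setT (fun x => \1_((@fracm R m n : X -> X) @^-1` A) x * complex.Re (h x)) = 0 /\
    Rintegral q setT (fun x => \1_((@fracm R m n : X -> X) @^-1` A) x * complex.Im (h x)) = 0.
  move=> mA; have [_ /(_ _ annihilated1)[_ _ /(_ 0)]] := annset_fracm mA.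
  rewrite intm0 => H; split.
    have := congr1 (@complex.Re R) H => /= E.
    rewrite -[RHS]E; apply: eq_Rintegral => x _.
    by rewrite chr0 mulr1 Re_mul/= mul0r subr0 mul1r.
  have := congr1 (@complex.Im R) H => /= E.
  rewrite -[RHS]E; apply: eq_Rintegral => x _.
  by rewrite chr0 mulr1 Im_mul/= mul0r addr0 mul1r.
have U (r : X -> R) : q.-integrable setT (EFin \o r) ->
    (forall A, measurable A -> Rintegral q setT (fun x => \1_((@fracm R m n : X -> X) @^-1` A) x * r x) = 0) ->
    {ae q, forall x, r x = 0}.
  move=> rI' r0.
  have : ae_eq q setT (EFin \o r) (cst 0%E).
    apply: (integral_ae_eq measurableT rI') => [|E _ mE]; first exact: measurable_cst.
    rewrite integral0.
    have rE : q.-integrable E (EFin \o r) by apply: integrableS rI'.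
    rewrite -[LHS]fineK; last exact: integrable_fin_num.
    rewrite -[RHS](congr1 EFin (r0 _ mE)); congr EFin.
    rewrite -/(Rintegral q E r) Rintegral_mkcond; apply: (congr1 fine).
    apply: ae_eq_integral => //.
    - apply/measurable_EFinP; apply/(measurable_restrictT _ mE); apply: measurable_funTS.
      by apply/measurable_EFinP; exact: measurable_int rI'.
    - apply/measurable_EFinP; apply: measurable_funM.
        by apply: measurable_indic; exact: (annset_fracm mE).1.
      by apply/measurable_EFinP; exact: measurable_int rI'.
    (* [annset_fracm] covers only preimages under [fracm]; on the cube, which carries [q], the
       preimage of [E] is [E]. *)
    have := cubeP_ae lebP; apply: filterS => x Qx _ /=.
    have xE : (x \in (@fracm R m n : X -> X) @^-1` E) = (x \in E).
      by apply/idP/idP; rewrite !inE/= fracm_id.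
    by rewrite patchE indicE xE; case: (x \in E) => /=; rewrite ?mul1r ?mul0r.
  by apply: filterS => x /(_ I)[].
have [] := conj (U _ rI (fun A mA => (P A mA).1)) (U _ jI (fun A mA => (P A mA).2)).
by apply: filterS2 => x r0 j0; exact: complex_ext.
Qed.

End uniqueness.

(** * Completeness and Plancherel *)

Section completeness.
Context (R : realType) d (T : measurableType d) (mu : {measure set T -> \bar R}).
Local Open Scope ereal_scope.

(** Cauchy-Schwarz with weights [2 ^+ l], whose inverses from [j] on add up to [2 * 2^-1 ^+ j]; the
    induction uses [(a + b)^2 <= 2 a^2 + 2 b^2]. *)
Lemma telescope_sqr (u : nat -> R) j p :
  ((u (j + p)%N - u j) ^+ 2 <= 2 * 2^-1 ^+ j *
    \sum_(j <= l < j + p) 2 ^+ l * (u l.+1 - u l) ^+ 2)%R.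
Proof.
elim: p j => [|p IH] j; first by rewrite addn0 subrr expr0n big_geq// mulr0.
rewrite big_ltn; last by rewrite addnS ltnS leq_addr.
rewrite -addSnnS.
set s := (\sum_(_ <= _ < _) _)%R.
have := IH j.+1; rewrite -/s [(2^-1 ^+ j.+1)%R]exprS => H.
have e1 : (2 * 2^-1 ^+ j * (2 ^+ j * (u j.+1 - u j) ^+ 2) = 2 * (u j.+1 - u j) ^+ 2 :> R)%R.
  by rewrite mulrA -(mulrA 2%R) -exprMn mulVf// expr1n mulr1.
rewrite mulrDr e1.
set a := (u (j.+1 + p)%N - u j.+1)%R in H; set b := (u j.+1 - u j)%R.
rewrite (_ : _ - u j = a + b)%R; last by rewrite /a /b; ring.
have : (0 <= (a - b) ^+ 2)%R by rewrite sqr_ge0.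
set y := (2^-1 ^+ j)%R in H *.
have H' : (a ^+ 2 <= y * s)%R.
  have e2 : (2 * (2^-1 * y) * s = y * s :> R)%R by rewrite mulrA divff// mul1r.
  by rewrite -e2.
clearbody a b; rewrite sqrrB sqrrD; nra.
Qed.

Lemma geometric_sum_le2 k : (\sum_(0 <= l < k) (2^-1 ^+ l)%:E <= 2%:E :> \bar R)%E.
Proof.
rewrite sumEFin lee_fin.
suff -> : (\sum_(0 <= l < k) 2^-1 ^+ l = 2 - 2 * 2^-1 ^+ k :> R)%R.
  by rewrite gerBl mulr_ge0// exprn_ge0.
elim: k => [|k IH]; first by rewrite big_geq// expr0 mulr1 subrr.
by rewrite big_nat_recr//= IH exprS; field.
Qed.

(** The decay [8^-1 ^+ j] lets the increments carry weights [2 ^+ l] in the series [G] and still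
    leaves a finite integral. Where [G] is finite, [telescope_sqr] makes the sequence Cauchy with
    error at most [2 * 2^-1 ^+ j * G], and integrating this error gives the rate. *)
Lemma L2_complete_real (f_ : nat -> T -> R) :
  (forall j, measurable_fun setT (f_ j)) ->
  (forall j, \int[mu]_x ((f_ j.+1 x - f_ j x) ^+ 2)%:E <= (8^-1 ^+ j)%:E) ->
  exists2 f : T -> R, measurable_fun setT f &
    forall j, \int[mu]_x ((f x - f_ j x) ^+ 2)%:E <= (4 * 2^-1 ^+ j)%:E.
Proof.
move=> mf fj.
pose dd l x : R := (2 ^+ l * (f_ l.+1 x - f_ l x) ^+ 2)%R.
have dd0 l x : (0 <= dd l x)%R by apply: mulr_ge0; [exact: exprn_ge0|exact: sqr_ge0].
have md l : measurable_fun setT (dd l).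
  apply: measurable_funM; first exact: measurable_cst.
  by apply: measurable_funX; exact: measurable_funB.
pose G x := \sum_(l <oo) (dd l x)%:E.
have G0 x : 0 <= G x by apply: nneseries_ge0 => l _; rewrite lee_fin.
have mG : measurable_fun setT G.
  apply: (@ge0_emeasurable_sum _ _ _ setT (fun l x => (dd l x)%:E) xpredT) => [l x _ _|l _].
    by rewrite lee_fin.
  exact/measurable_EFinP.
have IG : \int[mu]_x G x <= 2%:E.
  rewrite integral_nneseries//; last 2 first.
  - by move=> l; apply/measurable_EFinP.
  - by move=> l x _; rewrite lee_fin.
  apply: lime_le; first by apply: is_cvg_ereal_nneg_natsum => l _; apply: integral_ge0 => x _; rewrite lee_fin.
  apply: nearW => k; apply: le_trans (geometric_sum_le2 k).
  apply: lee_sum => l _; rewrite /dd.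
  under eq_integral do rewrite EFinM.
  rewrite ge0_integralZl//; last 2 first.
  - by apply/measurable_EFinP/measurable_funX/measurable_funB.
  - by move=> x _; rewrite lee_fin sqr_ge0.
  apply: (@le_trans _ _ ((2 ^+ l)%:E * (8^-1 ^+ l)%:E)).
    by rewrite lee_wpmul2l// lee_fin exprn_ge0.
  rewrite -EFinM lee_fin -exprMn.
  by apply: lerXn2r; rewrite ?nnegrE; lra.
have Gpart x j p : (\sum_(j <= l < j + p) dd l x)%:E <= G x.
  apply: (@le_trans _ _ (\sum_(0 <= l < j + p) (dd l x)%:E)).
    rewrite sumEFin lee_fin [leRHS](big_cat_nat (n := j))//=; last exact: leq_addr.
    by rewrite lerDr; apply: sumr_ge0 => l _.
  by apply: nneseries_lim_ge => l _; rewrite lee_fin.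
pose A := [set x | G x < +oo].
have mA : measurable A.
  rewrite (_ : A = setT `&` [set x | G x < +oo]); last by rewrite setTI.
  exact: emeasurable_fun_infty_o.
have Abound x j p : A x -> ((f_ (j + p)%N x - f_ j x) ^+ 2 <= 2 * 2^-1 ^+ j * fine (G x))%R.
  move=> Ax; apply: le_trans (telescope_sqr (fun j => f_ j x) j p) _.
  rewrite ler_wpM2l ?mulr_ge0 ?exprn_ge0// -lee_fin fineK ?ge0_fin_numE//.
  exact: Gpart.
(* Cut off where [G] is infinite, so that the sequence converges everywhere and its limit is
   measurable. *)
pose F j x := (f_ j x * \1_A x)%R.
have mF j : measurable_fun setT (F j).
  by apply: measurable_funM => //; exact: measurable_indic.
have cF x : cvgn (F ^~ x).
  have [Ax|nAx] := pselect (A x); last first.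
    rewrite /F indicE memNset//; under eq_fun do rewrite mulr0.
    exact: is_cvg_cst.
  rewrite /F indicE mem_set//; under eq_fun do rewrite mulr1.
  apply/cauchy_cvgP/cauchy_exP => e e0.
  have g0 : (0 <= fine (G x))%R by rewrite fine_ge0.
  have : (fun j => 2 * 2^-1 ^+ j * fine (G x))%R @ \oo --> (2 * 0 * fine (G x))%R.
    apply: cvgM; last exact: cvg_cst; apply: cvgM; first exact: cvg_cst.
    by apply: cvg_expr; rewrite ger0_norm//; lra.
  rewrite mulr0 mul0r => /cvgr_lt/(_ (e ^+ 2)%R); rewrite exprn_gt0// => /(_ isT)[j _ je].
  exists (f_ j x); exists j => // k /= jk.
  have := Abound x j (k - j)%N Ax; rewrite subnKC// => H.
  rewrite -ball_normE/= distrC ltNge; apply/negP => ek.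
  have := le_lt_trans H (je j (leqnn j)); rewrite ltNge => /negP; apply.
  by rewrite -[leRHS]real_normK ?num_real// lerXn2r ?nnegrE// ltW.
exists (fun x => limn (F ^~ x)).
  by apply: (measurable_fun_cvg mF) => x _; exact: cF.
move=> j.
have fin : mu (~` A) = 0.
  have : mu.-integrable setT G.
    apply/integrableP; split => //; under eq_integral do rewrite gee0_abs//.
    exact: le_lt_trans IG (ltry _).
  move=> /(integrable_ae measurableT)[N [mN N0 sN]].
  apply/eqP; rewrite -measure_le0 -N0; apply: le_measure; rewrite ?inE//; first exact: measurableC.
  move=> x nAx; apply: sN => /(_ I); rewrite ge0_fin_numE// => Ax; exact: nAx.
have pt x : A x -> ((limn (F ^~ x) - f_ j x) ^+ 2)%:E <= (2 * 2^-1 ^+ j)%:E * G x.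
  move=> Ax; rewrite -[G x]fineK ?ge0_fin_numE// -EFinM lee_fin.
  have : (fun p => (F (j + p)%N x - f_ j x) ^+ 2)%R @ \oo --> ((limn (F ^~ x) - f_ j x) ^+ 2)%R.
    rewrite expr2; under eq_fun do rewrite expr2.
    have c : (fun p => F (j + p)%N x - f_ j x)%R @ \oo --> (limn (F ^~ x) - f_ j x)%R.
      apply: cvgB; last exact: cvg_cst.
      have H : (fun p => F (p + j)%N x) @ \oo --> limn (F ^~ x).
        by have := cF x; rewrite -(cvg_shiftn j (F ^~ x)).
      by under eq_fun do rewrite addnC; exact: H.
    exact: cvgM.
  move=> c; rewrite -(cvg_lim _ c)//; apply: limr_le; first by apply/cvg_ex; eexists; exact: c.
  apply: nearW => p; rewrite {1}/F indicE mem_set// mulr1; exact: Abound.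
apply: (@le_trans _ _ (\int[mu]_x ((2 * 2^-1 ^+ j)%:E * G x))).
  apply: ae_ge0_le_integral => //.
  - by move=> x _; rewrite lee_fin sqr_ge0.
  - apply/measurable_EFinP/measurable_funX/measurable_funB => //.
    by apply: (measurable_fun_cvg mF) => x _; exact: cF.
  - by move=> x _; rewrite mule_ge0// lee_fin mulr_ge0// exprn_ge0.
  - exact: measurable_funeM.
  - exists (~` A); split => //; first exact: measurableC.
    by move=> x nx Ax; apply: nx => _; exact: pt.
rewrite ge0_integralZl//.
apply: (@le_trans _ _ ((2 * 2^-1 ^+ j)%:E * 2%:E)).
  by rewrite lee_wpmul2l// lee_fin mulr_ge0// exprn_ge0.
by rewrite -EFinM lee_fin; lra.
Qed.

Lemma L2_complete (f_ : nat -> T -> R[i]) :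
  (forall j, cmeasurable (f_ j)) ->
  (forall j, norm2 mu (fun x => (f_ j.+1 x - f_ j x)%R) <= (8^-1 ^+ j)%:E) ->
  exists2 f : T -> R[i], cmeasurable f &
    forall j, norm2 mu (fun x => (f x - f_ j x)%R) <= (8 * 2^-1 ^+ j)%:E.
Proof.
move=> mf fj.
have le_fj (p : R[i] -> R) : (forall z, p z ^+ 2 <= sqnormC z)%R ->
    (forall z w, p (z - w) = p z - p w)%R -> (forall j, measurable_fun setT (p \o f_ j)) ->
    forall j, \int[mu]_x ((p (f_ j.+1 x) - p (f_ j x)) ^+ 2)%:E <= (8^-1 ^+ j)%:E.
  move=> pn pB mp j; apply: le_trans (fj j); apply: ge0_le_integral => //.
  - by move=> x _; rewrite lee_fin sqr_ge0.
  - by apply/measurable_EFinP/measurable_funX/measurable_funB; exact: mp.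
  - by apply: measurable_sqnormC; exact: cmeasurableB.
  - by move=> x _; rewrite lee_fin -pB pn.
have ReB (z w : R[i]) : (complex.Re (z - w) = complex.Re z - complex.Re w)%R.
  by rewrite Re_add Re_opp.
have ImB (z w : R[i]) : (complex.Im (z - w) = complex.Im z - complex.Im w)%R.
  by rewrite Im_add Im_opp.
have [r mr rP] := L2_complete_real (fun j => (mf j).1)
  (le_fj _ (@sqnormC_Re R) ReB (fun j => (mf j).1)).
have [s ms sP] := L2_complete_real (fun j => (mf j).2)
  (le_fj _ (@sqnormC_Im R) ImB (fun j => (mf j).2)).
exists (fun x => r x +i* s x)%R; first by [].
move=> j; rewrite /norm2.
under eq_integral do rewrite /sqnormC ReB ImB EFinD.
rewrite ge0_integralD//.
- apply: (le_trans (leeD (rP j) (sP j))); rewrite -EFinD lee_fin; lra.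
- by move=> x _; rewrite lee_fin sqr_ge0.
- by apply/measurable_EFinP/measurable_funX/measurable_funB => //; exact: (mf j).1.
- by move=> x _; rewrite lee_fin sqr_ge0.
- by apply/measurable_EFinP/measurable_funX/measurable_funB => //; exact: (mf j).2.
Qed.

End completeness.

(** * Fourier coefficients and Bessel's identity on the torus *)

Section fourier.
Context (R : realType) (m n : nat).
Local Notation X := (borelM R m n).
Local Notation M_ := 'M[R]_(m, n).
Local Notation Z_ := 'M[int]_(m, n).
Variable leb : {measure set X -> \bar R}.
Hypothesis lebP : is_lebesgue leb.
Local Notation q := (cubeP lebP).
Variable e : nat -> Z_.
Hypothesis e_bij : bijective e.

Definition fourier_coef (k : Z_) (g : X -> R[i]) : R[i] :=
  cintegral q (fun x => g x * conjc (chr (intm k) x)).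

Lemma coef_cintegrable k g : L2 q g -> cintegrable q (fun x => g x * conjc (chr (intm k) x)).
Proof.
move=> Lg; apply: L2_cintegrable; apply: L2_unimodular => //.
  exact/cmeasurableJ/cmeasurable_chr.
by move=> x; rewrite sqnormCJ sqnormC_chr.
Qed.

Lemma coefD k f g : L2 q f -> L2 q g -> fourier_coef k (fun x => f x + g x) = fourier_coef k f + fourier_coef k g.
Proof.
move=> Lf Lg; rewrite -cintegralD; [|exact: coef_cintegrable|exact: coef_cintegrable].
by apply: eq_cintegral => x; rewrite mulrDl.
Qed.

Lemma coefZ k g c : L2 q g -> fourier_coef k (fun x => c * g x) = c * fourier_coef k g.
Proof.
move=> Lg; rewrite -cintegralZ; last exact: coef_cintegrable.
by apply: eq_cintegral => x; rewrite mulrA.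
Qed.

Lemma coefB k f g : L2 q f -> L2 q g -> fourier_coef k (fun x => f x - g x) = fourier_coef k f - fourier_coef k g.
Proof.
move=> Lf Lg; rewrite -mulN1r -coefZ// -coefD//; last exact: L2Z.
by apply: eq_cintegral => x; rewrite mulN1r.
Qed.

Lemma coef_chr k l : fourier_coef k (chr (intm l)) = (k == l)%:R.
Proof.
rewrite eq_sym -subr_eq0 -(cintegral_chr lebP e_bij); apply: eq_cintegral => x.
by rewrite intmD intmN chrD chrN.
Qed.

Lemma sqnormC_coef_le k g : L2 q g -> ((sqnormC (fourier_coef k g))%:E <= norm2 q g)%E.
Proof.
move=> Lg; have u1 x : sqnormC (conjc (chr (intm k) x)) = 1 by rewrite sqnormCJ sqnormC_chr.
apply: (@le_trans _ _ (norm2 q (fun x => g x * conjc (chr (intm k) x)))).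
  apply: sqnormC_cintegral_le; apply: L2_unimodular => //.
  exact/cmeasurableJ/cmeasurable_chr.
by rewrite /norm2; under eq_integral do rewrite sqnormCM u1 mulr1.
Qed.

Definition trig_sum (a : nat -> R[i]) i0 j (x : X) := \sum_(i0 <= i < j) a i * chr (intm (e i)) x.

Lemma L2_tsum a i0 j : L2 q (trig_sum a i0 j).
Proof.
rewrite /trig_sum; elim: (index_iota i0 j) => [|i s IH].
  by under eq_fun do rewrite big_nil; exact: L2_cst.
by under eq_fun do rewrite big_cons; apply: L2D => //; apply/L2Z/L2_chr.
Qed.

Lemma coef_tsum a i0 j k :
  fourier_coef (e k) (trig_sum a i0 j) = if (i0 <= k < j)%N then a k else 0.
Proof.
rewrite -mem_index_iota /trig_sum; have := iota_uniq i0 (j - i0).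
rewrite -/(index_iota i0 j); elim: (index_iota i0 j) => [_|i s IH /= /andP[nis us]].
  rewrite /fourier_coef (_ : (fun x => _) = fun=> 0) ?cintegral_cst//.
  by apply/funext => x; rewrite big_nil mul0r.
rewrite (_ : (fun x => _) = fun x => a i * chr (intm (e i)) x + \sum_(i <- s) a i * chr (intm (e i)) x); last first.
  by apply/funext => x; rewrite big_cons.
rewrite coefD; last 2 first.
- exact/L2Z/L2_chr.
- elim: s {IH nis us} => [|l s IHs]; first by under eq_fun do rewrite big_nil; exact: L2_cst.
  by under eq_fun do rewrite big_cons; apply: L2D => //; apply/L2Z/L2_chr.
rewrite coefZ ?coef_chr; last exact: L2_chr.
rewrite IH// inE (inj_eq (bij_inj e_bij)); case: eqP => [->|_] /=; last by rewrite mulr0 add0r.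
by rewrite (negPf nis) mulr1 addr0.
Qed.

Lemma norm2_proj_chr g k : L2 q g -> norm2 q g =
  (norm2 q (fun x => (g x - fourier_coef k g * chr (intm k) x)%R) + (sqnormC (fourier_coef k g))%:E)%E.
Proof.
by move=> Lg; apply: norm2_proj => //; [exact: cmeasurable_chr|exact: sqnormC_chr].
Qed.

Lemma norm2_tsum a i0 j : norm2 q (trig_sum a i0 j) =
  (\sum_(i0 <= i < j) (sqnormC (a i))%:E)%E.
Proof.
elim: j => [|j IH].
  rewrite big_geq// /trig_sum /norm2; under eq_integral do rewrite big_geq// sqnormC0.
  by rewrite integral0.
have [ij|ji] := leqP i0 j; last first.
  rewrite big_geq// /trig_sum /norm2; under eq_integral do rewrite big_geq// sqnormC0.
  by rewrite integral0.
rewrite (norm2_proj_chr (e j) (L2_tsum _ _ _)) coef_tsum ij ltnSn/= big_nat_recr//= -IH.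
by congr (norm2 _ _ + _)%E; apply/funext => x; rewrite /trig_sum big_nat_recr//= addrK.
Qed.

(** Each step projects the remainder on the next character. Its coefficient there is still that of
    [g], because the sum already subtracted involves other characters only. *)
Lemma bessel_id g j : L2 q g -> norm2 q g =
  (norm2 q (fun x => (g x - trig_sum (fun i => fourier_coef (e i) g) 0 j x)%R) +
   \sum_(0 <= i < j) (sqnormC (fourier_coef (e i) g))%:E)%E.
Proof.
move=> Lg; elim: j => [|j ->].
  rewrite big_geq// adde0; congr (norm2 _ _); apply/funext => x.
  by rewrite /trig_sum big_geq// subr0.
have Lt := L2_tsum (fun i => fourier_coef (e i) g) 0 j.
have Ld : L2 q (fun x => g x - trig_sum (fun i => fourier_coef (e i) g) 0 j x).
  apply: L2D => //; rewrite (_ : (fun x => _) = fun x => -1 * trig_sum (fun i => fourier_coef (e i) g) 0 j x).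
    exact: L2Z.
  by apply/funext => x; rewrite mulN1r.
rewrite (norm2_proj_chr (e j) Ld) coefB// coef_tsum ltnn andbF subr0.
rewrite big_nat_recr//= -addeA [X in (_ + X)%E = _]addeC; congr (norm2 _ _ + _)%E.
by apply/funext => x; rewrite /trig_sum big_nat_recr//= opprD addrA.
Qed.

End fourier.

(** * Fourier synthesis and Plancherel with a parameter *)

Section plancherel.
Context (R : realType) (m n : nat).
Local Notation X := (borelM R m n).
Local Notation M_ := 'M[R]_(m, n).
Local Notation Z_ := 'M[int]_(m, n).
Variable leb : {measure set X -> \bar R}.
Hypothesis lebP : is_lebesgue leb.
Local Notation q := (cubeP lebP).
Variable e : nat -> Z_.
Hypothesis e_bij : bijective e.
Local Notation coef := (fourier_coef lebP).
Local Notation tsum := (trig_sum e).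
Local Notation QQ := (q \x q)%E.

Lemma cmeasurable_slice (F : X * X -> R[i]) x : cmeasurable F -> cmeasurable (fun y => F (x, y)).
Proof. by apply: cmeasurable_comp; exact: pair1_measurable. Qed.

Lemma cmeasurable_coef k (F : X * X -> R[i]) : cmeasurable F ->
  cmeasurable (fun x => coef k (fun y => F (x, y))).
Proof.
move=> mF.
have mG : cmeasurable (fun p : X * X => F p * conjc (chr (intm k) p.2)).
  apply: cmeasurableM => //; apply: cmeasurableJ.
  by apply: (cmeasurable_comp (f := chr (intm k))); [exact: measurable_snd|exact: cmeasurable_chr].
have H (g : X * X -> R) : measurable_fun setT g ->
    measurable_fun setT (fun x => Rintegral q setT (fun y => g (x, y))).
  move=> mg; rewrite /Rintegral.
  apply: (measurableT_comp (f := fine)); first exact: fine_measurable.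
  (* Tonelli's measurability statement concerns nonnegative functions, hence the split into positive
     and negative parts. *)
  under eq_fun do rewrite integralE.
  have mg' : measurable_fun setT (EFin \o g) by exact/measurable_EFinP.
  apply: emeasurable_funB.
    have := @measurable_fun_fubini_tonelli_F _ _ _ _ R q _ (measurable_funepos mg') (fun _ => funepos_ge0 _ _).
    by rewrite /fubini_F; under eq_fun do under eq_integral do rewrite funeposE;
      under [X in _ -> measurable_fun _ X]eq_fun do under eq_integral do rewrite funeposE.
  have := @measurable_fun_fubini_tonelli_F _ _ _ _ R q _ (measurable_funeneg mg') (fun _ => funeneg_ge0 _ _).
  by rewrite /fubini_F; under eq_fun do under eq_integral do rewrite funenegE;
    under [X in _ -> measurable_fun _ X]eq_fun do under eq_integral do rewrite funenegE.
by split; [exact: (H _ mG.1)|exact: (H _ mG.2)].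
Qed.

Lemma norm2_slices (F : X * X -> R[i]) : cmeasurable F ->
  norm2 QQ F = (\int[q]_x norm2 q (fun y => F (x, y)))%E.
Proof.
move=> mF; rewrite /norm2 fubini_tonelli1//; first exact: measurable_sqnormC.
by move=> p; rewrite lee_fin sqnormC_ge0.
Qed.

Lemma measurable_norm2_slice (F : X * X -> R[i]) : cmeasurable F ->
  measurable_fun setT (fun x => norm2 q (fun y => F (x, y))).
Proof.
move=> mF; apply: (measurable_fun_fubini_tonelli_F (m2 := q) (fun p => (sqnormC (F p))%:E)).
  exact: measurable_sqnormC.
by move=> p; rewrite lee_fin sqnormC_ge0.
Qed.

Lemma L2_slice (F : X * X -> R[i]) : L2 QQ F -> {ae q, forall x, L2 q (fun y => F (x, y))}.
Proof.
move=> [mF nF]; have mF2 := measurable_norm2_slice mF.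
have : q.-integrable setT (fun x => norm2 q (fun y => F (x, y))).
  apply/integrableP; split => //; under eq_integral do rewrite gee0_abs ?norm2_ge0//.
  by rewrite -norm2_slices.
move=> /(integrable_ae measurableT); apply: filterS => x /(_ I) fx.
by split; [exact: cmeasurable_slice|rewrite -ge0_fin_numE// norm2_ge0].
Qed.

Lemma norm2_eq0 d (T : measurableType d) (mu : {measure set T -> \bar R}) (f : T -> R[i]) :
  cmeasurable f -> norm2 mu f = 0%E <-> {ae mu, forall x, f x = 0}.
Proof.
move=> mf; split=> [f0|f0].
  have : (\int[mu]_x `|(sqnormC (f x))%:E| = 0)%E.
    by rewrite -[RHS]f0; apply: eq_integral => x _; rewrite gee0_abs// lee_fin sqnormC_ge0.
  move=> /(ae_eq_integral_abs _ measurableT (measurable_sqnormC mf)).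
  by apply: filterS => x /(_ I)[] /sqnormC_eq0.
rewrite /norm2 -(integral0 mu setT); apply: ge0_ae_eq_integral => //.
- exact: measurable_sqnormC.
- by move=> x _; rewrite lee_fin sqnormC_ge0.
- by apply: filterS f0 => x -> _; rewrite sqnormC0.
Qed.

(** The bound [8^-1 ^+ l] is the rate demanded by [L2_complete]; [l <= M l] ensures that every index
    is eventually included. *)
Lemma tail_subsequence (a : nat -> \bar R) : (forall i, (0 <= a i)%E) ->
  (\sum_(i <oo) a i < +oo)%E ->
  exists M : nat -> nat, [/\ forall l, (l <= M l)%N, forall l, (M l <= M l.+1)%N &
    forall l, (\sum_(M l <= i < M l.+1) a i <= (8^-1 ^+ l)%:E)%E].
Proof.
move=> a0 afin.
have Nex l : exists N : nat, forall j k, (N <= j)%N -> (\sum_(j <= i < k) a i <= (8^-1 ^+ l)%:E)%E.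
  have sfin : (\sum_(i <oo) a i)%E \is a fin_num.
    by rewrite ge0_fin_numE//; apply: nneseries_ge0.
  have e0 : (0 < (8^-1 ^+ l)%:E :> \bar R)%E by rewrite lte_fin exprn_gt0.
  have : ((fun k => \sum_(0 <= i < k) a i)%E @ \oo --> \sum_(i <oo) a i)%E.
    exact: is_cvg_nneseries.
  rewrite -[X in _ --> X]fineK// => /fine_cvgP[_ /=]/cvgrPdist_le/(_ (8^-1 ^+ l)); rewrite exprn_gt0// => /(_ isT)[N _ HN].
  exists N => j k Nj; have [jk|kj] := leqP j k; last first.
    by rewrite big_geq ?(ltnW kj)// lee_fin exprn_ge0.
  have afin' i : a i \is a fin_num.
    rewrite ge0_fin_numE//; apply: le_lt_trans afin.
    apply: (@le_trans _ _ (\sum_(0 <= k < i.+1) a k)%E); last by apply: nneseries_lim_ge.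
    by rewrite big_nat_recr//= leeDr// sume_ge0.
  have jkS : (\sum_(0 <= i < k) a i = \sum_(0 <= i < j) a i + \sum_(j <= i < k) a i)%E.
    by rewrite (big_cat_nat (n := j)).
  have kS : (\sum_(0 <= i < k) a i <= \sum_(i <oo) a i)%E by exact: nneseries_lim_ge.
  have jf : (\sum_(0 <= i < j) a i)%E \is a fin_num by apply/sum_fin_numP => i _ _.
  have := HN j Nj; rewrite /= => H.
  have : (\sum_(j <= i < k) a i <= \sum_(i <oo) a i - \sum_(0 <= i < j) a i)%E.
    by rewrite leeBrDl// -jkS.
  move=> /le_trans; apply.
  rewrite -(fineK sfin) -(fineK jf) -EFinB lee_fin.
  exact: le_trans (ler_norm _) H.
have [N NP] := choice Nex.
exists (fun l => (\sum_(k < l.+1) N k + l)%N); split=> [l|l|l]; first exact: leq_addl.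
  by apply: leq_add => //; rewrite [leqRHS]big_ord_recr/= leq_addr.
by apply: NP; rewrite big_ord_recr/= -addnA addnCA leq_addr.
Qed.

Lemma le0_geometric (x : \bar R) (K : R) :
  (forall l, (x <= (K * 2^-1 ^+ l)%:E)%E) -> (x <= 0)%E.
Proof.
move=> xl.
have c : (fun l => (K * 2^-1 ^+ l)%:E) @ \oo --> (0%E : \bar R).
  apply: cvg_EFin; first exact: nearW.
  rewrite -[X in _ --> X](mulr0 K); apply: cvgM; first exact: cvg_cst.
  by apply: cvg_expr; rewrite ger0_norm//; lra.
rewrite -(cvg_lim _ c)//; apply: lime_ge; first by apply/cvg_ex; eexists; exact: c.
exact: nearW.
Qed.

Lemma cmeasurable_tsum (c : nat -> X -> R[i]) i0 j : (forall i, cmeasurable (c i)) ->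
  cmeasurable (fun p : X * X => tsum (fun i => c i p.1) i0 j p.2).
Proof.
move=> mc; apply: (@cmeasurable_sum _ _ _ _ _ (fun i (p : X * X) => c i p.1 * chr (intm (e i)) p.2)) => i.
apply: cmeasurableM.
  by apply: (cmeasurable_comp (f := c i)); [exact: measurable_fst|].
by apply: (cmeasurable_comp (f := chr (intm (e i)))); [exact: measurable_snd|exact: cmeasurable_chr].
Qed.

Lemma norm2_tsum2 (c : nat -> X -> R[i]) i0 j : (forall i, cmeasurable (c i)) ->
  norm2 QQ (fun p : X * X => tsum (fun i => c i p.1) i0 j p.2) =
  (\sum_(i0 <= i < j) norm2 q (c i))%E.
Proof.
move=> mc; rewrite norm2_slices; last exact: cmeasurable_tsum.
transitivity (\int[q]_x (\sum_(i0 <= i < j) (sqnormC (c i x))%:E))%E.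
  by apply: eq_integral => x _; exact: (norm2_tsum lebP e_bij (fun i => c i x) i0 j).
rewrite ge0_integral_sum// => [i|i x _]; first exact: measurable_sqnormC.
by rewrite lee_fin sqnormC_ge0.
Qed.

(** The Riesz-Fischer theorem with a parameter [x]: partial sums along a fast subsequence converge
    in L2 of the product. The last clause keeps the approximation, which [plancherel] uses. *)
Lemma fourier_synthesis (c : nat -> X -> R[i]) : (forall i, cmeasurable (c i)) ->
  (\sum_(i <oo) norm2 q (c i) < +oo)%E ->
  exists F : X * X -> R[i], [/\ L2 QQ F,
    forall i, {ae q, forall x, coef (e i) (fun y => F (x, y)) = c i x} &
    forall l, exists j,
      (norm2 QQ (fun p => (F p - tsum (fun i => c i p.1) 0 j p.2)%R) <= (8 * 2^-1 ^+ l)%:E)%E].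
Proof.
move=> mc cfin.
have [M [lM MS Mtail]] := tail_subsequence (fun i => norm2_ge0 q (c i)) cfin.
pose f_ l (p : X * X) := tsum (fun i => c i p.1) 0 (M l) p.2.
have mf l : cmeasurable (f_ l) by exact: cmeasurable_tsum.
have fS l : (fun p => f_ l.+1 p - f_ l p) = (fun p => tsum (fun i => c i p.1) (M l) (M l.+1) p.2).
  apply/funext => p; rewrite /f_ /trig_sum (big_cat_nat (n := M l))//=.
  by rewrite addrAC subrr add0r.
have [|F mF FP] := @L2_complete _ _ _ QQ f_ mf.
  by move=> l; rewrite fS norm2_tsum2.
have cf i : (norm2 q (c i) < +oo)%E.
  apply: le_lt_trans cfin.
  apply: (@le_trans _ _ (\sum_(0 <= k < i.+1) norm2 q (c k))%E).
    by rewrite big_nat_recr//= leeDr// sume_ge0// => k _; exact: norm2_ge0.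
  by apply: nneseries_lim_ge => k _ _; exact: norm2_ge0.
have Lf l : L2 QQ (f_ l).
  split => //; rewrite /f_ norm2_tsum2//.
  by apply: lte_sum_pinfty => i _; exact: cf.
have LF : L2 QQ F.
  rewrite (_ : F = (fun p => (F p - f_ 0%N p) + f_ 0%N p)).
    apply: L2D => //; split; first exact: cmeasurableB.
    exact: le_lt_trans (FP 0%N) (ltry _).
  by apply/funext => p; rewrite subrK.
exists F; split => // [i|l]; last by exists (M l); exact: FP.
have mcF := cmeasurable_coef (e i) mF.
have md : cmeasurable (fun x => coef (e i) (fun y => F (x, y)) - c i x) by exact: cmeasurableB.
apply: filterS (_ : {ae q, forall x, coef (e i) (fun y => F (x, y)) - c i x = 0}).
  by move=> x /eqP; rewrite subr_eq0 => /eqP.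
apply/(norm2_eq0 _ md)/eqP; rewrite eq_le norm2_ge0 andbT.
(* Once the partial sum contains the index [e i], its coefficient there is [c i], so the error on
   the coefficient is at most the error on the partial sum. *)
apply: (@le0_geometric _ 8) => l; pose l' := maxn l i.+1.
have il' : (i < M l')%N by apply: leq_trans (lM l'); exact: leq_maxr.
apply: (@le_trans _ _ (8 * 2^-1 ^+ l')%:E); last first.
  rewrite lee_fin ler_wpM2l// ler_wiXn2l ?leq_maxl//; lra.
apply: le_trans (FP l').
have mFf : cmeasurable (fun p => F p - f_ l' p) by exact: cmeasurableB.
rewrite norm2_slices//; apply: ae_ge0_le_integral => //.
- by move=> x _; rewrite lee_fin sqnormC_ge0.
- exact: measurable_sqnormC.
- by move=> x _; exact: norm2_ge0.
- exact: (measurable_norm2_slice mFf).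
have := L2_slice LF; apply: filterS => x Lx _.
rewrite (_ : c i x = coef (e i) (tsum (fun i => c i x) 0 (M l'))); last first.
  by rewrite (coef_tsum lebP e_bij) il'.
rewrite -coefB//; last exact: L2_tsum.
apply: sqnormC_coef_le; apply: L2B => //; exact: L2_tsum.
Qed.

Lemma bessel_id2 (F : X * X -> R[i]) j : L2 QQ F -> norm2 QQ F =
  (norm2 QQ (fun p => (F p - tsum (fun i => coef (e i) (fun y => F (p.1, y))) 0 j p.2)%R) +
   \sum_(0 <= i < j) norm2 q (fun x => coef (e i) (fun y => F (x, y))))%E.
Proof.
move=> LF; have mF := LF.1.
have mc i := cmeasurable_coef (e i) mF.
have mt := cmeasurable_tsum 0 j mc.
have md : cmeasurable (fun p : X * X => F p - tsum (fun i => coef (e i) (fun y => F (p.1, y))) 0 j p.2).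
  exact: cmeasurableB.
have s0 i x : (0 <= (sqnormC (coef (e i) (fun y => F (x, y))))%:E)%E by rewrite lee_fin sqnormC_ge0.
have ms i : measurable_fun setT (fun x => (sqnormC (coef (e i) (fun y => F (x, y))))%:E).
  exact: measurable_sqnormC.
rewrite (norm2_slices md) -ge0_integral_sum// -ge0_integralD//; last 4 first.
- by move=> x _; exact: norm2_ge0.
- exact: (measurable_norm2_slice md).
- by move=> x _; exact: sume_ge0.
- exact: emeasurable_sum.
rewrite norm2_slices//; apply: ge0_ae_eq_integral => //.
- exact: (measurable_norm2_slice mF).
- by apply: emeasurable_funD; [exact: (measurable_norm2_slice md)|exact: emeasurable_sum].
- by move=> x _; exact: norm2_ge0.
- by move=> x _; rewrite adde_ge0 ?norm2_ge0// sume_ge0.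
have := L2_slice LF; apply: filterS => x Lx _.
exact: bessel_id.
Qed.

(** Bessel gives one inequality. For the other, a function [F'] is synthesized from the coefficients
    of [F]; by uniqueness on almost every slice it equals [F], so the partial sums that approximate
    [F'] approximate [F]. *)
Theorem plancherel (F : X * X -> R[i]) : L2 QQ F ->
  norm2 QQ F = (\sum_(i <oo) norm2 q (fun x => coef (e i) (fun y => F (x, y))))%E.
Proof.
move=> LF; have mF := LF.1.
pose c i x := coef (e i) (fun y => F (x, y)).
have mc i : cmeasurable (c i) by exact: cmeasurable_coef.
have bessel : (\sum_(i <oo) norm2 q (c i) <= norm2 QQ F)%E.
  apply: lime_le; first by apply: is_cvg_ereal_nneg_natsum => i _; exact: norm2_ge0.
  by apply: nearW => j; rewrite (bessel_id2 j LF) leeDr// norm2_ge0.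
apply/eqP; rewrite eq_le bessel andbT.
have [F' [LF' cF' approx]] := fourier_synthesis mc (le_lt_trans bessel LF.2).
have mF' := LF'.1.
have mFF' : cmeasurable (fun p => F p - F' p) by exact: (cmeasurableB mF mF').
have FF'0 : norm2 QQ (fun p => F p - F' p) = 0%E.
  rewrite norm2_slices// -[RHS](integral0 q setT); apply: ge0_ae_eq_integral => //.
  - exact: (measurable_norm2_slice mFF').
  - by move=> x _; exact: norm2_ge0.
  have := ae_foralln cF'; have := L2_slice LF; have := L2_slice LF'.
  apply: filterS3 => x Lx' Lx cx _.
  have Ld : L2 q (fun y => F (x, y) - F' (x, y)) by exact: L2B.
  apply/norm2_eq0; first exact: Ld.1.
  apply: cube_fourier_unique; first exact: L2_cintegrable.
  (* [cube_fourier_unique] tests against [chr (intm k)] and [coef] against its conjugate, hence the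
     index [- k]. *)
  move=> k; have [g ge eg] := e_bij.
  have := coefB (e (g (- k))) Lx Lx'; rewrite cx subrr => E.
  rewrite -[RHS]E; apply: eq_cintegral => y.
  by rewrite eg -chrN -intmN opprK.
(* The constant 16 is the 8 of [fourier_synthesis] times the 2 of [norm2D]. *)
have small l : (norm2 QQ F - \sum_(i <oo) norm2 q (c i) <= (16 * 2^-1 ^+ l)%:E)%E.
  have [j jl] := approx l.
  have mt := cmeasurable_tsum 0 j mc.
  rewrite leeBlDr//; last first.
    rewrite ge0_fin_numE; first exact: le_lt_trans bessel LF.2.
    by apply: nneseries_ge0 => i _ _; exact: norm2_ge0.
  rewrite (bessel_id2 j LF); apply: leeD; last first.
    by apply: nneseries_lim_ge => i _ _; exact: norm2_ge0.
  rewrite (_ : (fun p => _) = (fun p => (F p - F' p) + (F' p - tsum (fun i => c i p.1) 0 j p.2))); last first.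
    by apply/funext => p; rewrite addrA subrK.
  apply: (le_trans (norm2D _ _ _)) => //; first exact: cmeasurableB.
  rewrite FF'0 add0e (_ : 16 * _ = 2 * (8 * 2^-1 ^+ l)); last by rewrite mulrA; congr (_ * _); lra.
  by rewrite [leRHS]EFinM lee_wpmul2l// lee_fin.
have := le0_geometric small; rewrite sube_le0//.
Qed.

End plancherel.

(** * Semi-Hilbert representations *)

Section hilbertian.
Context (R : realType) (G : Type).
Implicit Types rho tau : rep R G.

(** Polarization for a form that is linear in the first argument and conjugate-linear in the
    second. *)
Definition polar (V : lmodType R[i]) (Q : V -> R) (x y : V) : R[i] :=
  ((Q (x + y) - Q (x - y)) / 4) +i*
  ((Q (x + (0 +i* 1) *: y) - Q (x - (0 +i* 1) *: y)) / 4).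

(* An isometry is recovered from its squared norm by polarization, so [unitary_intertwiner]
   reduces to statements about [Q]. *)
Record hilbertian rho (Q : rvec rho -> R) : Prop := Hilbertian {
  hilb_ge0 : forall x, 0 <= Q x ;
  hilb_lin : forall a (x y : rvec rho), rspace x -> rspace y -> rspace (a *: x + y) ;
  hilb_polar : forall x y : rvec rho, rspace x -> rspace y -> rdot x y = polar Q x y ;
  hilb_sq : forall x : rvec rho, rdot x x = (Q x)%:C ;
  hilb_eq : forall x y : rvec rho, rspace x -> rspace y -> Q (x - y) = 0 -> Q x = Q y }.

Lemma hilb_req rho (Q : rvec rho -> R) x y : hilbertian Q -> Q (x - y) = 0 -> req x y.
Proof. by move=> hQ xy; rewrite /req (hilb_sq hQ) xy. Qed.

Lemma hilb_intertwiner rho tau (Q : rvec rho -> R) (Q' : rvec tau -> R)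
    (T : rvec rho -> rvec tau) : hilbertian Q -> hilbertian Q' ->
  (forall x, rspace x -> rspace (T x)) ->
  (forall a x y, rspace x -> rspace y -> Q' (T (a *: x + y) - (a *: T x + T y)) = 0) ->
  (forall x, rspace x -> Q' (T x) = Q x) ->
  (forall z, rspace z -> exists2 x, rspace x & Q' (T x - z) = 0) ->
  (forall g x, rspace x -> Q' (T (ract g x) - ract g (T x)) = 0) ->
  unitary_intertwiner T.
Proof.
move=> hQ hQ' Tsp Tlin TQ Tsurj Tact; split => //.
- by move=> a x y xs ys; apply: (hilb_req hQ'); exact: Tlin.
- move=> x y xs ys; rewrite (hilb_polar hQ' (Tsp _ xs) (Tsp _ ys)) (hilb_polar hQ xs ys).
  (* [T] is linear only up to a null vector, which by [hilb_eq] does not affect [Q']. *)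
  have H a : Q' (T x + a *: T y) = Q (x + a *: y).
    rewrite addrC [x + _]addrC -TQ; last exact: (hilb_lin hQ).
    apply/esym; apply: (hilb_eq hQ'); last exact: Tlin.
      by apply: Tsp; exact: (hilb_lin hQ).
    by apply: (hilb_lin hQ'); exact: Tsp.
  rewrite /polar; congr Complex; congr (_ / _).
    by have := H 1; have := H (-1); rewrite !scale1r !scaleN1r => -> ->.
  by have := H (0 +i* 1); have := H (- (0 +i* 1)); rewrite !scaleNr => -> ->.
- by move=> z /Tsurj[x xs Tx]; exists x => //; exact: (hilb_req hQ').
- by move=> g x xs; apply: (hilb_req hQ'); exact: Tact.
Qed.

Lemma hilb_copies N rho (Q : rvec rho -> R) : hilbertian Q ->
  hilbertian (fun x : rvec (copies N rho) => \sum_k Q ((x : {ffun 'I_N -> rvec rho}) k)).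
Proof.
move=> hQ; split.
- by move=> x; apply: sumr_ge0 => k _; exact: (hilb_ge0 hQ).
- by move=> a x y xs ys k; rewrite !ffunE; exact: (hilb_lin hQ).
- move=> x y xs ys; rewrite /rdot/=.
  rewrite (eq_bigr (fun k => polar Q (x k) (y k))) => [|k _]; last exact: (hilb_polar hQ).
  apply: complex_ext.
    rewrite /polar /= -sumrB mulr_suml (big_morph _ (@Re_add R) (erefl _)).
    by apply: eq_bigr => k _; rewrite /= !ffunE.
  rewrite /polar /= -sumrB mulr_suml (big_morph _ (@Im_add R) (erefl _)).
  by apply: eq_bigr => k _; rewrite /= !ffunE.
- move=> x; rewrite /rdot/= (eq_bigr (fun k => (Q (x k))%:C)) => [|k _]; last exact: (hilb_sq hQ).
  apply: complex_ext; first by rewrite (big_morph _ (@Re_add R) (erefl _)).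
  by rewrite (big_morph _ (@Im_add R) (erefl _))/= big1.
- move=> x y xs ys /eqP; rewrite psumr_eq0 => [/allP H|k _]; last exact: (hilb_ge0 hQ).
  apply: eq_bigr => k _; apply: (hilb_eq hQ) => //.
  by have /eqP := H k (mem_index_enum _); rewrite !ffunE.
Qed.

(** [P] is a domain containing [rspace] on which [S] still preserves the norm. It must also contain
    the equivariance defects of [T], which are not assumed to lie in [rspace]. *)
Lemma hilb_intertwiner_comp rho tau tau' (Q : rvec rho -> R) (Q' : rvec tau -> R)
    (Q'' : rvec tau' -> R) (P : set (rvec tau)) (T : rvec rho -> rvec tau)
    (S : rvec tau -> rvec tau') :
  hilbertian Q -> hilbertian Q' -> hilbertian Q'' ->
  (forall x, rspace x -> rspace (T x)) ->
  (forall a x y, rspace x -> rspace y -> Q' (T (a *: x + y) - (a *: T x + T y)) = 0) ->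
  (forall x, rspace x -> Q' (T x) = Q x) ->
  (forall z, rspace z -> exists2 x, rspace x & Q' (T x - z) = 0) ->
  (forall g x, rspace x -> P (T (ract g x) - ract g (T x)) /\ Q' (T (ract g x) - ract g (T x)) = 0) ->
  (forall a x y, S (a *: x + y) = a *: S x + S y) ->
  (forall x, rspace x -> rspace (S x)) ->
  (forall x, rspace x -> P x) ->
  (forall x, P x -> Q'' (S x) = Q' x) ->
  (forall z, rspace z -> exists2 x, rspace x & S x = z) ->
  (forall g x, S (ract g x) = ract g (S x)) ->
  unitary_intertwiner (S \o T).
Proof.
move=> hQ hQ' hQ'' Tsp Tlin TQ Tsurj Tact Slin Ssp sP SQ Ssurj Sact.
have SB x y : S x - S y = S (x - y).
  by rewrite [x - y]addrC -[- y]scaleN1r Slin scaleN1r addrC.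
have sB x y : rspace x -> rspace y -> P (x - y).
  by move=> xs ys; apply: sP; rewrite addrC -scaleN1r; exact: (hilb_lin hQ').
apply: (hilb_intertwiner hQ hQ'') => /=.
- by move=> x xs; apply: Ssp; exact: Tsp.
- move=> a x y xs ys; rewrite -Slin SB SQ; first exact: Tlin.
  by apply: sB; [apply/Tsp/(hilb_lin hQ)|apply: (hilb_lin hQ'); exact: Tsp].
- by move=> x xs; rewrite SQ ?TQ//; apply/sP/Tsp.
- move=> z /Ssurj[y ys <-]; have [x xs xy] := Tsurj _ ys.
  by exists x => //; rewrite SB SQ//; apply: sB => //; exact: Tsp.
- by move=> g x xs; have [Px Qx] := Tact g x xs; rewrite -Sact SB SQ.
Qed.

End hilbertian.

Section function_reps.
Context (R : realType) (G : Type) (rho : rep R G).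
Context d (T : measurableType d) (mu : {measure set T -> \bar R}).
Variable ev : rvec rho -> T -> R[i].
Hypothesis ev_lin : forall a x y t, ev (a *: x + y) t = a * ev x t + ev y t.
Hypothesis ev_int : forall x, rspace x ->
  mu.-integrable setT (fun t => (sqnormC (ev x t))%:E).
Hypothesis rspace_lin : forall a (x y : rvec rho), rspace x -> rspace y -> rspace (a *: x + y).
Hypothesis rdotE : forall x y, rdot x y = cintegral mu (fun t => ev x t * conjc (ev y t)).

Let evD x y t : ev (x + y) t = ev x t + ev y t.
Proof. by rewrite -[x]scale1r ev_lin mul1r scale1r. Qed.

Let evZ a x t : ev (a *: x) t = a * ev x t.
Proof.
have e0 : ev 0 t = 0.
  by have := evD 0 0 t; rewrite addr0 => /eqP; rewrite -subr_eq subrr => /eqP <-.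
by rewrite -[a *: x]addr0 ev_lin e0 addr0.
Qed.

Let evB x y t : ev (x - y) t = ev x t - ev y t.
Proof. by rewrite -scaleN1r evD evZ mulN1r. Qed.

(** Serves both models: [ev] is evaluation at coset representatives for [Ind] and plain evaluation
    for [schrodinger]. *)
Lemma hilb_functions : hilbertian (fun x => Rintegral mu setT (fun t => sqnormC (ev x t))).
Proof.
split.
- by move=> x; apply: Rintegral_ge0 => t _; exact: sqnormC_ge0.
- exact: rspace_lin.
- move=> x y xs ys; rewrite rdotE /polar.
  have I a : mu.-integrable setT (fun t => (sqnormC (ev (x + a *: y) t))%:E).
    by apply: ev_int; rewrite addrC; exact: rspace_lin.
  have hE a : (Rintegral mu setT (fun t => sqnormC (ev (x + a *: y) t)) -
      Rintegral mu setT (fun t => sqnormC (ev (x - a *: y) t))) / 4 =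
    Rintegral mu setT (fun t => (sqnormC (ev (x + a *: y) t) - sqnormC (ev (x - a *: y) t)) / 4).
    have I' : mu.-integrable setT (fun t => (sqnormC (ev (x - a *: y) t))%:E).
      by rewrite -scaleNr; exact: I.
    transitivity (Rintegral mu setT (fun t => 4^-1 * (sqnormC (ev (x + a *: y) t) - sqnormC (ev (x - a *: y) t)))); last first.
      by apply: eq_Rintegral => t _; rewrite mulrC.
    rewrite RintegralZl// ?RintegralB//; first by rewrite mulrC.
    by exact: (I a).
    exact: (integrableB measurableT (I a) I').
  have := hE 1; rewrite scale1r => ->; rewrite hE.
  congr Complex; apply: eq_Rintegral => t _.
    rewrite evD evB; move: (ev x t) (ev y t) => [a b] [c e].
    by rewrite /sqnormC/=; field.
  rewrite evD evB evZ; move: (ev x t) (ev y t) => [a b] [c e].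
  by rewrite /sqnormC/=; field.
- move=> x; rewrite rdotE; apply: complex_ext => /=.
    by apply: eq_Rintegral => t _; rewrite !ReImE /sqnormC; ring.
  transitivity (Rintegral mu setT (fun=> 0)); last by rewrite Rintegral_cst// mul0r.
  by apply: eq_Rintegral => t _; rewrite !ReImE; ring.
- move=> x y xs ys xy.
  have Ixy : mu.-integrable setT (fun t => (sqnormC (ev (x - y) t))%:E).
    by apply: ev_int; rewrite -scaleN1r addrC; exact: rspace_lin.
  have m (z : rvec rho) : mu.-integrable setT (fun t => (sqnormC (ev z t))%:E) ->
    measurable_fun setT (fun t => (sqnormC (ev z t))%:E) by exact: measurable_int.
  have xy0 : (\int[mu]_t `|(sqnormC (ev (x - y) t))%:E| = 0)%E.
    under eq_integral do rewrite gee0_abs ?lee_fin ?sqnormC_ge0//.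
    by rewrite -[LHS]fineK ?integrable_fin_num//; congr EFin.
  have /(ae_eq_integral_abs _ measurableT (m _ Ixy)) ae0 := xy0.
  rewrite /Rintegral; congr fine; apply: ge0_ae_eq_integral => //.
  + exact: m (ev_int xs).
  + exact: m (ev_int ys).
  + by move=> t _; rewrite lee_fin sqnormC_ge0.
  + by move=> t _; rewrite lee_fin sqnormC_ge0.
  + move: ae0; apply: filterS => t /(_ I)[] /sqnormC_eq0.
    by rewrite evB => /eqP; rewrite subr_eq0 => /eqP ->.
Qed.

End function_reps.

Section instances.
Context (R : realType) (m n : nat).
Local Notation X := (borelM R m n).
Local Notation M_ := 'M[R]_(m, n).
Local Notation G := (heis R m n).

Lemma integrable_sqnormC_lin d (T : measurableType d) (mu : {measure set T -> \bar R})
    (f g : T -> R[i]) (a : R[i]) :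
  measurable_fun setT (fun t => (sqnormC (a * f t + g t))%:E) ->
  mu.-integrable setT (fun t => (sqnormC (f t))%:E) ->
  mu.-integrable setT (fun t => (sqnormC (g t))%:E) ->
  mu.-integrable setT (fun t => (sqnormC (a * f t + g t))%:E).
Proof.
move=> mfg If Ig.
have I := integrableZl measurableT 2 (integrableD measurableT (integrableZl measurableT (sqnormC a) If) Ig).
apply: (le_integrable measurableT mfg _ I) => t _.
rewrite lee_fin ger0_norm ?sqnormC_ge0// (le_trans (sqnormCD _ _))// sqnormCM.
exact: ler_norm.
Qed.

Section Ind.
Variable H : groupClosed (heis R m n).
Variable chi : unitary_character H.
Variable nu : {measure set (cosets H) -> \bar R}.

Lemma sqnormC_uchar h : h \in H -> sqnormC (chi h) = 1.
Proof.
move=> hH; have := @uchar_norm _ _ _ _ chi _ hH; rewrite normc_def => /(congr1 (@complex.Re R))/= s1.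
have : Num.sqrt (sqnormC (chi h)) ^+ 2 = 1 by rewrite s1 expr1n.
by rewrite sqr_sqrtr// sqnormC_ge0.
Qed.

Lemma Ind_sqnormC_inv (f : G -> R[i]) : (forall h g, h \in H -> f (h * g)%g = chi h * f g) ->
  forall h g, h \in H -> sqnormC (f (h * g)%g) = sqnormC (f g).
Proof. by move=> fH h g hH; rewrite fH// sqnormCM sqnormC_uchar// mul1r. Qed.

(** [repr] is an arbitrary choice, so [f] composed with it need not be measurable; its squared
    modulus is left [H]-invariant and descends to the cosets. *)
Lemma measurable_Ind (f : G -> R[i]) : cmeasurable f ->
  (forall h g, h \in H -> f (h * g)%g = chi h * f g) ->
  measurable_fun setT (fun x : cosets H => (sqnormC (f (repr x)))%:E).
Proof.
move=> mf fH; apply: measurable_cosets_fun.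
rewrite (_ : _ \o _ = fun g => (sqnormC (f g))%:E); first exact: measurable_sqnormC.
apply/funext => g /=; have [h hH ->] := repr_pi H g.
by rewrite (Ind_sqnormC_inv fH).
Qed.

Definition Ind_norm (f : rvec (Ind chi nu)) : R :=
  Rintegral nu setT (fun x => sqnormC ((f : G -> R[i]) (repr x))).

Lemma Ind_integrable (f : rvec (Ind chi nu)) : rspace f ->
  nu.-integrable setT (fun x => (sqnormC ((f : G -> R[i]) (repr x)))%:E).
Proof.
move=> [mf fH ff]; apply/integrableP; split; first exact: measurable_Ind.
by under eq_integral do rewrite gee0_abs ?lee_fin ?sqnormC_ge0//.
Qed.

Lemma Ind_lin a (f g : rvec (Ind chi nu)) : rspace f -> rspace g -> rspace (a *: f + g).
Proof.
move=> fs gs; have [mf fH ff] := fs; have [mg gH gg] := gs.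
have mafg : cmeasurable (fun x : G => a * (f : G -> R[i]) x + (g : G -> R[i]) x).
  by apply: cmeasurableD => //; apply: cmeasurableM => //; exact: cmeasurable_cst.
have hH h x : h \in H -> a * (f : G -> R[i]) (h * x)%g + (g : G -> R[i]) (h * x)%g =
    chi h * (a * (f : G -> R[i]) x + (g : G -> R[i]) x).
  by move=> hH; rewrite fH// gH// mulrDr mulrCA.
split => //.
have mN := @measurable_Ind (fun x : G => a * (f : G -> R[i]) x + (g : G -> R[i]) x) mafg hH.
have /integrableP[_] := integrable_sqnormC_lin mN (Ind_integrable fs) (Ind_integrable gs).
by under eq_integral do rewrite gee0_abs ?lee_fin ?sqnormC_ge0//.
Qed.

Lemma Ind_hilb : hilbertian Ind_norm.
Proof.
apply: (@hilb_functions _ _ _ _ _ nu (fun (f : rvec (Ind chi nu)) x => (f : G -> R[i]) (repr x))) => //.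
- exact: Ind_integrable.
- exact: Ind_lin.
Qed.

End Ind.

Section schrodinger.
Variables (M : 'M[R]_m) (leb : {measure set X -> \bar R}).

Definition schrodinger_norm (f : rvec (schrodinger M leb)) : R :=
  Rintegral leb setT (fun x => sqnormC ((f : X -> R[i]) x)).

Lemma schrodinger_hilb : hilbertian schrodinger_norm.
Proof.
apply: (@hilb_functions _ _ _ _ _ leb (fun (f : rvec (schrodinger M leb)) x => (f : X -> R[i]) x)) => //.
- exact: L2_integrable.
- by move=> a f g Lf Lg; apply: (@L2D _ _ _ leb (fun x => a * (f : X -> R[i]) x) g) => //; exact: L2Z.
Qed.

End schrodinger.
End instances.

(** * Unfolding over the integral lattice *)

Section unfolding.
Context (R : realType) (m n : nat).
Local Notation X := (borelM R m n).
Local Notation M_ := 'M[R]_(m, n).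
Local Notation Z_ := 'M[int]_(m, n).
Variable leb : {measure set X -> \bar R}.
Hypothesis lebP : is_lebesgue leb.
Local Notation q := (cubeP lebP).
Variable e : nat -> Z_.
Hypothesis e_bij : bijective e.
Local Notation coef := (fourier_coef lebP).
Local Notation QQ := (q \x q)%E.

Lemma cmeasurable_translate (f : X -> R[i]) (t : M_) : cmeasurable f -> cmeasurable (fun x : X => f (x + t)).
Proof. by move=> mf; exact: (cmeasurable_comp (f := f) (measurable_translate t)). Qed.

Lemma norm2_translate (f : X -> R[i]) (t : M_) : cmeasurable f ->
  norm2 leb (fun x => f (x + t)) = norm2 leb f.
Proof.
move=> mf; apply: (ge0_integral_translate lebP t (D := setT) (f := fun x => (sqnormC (f x))%:E)) => //.
  exact: measurable_sqnormC.
by move=> x _; rewrite lee_fin sqnormC_ge0.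
Qed.

Lemma norm2_unfold (f : X -> R[i]) : cmeasurable f ->
  norm2 leb f = (\sum_(i <oo) norm2 q (fun x => f (x + intm (e i))%R))%E.
Proof.
move=> mf; apply: (ge0_integral_unfold lebP e_bij (f := fun x => (sqnormC (f x))%:E)).
  exact: measurable_sqnormC.
by move=> x; rewrite lee_fin sqnormC_ge0.
Qed.

Lemma ae_translate (P : X -> Prop) (t : M_) : {ae leb, forall x, P x} -> {ae leb, forall x, P (x + t)}.
Proof.
move=> [B [mB B0 PB]]; exists (translate t @^-1` B); split.
- by rewrite -[X in measurable X]setTI; exact: measurable_translate.
- by rewrite -[RHS]B0; exact: leb_translate.
- by move=> x /= nP; exact: PB.
Qed.

(** The exceptional set is pulled back by [fracm]; unfolding writes its measure as a series of
    copies of one null measure on the cube. *)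
Lemma ae_unfold (P : X -> Prop) : (forall x k, P x -> P (x + intm k)) ->
  {ae q, forall x, P x} -> {ae leb, forall x, P x}.
Proof.
move=> Pper [B [mB B0 PB]].
pose B' := (@fracm R m n : X -> X) @^-1` B.
have mB' : measurable B'.
  by rewrite -[X in measurable X]setTI; exact: measurable_fracm.
exists B'; split => //; last first.
  move=> x /= nP; apply: PB => /= Pf; apply: nP.
  by have := Pper _ (floorm x) Pf; rewrite /fracm subrK.
have -> : leb B' = (\int[leb]_x (\1_B' x)%:E)%E by rewrite integral_indic// setIT.
rewrite (ge0_integral_unfold lebP e_bij)//.
- rewrite eseries0// => i _ _.
  transitivity (\int[q]_x (\1_B' x)%:E)%E.
    apply: eq_integral => x _; rewrite !indicE; congr (_%:R%:E); congr nat_of_bool.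
    by rewrite /B'; apply/idP/idP; rewrite !inE/= fracmDint.
  by rewrite integral_indic// setIT; apply: (etrans (cubeP_fracm lebP mB)).
- exact/measurable_EFinP.
Qed.

Lemma norm2_cubeP_ae (f g : X -> R[i]) : cmeasurable f -> cmeasurable g ->
  {ae q, forall x, f x = g x} -> norm2 q f = norm2 q g.
Proof.
move=> mf mg fg; apply: ge0_ae_eq_integral => //.
- exact: measurable_sqnormC.
- exact: measurable_sqnormC.
- by move=> x _; rewrite lee_fin sqnormC_ge0.
- by move=> x _; rewrite lee_fin sqnormC_ge0.
- by apply: filterS fg => x /= ->.
Qed.

Lemma eq_coef_cube k (f g : X -> R[i]) : cmeasurable f -> cmeasurable g ->
  (forall x, @cube R m n x -> f x = g x) -> coef k f = coef k g.
Proof.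
move=> mf mg fg.
have mc : cmeasurable (fun x : X => conjc (chr (intm k) x)) by apply: cmeasurableJ; exact: cmeasurable_chr.
have [m1 m2] := cmeasurableM mf mc; have [m3 m4] := cmeasurableM mg mc.
apply: complex_ext; rewrite /=; congr fine; apply: ae_eq_integral => //; try exact/measurable_EFinP.
- by apply: filterS (cubeP_ae lebP) => x Qx _; rewrite fg.
- by apply: filterS (cubeP_ae lebP) => x Qx _; rewrite fg.
Qed.

(** Passing through the unordered sum [\esum] allows reindexing along [b] regardless of the
    enumeration [e]. *)
Lemma nneseries_lattice N (b : 'I_N * Z_ -> Z_) (G : Z_ -> \bar R) : bijective b ->
  (forall k, (0 <= G k)%E) ->
  (\sum_j \sum_(i <oo) G (b (j, e i)) = \sum_(i <oo) G (e i))%E.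
Proof.
move=> b_bij G0.
have E (H : Z_ -> \bar R) : (forall k, (0 <= H k)%E) -> (\sum_(i <oo) H (e i) = \esum_(k in setT) H k)%E.
  by move=> H0; rewrite nneseries_esumT//; apply/esym/reindex_esum; rewrite setTT_bijective.
transitivity (\sum_j \esum_(k in setT) G (b (j, k)))%E.
  by apply: eq_bigr => j _; exact: (E (fun k => G (b (j, k)))).
rewrite E// (reindex_esum setT setT b); last by rewrite setTT_bijective.
transitivity (\esum_(k in [set: 'I_N] `*`` (fun=> [set: Z_])) G (b (k.1, k.2)))%E; last first.
  rewrite (_ : _ `*`` _ = setT); last by apply/seteqP.
  by apply: eq_esum => -[j k].
rewrite -(esum_esum (a := fun j k => G (b (j, k))))// esum_fset//; last 2 first.
- exact: finite_finset.
- by move=> j _; exact: esum_ge0.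
rewrite fsbig_seq ?index_enum_uniq//; apply: eq_fsbigl; apply/seteqP; split=> j //= _; exact: mem_index_enum.
Qed.

End unfolding.

Section measurable_matrices.
Context (R : realType) d (T : measurableType d).

Lemma measurable_mulmx p r s (U : T -> 'M[R]_(p, r)) (V : T -> 'M[R]_(r, s)) :
  (forall i j, measurable_fun setT (fun t => U t i j)) ->
  (forall i j, measurable_fun setT (fun t => V t i j)) ->
  forall i j, measurable_fun setT (fun t => (U t *m V t) i j).
Proof.
move=> mU mV i j; under eq_fun do rewrite mxE.
by apply: measurable_sum => k; exact: measurable_funM.
Qed.

Lemma measurable_mxtrace p (U : T -> 'M[R]_p) :
  (forall i j, measurable_fun setT (fun t => U t i j)) ->
  measurable_fun setT (fun t => \tr (U t)).
Proof. by move=> mU; rewrite /mxtrace; apply: measurable_sum => i. Qed.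

End measurable_matrices.

(** * Functions equivariant under the lattice subgroup *)

Section equivariant_functions.
Context (R : realType) (m n : nat).
Local Notation X := (borelM R m n).
Local Notation M_ := 'M[R]_(m, n).
Local Notation Z_ := 'M[int]_(m, n).
Local Notation G := (heis R m n).
Variables (M : 'M[R]_m) (A : 'M[int]_m).
Hypotheses (M_sym : M^T = M) (AE : map_mx intr A = 2 *: M).
Variable phi : @unitary_character R m n GammaL.
Hypothesis phiE : forall g : G, g \in GammaL -> phi g = expi2pi (\tr (M *m hkap g)).

Lemma intm_mul (k : Z_) : intm (A *m k) = (2 *: M) *m intm k :> M_.
Proof. by rewrite -AE -map_mxM. Qed.

Lemma mxtrace_symC (u l : M_) : \tr (M *m (u *m l^T)) = \tr (M *m (l *m u^T)).
Proof. by rewrite -mxtrace_tr !trmx_mul trmxK M_sym mxtrace_mulC. Qed.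

Lemma chr_intm_mul (k : Z_) (u : M_) :
  chr (intm (A *m k)) u = expi2pi (\tr (M *m (intm k *m u^T + u *m (intm k)^T))).
Proof.
rewrite /chr intm_mul mulmxDr mxtraceD (mxtrace_symC u) -mulmxA -scalemxAl mxtraceZ.
by rewrite mulrDl mul1r.
Qed.

(** Value of the character at the central element whose symmetric coordinate is that of [g];
    removing it moves [g] into the slice [hsec]. *)
Definition phase (g : G) : R[i] := expi2pi (\tr (M *m (hkap g + hmu g *m (hlam g)^T))).

Lemma cmeasurable_phase : cmeasurable (phase : G -> R[i]).
Proof.
apply: cmeasurable_expi2pi; apply: measurable_mxtrace; apply: measurable_mulmx => i j.
  exact: measurable_cst.
under eq_fun do rewrite mxE.
apply: measurable_funD; first exact: measurable_hkap.
apply: measurable_mulmx => k l; first exact: measurable_hmu.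
by under eq_fun do rewrite mxE; exact: measurable_hlam.
Qed.

(** The second factor is the multiplier of [schrodinger] at the point [hlam g]: right translation in
    the induced models becomes the Schroedinger action. *)
Lemma phaseMr (g g0 : G) : phase (g * g0)%g = phase g *
  expi2pi (\tr (M *m (hkap g0 + hmu g0 *m (hlam g0)^T + 2 *: (hlam g *m (hmu g0)^T)))).
Proof.
rewrite -expi2piD /phase; congr expi2pi.
rewrite hkapM hlamM hmuM trmx_add !mulmxDl !mulmxDr.
rewrite ?mulmxDr ?mulmxN -!scalemxAr !mxtraceD ?raddfN/= mxtraceZ (mxtrace_symC (hmu g0) (hlam g)).
ring.
Qed.

Lemma hsec_GammaL (k l : Z_) : hsec (intm k) (intm l) \in (@GammaL R m n).
Proof. by apply/andP; rewrite hlam_hsec hmu_hsec !intm_mxOver. Qed.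

(* Compare [phi] on [(k, 0, 0) (0, l, 0) = (k, l, k l^T)]: the existence of the character
   forces the trace to be an integer. *)
Lemma expi2pi_intm (k l : Z_) : expi2pi (\tr (M *m (intm k *m (intm l)^T))) = 1.
Proof.
have g1 := hsec_GammaL k 0; have g2 := hsec_GammaL 0 l.
have := @ucharM _ _ _ _ phi _ _ g1 g2.
rewrite !phiE ?rpredM// ?hkapM; last by apply: gpredM.
rewrite !hkap_hsec !hlam_hsec !hmu_hsec intm0 !mul0mx trmx0 !mulmx0 subr0 oppr0 !add0r mulmx0 mxtrace0.
by rewrite expi2pi0 mulr1.
Qed.

Section equivariant_function.
Variable f : G -> R[i].
Hypothesis fL : forall h g, h \in (@GammaL R m n) -> f (h * g)%g = phi h * f g.

Lemma phase_dec g : f g = phase g * f (hsec (hlam g) (hmu g)).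
Proof.
pose h : G := hel 0 0 (heis_sym g).
have hL : h \in (@GammaL R m n).
  by apply/andP; split; apply/mxOverP => i j; rewrite mxE rpred0.
have -> : phase g = phi h.
  by rewrite phiE// /phase; congr (expi2pi (\tr (M *m _))); rewrite /hkap/= mul0mx subr0.
rewrite -fL//; congr (f _); apply: heisP.
- by rewrite hlamM /= add0r.
- by rewrite hmuM /= add0r.
- by rewrite hkapM hkap_hsec !mul0mx /h /hkap/= mul0mx !subr0 addr0 addrK.
Qed.

Lemma hsec_mulr (l u : M_) (g : G) : f (hsec l u * g)%g =
  expi2pi (\tr (M *m (hkap g + hmu g *m (hlam g)^T + 2 *: (l *m (hmu g)^T)))) *
  f (hsec (l + hlam g) (u + hmu g)).
Proof.
rewrite phase_dec phaseMr hlamM hmuM hlam_hsec hmu_hsec.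
by rewrite {1}/phase hlam_hsec hmu_hsec hkap_hsec addNr mulmx0 mxtrace0 expi2pi0 mul1r.
Qed.

Lemma hsec_mull (k l : Z_) (x u : M_) :
  f (hsec (intm k + x) (intm l + u)) = conjc (chr (intm (A *m k)) u) * f (hsec x u).
Proof.
have kl := hsec_GammaL k l.
have := fL (hsec x u) kl; rewrite phase_dec phiE// hlamM hmuM !hlam_hsec !hmu_hsec.
have -> : phase (hsec (intm k) (intm l) * hsec x u)%g =
    expi2pi (\tr (M *m hkap (hsec (intm k) (intm l) : G))) * chr (intm (A *m k)) u.
  rewrite chr_intm_mul -expi2piD /phase.
  (* The exponents differ by [\tr (M *m (intm l *m (intm k)^T))], whose exponential is 1. *)
  rewrite -[RHS]mul1r -(expi2pi_intm l k) -expi2piD; congr expi2pi.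
  rewrite hkapM hlamM hmuM !hkap_hsec !hlam_hsec !hmu_hsec !trmx_add !mulmxDl !mulmxDr.
  rewrite ?mulmxDr ?mulmxN !mxtraceD !raddfN/=.
  ring.
set a := expi2pi _; set b := chr _ _ => E.
have a1 : conjc a * a = 1 by rewrite mulrC expi2pi_conj.
have b1 : conjc b * b = 1 by rewrite mulrC; exact: expi2pi_conj.
rewrite -[f (hsec x u)]mul1r -a1 -mulrA -E.
rewrite (_ : _ * _ = (conjc a * a) * (conjc b * b) * f (hsec (intm k + x) (intm l + u))); last by ring.
by rewrite a1 b1 !mul1r.
Qed.

Lemma hsec_perr (l : Z_) (x u : M_) : f (hsec x (u + intm l)) = f (hsec x u).
Proof.
have := hsec_mull 0 l x u.
rewrite intm0 add0r mulmx0 intm0 chr0 [_ + u]addrC => ->.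
by rewrite -expi2pi0 -expi2piN oppr0 expi2pi0 mul1r.
Qed.

Lemma hsec_perl (k : Z_) (x u : M_) :
  f (hsec (x + intm k) u) = conjc (chr (intm (A *m k)) u) * f (hsec x u).
Proof. by have := hsec_mull k 0 x u; rewrite intm0 add0r [_ + x]addrC. Qed.

End equivariant_function.
End equivariant_functions.

(** * The intertwiner *)

Section theta_coefs.
Context (R : realType) (m n : nat).
Local Notation X := (borelM R m n).
Local Notation M_ := 'M[R]_(m, n).
Local Notation Z_ := 'M[int]_(m, n).
Local Notation G := (heis R m n).
Variables (M : 'M[R]_m) (A : 'M[int]_m).
Hypotheses (M_sym : M^T = M) (AE : map_mx intr A = 2 *: M) (M_unit : 2 *: M \in unitmx).
Variable phi : @unitary_character R m n GammaL.
Hypothesis phiE : forall g : G, g \in GammaL -> phi g = expi2pi (\tr (M *m hkap g)).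
Variable leb : {measure set X -> \bar R}.
Hypothesis lebP : is_lebesgue leb.
Variable e : nat -> Z_.
Hypothesis e_bij : bijective e.
Variables (N : nat) (a : 'I_N -> Z_).
Hypothesis a_bij : bijective (fun p : 'I_N * Z_ => A *m p.2 + a p.1).
Variable nu : {measure set (cosets (@GammaL R m n)) -> \bar R}.
Local Notation q := (cubeP lebP).
Local Notation coef := (fourier_coef lebP).
Local Notation QQ := (q \x q)%E.
Variable C : R.
Hypothesis C_gt0 : 0 < C.
Hypothesis nuE : forall f : G -> \bar R, measurable_fun setT f -> (forall g, (0 <= f g)%E) ->
  (forall h g, h \in (@GammaL R m n) -> f (h * g)%g = f g) ->
  (\int[nu]_x f (repr x) = C%:E * \int[QQ]_p f (hsec p.1 p.2))%E.

(* [2 M alpha_j = a_j]: this translation absorbs the character [chr (a j)] produced by a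
   translation in [mu]. *)
Definition shift_vec j : M_ := invmx (2 *: M) *m intm (a j).

Definition section_coef k (f : G -> R[i]) (x : X) : R[i] := coef k (fun u : X => f (hsec x u)).

(** The factor [Num.sqrt C] compensates the constant between [nu] and [q \x q], so that the map is
    isometric and not merely a similarity. *)
Definition theta_coefs (f : rvec (Ind phi nu)) : rvec (copies N (schrodinger M leb)) :=
  [ffun j => (fun x : M_ => (Num.sqrt C)%:C * section_coef (a j) f (x - shift_vec j)) : X -> R[i]^o].

Lemma shift_vecE j : (2 *: M) *m shift_vec j = intm (a j).
Proof. by rewrite /shift_vec mulmxA mulmxV// mul1mx. Qed.

Lemma sqnormC_sqrt : sqnormC (Num.sqrt C)%:C = C.
Proof. by rewrite /sqnormC/= sqr_sqrtr ?ltW// expr0n addr0. Qed.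

Lemma cmeasurable_hsec (f : G -> R[i]) : cmeasurable f ->
  cmeasurable (fun p : X * X => f (hsec p.1 p.2)).
Proof. by move=> mf; exact: (cmeasurable_comp (f := f) (@measurable_hsec R m n)). Qed.

Lemma cmeasurable_section_coef k (f : G -> R[i]) : cmeasurable f -> cmeasurable (section_coef k f).
Proof. by move=> mf; exact: (cmeasurable_coef lebP k (cmeasurable_hsec mf)). Qed.

Section equivariant_function.
Variable f : G -> R[i].
Hypothesis mf : cmeasurable f.
Hypothesis fL : forall h g, h \in (@GammaL R m n) -> f (h * g)%g = phi h * f g.

Lemma section_coef_shift k (l : Z_) (x : M_) :
  section_coef k f (x + intm l) = section_coef (A *m l + k) f x.
Proof.
apply: eq_cintegral => u; rewrite (hsec_perl M_sym AE phiE fL) intmD chrD.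
by rewrite rmorphM /= mulrCA mulrA.
Qed.

Lemma Ind_norm2 : (\int[nu]_x (sqnormC (f (repr x)))%:E = C%:E * norm2 QQ (fun p => f (hsec p.1 p.2)))%E.
Proof.
apply: (nuE (f := fun g => (sqnormC (f g))%:E)).
- exact: measurable_sqnormC.
- by move=> g; rewrite lee_fin sqnormC_ge0.
- by move=> h g hL; rewrite (Ind_sqnormC_inv fL).
Qed.

Lemma norm2_theta (k : Z_) (t : M_) :
  norm2 leb (fun x : X => (Num.sqrt C)%:C * section_coef k f (x - t)) =
  (C%:E * \sum_(i <oo) norm2 q (section_coef (A *m e i + k) f))%E.
Proof.
rewrite norm2Z; last first.
  by apply: (cmeasurable_translate (- t)); exact: cmeasurable_section_coef.
rewrite sqnormC_sqrt (norm2_translate lebP); last exact: cmeasurable_section_coef.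
rewrite (norm2_unfold lebP e_bij); last exact: cmeasurable_section_coef.
apply: (congr1 (fun z => C%:E * z)%E); apply: eq_eseriesr => i _; apply: eq_integral => x _.
exact: (congr1 (fun z => (sqnormC z)%:E) (section_coef_shift k (e i) x)).
Qed.

Hypothesis ff : (\int[nu]_x (sqnormC (f (repr x)))%:E < +oo)%E.

Lemma L2_hsec : L2 QQ (fun p => f (hsec p.1 p.2)).
Proof.
split; first exact: cmeasurable_hsec.
move: ff; rewrite Ind_norm2 !ltey => /negP Cf; apply/negP => /eqP fy; apply: Cf.
by rewrite fy gt0_muley// lte_fin.
Qed.

(** Almost all slices over the cube are square-integrable by Tonelli; an integral translation
    multiplies a slice by a unimodular character, which carries this to all of [X]. *)
Lemma L2_hsecl : {ae leb, forall x, L2 q (fun u : X => f (hsec x u))}.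
Proof.
apply: (ae_unfold e_bij); last exact: (L2_slice L2_hsec).
move=> x k fx; have := L2_unimodular (mu := q) (u := fun u => conjc (chr (intm (A *m k)) u)) _ _ fx.
rewrite (_ : (fun _ => _ * _) = fun u : X => f (hsec (x + intm k) u)); last first.
  by apply/funext => u; rewrite (hsec_perl M_sym AE phiE fL) mulrC.
apply; first by apply: cmeasurableJ; exact: cmeasurable_chr.
by move=> u; rewrite sqnormCJ sqnormC_chr.
Qed.

(** Unfolding turns the norm of component [j] into the coefficients indexed by the coset of [a j];
    together the cosets give the full sum of [plancherel]. *)
Lemma sum_norm2_theta :
  (\sum_j norm2 leb (fun x : X => ((Num.sqrt C)%:C * section_coef (a j) f (x - shift_vec j))%R) =
   \int[nu]_x (sqnormC (f (repr x)))%:E)%E.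
Proof.
rewrite Ind_norm2 (plancherel e_bij L2_hsec).
rewrite -(nneseries_lattice e_bij (G := fun k => norm2 q (section_coef k f)) a_bij); last first.
  by move=> k; exact: norm2_ge0.
rewrite ge0_sume_distrr; last by move=> j _; apply: nneseries_ge0 => i _ _; exact: norm2_ge0.
by apply: eq_bigr => j _; rewrite norm2_theta.
Qed.

End equivariant_function.

End theta_coefs.

(** * Equivariant functions with prescribed values on the unit cubes *)

Section automorphic.
Context (R : realType) (m n : nat).
Local Notation X := (borelM R m n).
Local Notation M_ := 'M[R]_(m, n).
Local Notation Z_ := 'M[int]_(m, n).
Local Notation G := (heis R m n).
Variables (M : 'M[R]_m) (A : 'M[int]_m).
Hypotheses (M_sym : M^T = M) (AE : map_mx intr A = 2 *: M).
Variable phi : @unitary_character R m n GammaL.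
Hypothesis phiE : forall g : G, g \in GammaL -> phi g = expi2pi (\tr (M *m hkap g)).
Variable leb : {measure set X -> \bar R}.
Hypothesis lebP : is_lebesgue leb.
Local Notation q := (cubeP lebP).
Local Notation coef := (fourier_coef lebP).
Local Notation QQ := (q \x q)%E.
Local Notation scoef := (section_coef lebP).
Variable F : X * X -> R[i].
Hypothesis mF : cmeasurable F.

(** Equivariant extension of [F] from the product of the unit cubes: [phase] restores the symmetric
    coordinate, and the character is the factor acquired when [hlam] moves by its integral part. *)
Definition automorphic (g : G) : R[i] :=
  phase M g * conjc (chr (intm (A *m floorm (hlam g))) (hmu g)) *
  F (fracm (hlam g), fracm (hmu g)).

Lemma cmeasurable_automorphic : cmeasurable automorphic.
Proof.
have mtr i j : measurable_fun setT (fun g : G => (hlam g)^T i j).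
  by under eq_fun do rewrite mxE; exact: measurable_hlam.
have mutr i j : measurable_fun setT (fun g : G => (hmu g)^T i j).
  by under eq_fun do rewrite mxE; exact: measurable_hmu.
have mc p r (B : 'M[R]_(p, r)) i j : measurable_fun setT (fun _ : G => B i j) by exact: measurable_cst.
apply: cmeasurableM; first apply: cmeasurableM.
- exact: cmeasurable_phase.
- apply: cmeasurableJ; rewrite /chr; under eq_fun do rewrite (intm_mul AE).
  apply: cmeasurable_expi2pi; apply: measurable_mxtrace; apply: measurable_mulmx; last exact: mutr.
  apply: measurable_mulmx; first exact: mc.
  move=> i j; under eq_fun do rewrite mxE.
  exact: (measurableT_comp (@measurable_floorm R m n i j) (@measurable_hlamX R m n)).
- apply: (cmeasurable_comp (f := F)) mF; apply: measurable_fun_pair.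
    exact: (measurableT_comp (@measurable_fracm R m n) (@measurable_hlamX R m n)).
  exact: (measurableT_comp (@measurable_fracm R m n) (@measurable_hmuX R m n)).
Qed.

Lemma automorphicM h g : h \in (@GammaL R m n) -> automorphic (h * g)%g = phi h * automorphic g.
Proof.
move=> hL; rewrite phiE//; move: (hL) => /andP[/mxOver_int[k hk] /mxOver_int[l hl]].
rewrite /automorphic hlamM hmuM hk hl ![intm _ + _]addrC floormD !fracmDint chr_periodic.
rewrite mulmxDr intmD chrD.
have -> : phase M (h * g)%g =
    expi2pi (\tr (M *m hkap h)) * phase M g * chr (intm (A *m k)) (hmu g).
  rewrite (chr_intm_mul M_sym AE) /phase -!expi2piD.
  rewrite -[RHS]mulr1 -(expi2pi_intm phiE l k) -expi2piD; congr expi2pi.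
  rewrite hkapM hlamM hmuM hk hl !trmx_add !mulmxDl !mulmxDr.
  rewrite ?mulmxDr ?mulmxN !mxtraceD ?raddfN/=.
  ring.
set c := chr (intm (A *m k)) _; set d := chr _ _; set w := F _.
have cc : c * conjc c = 1 by exact: expi2pi_conj.
have -> : conjc (d * c) = conjc d * conjc c by rewrite rmorphM.
rewrite [LHS](_ : _ = expi2pi (\tr (M *m hkap h)) * (phase M g * conjc d * w) * (c * conjc c)); last by ring.
by rewrite cc mulr1.
Qed.

Lemma automorphic_cube x u : @cube R m n x -> @cube R m n u -> automorphic (hsec x u) = F (x, u).
Proof.
move=> Qx Qu; rewrite /automorphic hlam_hsec hmu_hsec !fracm_id//.
rewrite (_ : floorm x = 0) ?mulmx0; last exact/cube_floorm.
rewrite intm0 -chrN oppr0 chr0 mulr1 /phase hkap_hsec addNr mulmx0 mxtrace0 expi2pi0.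
exact: mul1r.
Qed.

Lemma norm2_automorphic : norm2 QQ (fun p => automorphic (hsec p.1 p.2)) = norm2 QQ F.
Proof.
have mf := cmeasurable_hsec cmeasurable_automorphic.
rewrite (norm2_slices lebP mf) (norm2_slices lebP mF); apply: ge0_ae_eq_integral => //.
- exact: (measurable_norm2_slice lebP mf).
- exact: (measurable_norm2_slice lebP mF).
- by move=> x _; exact: norm2_ge0.
- by move=> x _; exact: norm2_ge0.
apply: filterS (cubeP_ae lebP) => x Qx _; apply: norm2_cubeP_ae.
- exact: (cmeasurable_slice x mf).
- exact: (cmeasurable_slice x mF).
- by apply: filterS (cubeP_ae lebP) => u Qu; exact: automorphic_cube.
Qed.

Lemma section_coef_automorphic k x : @cube R m n x ->
  scoef k automorphic x = coef k (fun u : X => F (x, u)).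
Proof.
move=> Qx; apply: eq_coef_cube.
- exact: (cmeasurable_slice x (cmeasurable_hsec cmeasurable_automorphic)).
- exact: (cmeasurable_slice x mF).
- by move=> u Qu; exact: automorphic_cube.
Qed.

End automorphic.

Section intertwiner.
Context (R : realType) (m n : nat).
Local Notation X := (borelM R m n).
Local Notation M_ := 'M[R]_(m, n).
Local Notation Z_ := 'M[int]_(m, n).
Local Notation G := (heis R m n).
Variables (M : 'M[R]_m) (A : 'M[int]_m).
Hypotheses (M_sym : M^T = M) (AE : map_mx intr A = 2 *: M) (M_unit : 2 *: M \in unitmx).
Variable phi : @unitary_character R m n GammaL.
Hypothesis phiE : forall g : G, g \in GammaL -> phi g = expi2pi (\tr (M *m hkap g)).
Variable leb : {measure set X -> \bar R}.
Hypothesis lebP : is_lebesgue leb.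
Variable e : nat -> Z_.
Hypothesis e_bij : bijective e.
Variables (N : nat) (a : 'I_N -> Z_).
Hypothesis a_bij : bijective (fun p : 'I_N * Z_ => A *m p.2 + a p.1).
Variable nu : {measure set (cosets (@GammaL R m n)) -> \bar R}.
Local Notation q := (cubeP lebP).
Local Notation coef := (fourier_coef lebP).
Local Notation QQ := (q \x q)%E.
Variable C : R.
Hypothesis C_gt0 : 0 < C.
Hypothesis nuE : forall f : G -> \bar R, measurable_fun setT f -> (forall g, (0 <= f g)%E) ->
  (forall h g, h \in (@GammaL R m n) -> f (h * g)%g = f g) ->
  (\int[nu]_x f (repr x) = C%:E * \int[QQ]_p f (hsec p.1 p.2))%E.

Local Notation alpha := (shift_vec M a).
Local Notation scoef := (section_coef lebP).
Local Notation theta := (@theta_coefs R m n M phi leb lebP N a nu C).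

Local Notation autf := (automorphic M A).
Local Notation copies_norm := (fun x : rvec (copies N (schrodinger M leb)) =>
  \sum_k schrodinger_norm ((x : {ffun 'I_N -> rvec (schrodinger M leb)}) k)).

Lemma thetaE f j : theta f j = fun x : X => (Num.sqrt C)%:C * scoef (a j) f ((x : M_) - alpha j).
Proof. by rewrite /theta_coefs ffunE. Qed.

Lemma cmeasurable_theta f j : cmeasurable (f : G -> R[i]) -> cmeasurable (theta f j : X -> R[i]).
Proof.
move=> mf; rewrite thetaE; apply: cmeasurableM; first exact: cmeasurable_cst.
by apply: (cmeasurable_translate (- alpha j)); exact: cmeasurable_section_coef.
Qed.

Lemma L2_theta f j : rspace f -> L2 leb (theta f j : X -> R[i]).
Proof.
move=> [mf fL ff]; split; first exact: cmeasurable_theta.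
have E := sum_norm2_theta M_sym AE phiE e_bij a_bij C_gt0 nuE mf fL ff.
rewrite thetaE; apply: le_lt_trans ff; rewrite -E (bigD1 j)//=.
by rewrite leeDl// sume_ge0// => k _; exact: norm2_ge0.
Qed.

Lemma copies_norm_theta f : rspace f -> copies_norm (theta f) = Ind_norm f.
Proof.
move=> fs; have [mf fL ff] := fs.
have E := sum_norm2_theta M_sym AE phiE e_bij a_bij C_gt0 nuE mf fL ff.
apply: EFin_inj; rewrite -sumEFin.
transitivity (\sum_j norm2 leb (theta f j : X -> R[i]))%E.
  apply: eq_bigr => j _; rewrite /schrodinger_norm fineK//.
  by rewrite ge0_fin_numE; [exact: (L2_theta j fs).2|exact: norm2_ge0].
transitivity (\int[nu]_x (sqnormC (f (repr x)))%:E)%E.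
  by rewrite -E; apply: eq_bigr => j _; rewrite thetaE.
rewrite /Ind_norm fineK// ge0_fin_numE//.
by apply: integral_ge0 => x _; rewrite lee_fin sqnormC_ge0.
Qed.

Lemma copies_norm_ae0 (x : rvec (copies N (schrodinger M leb))) :
  (forall j, cmeasurable (x j : X -> R[i])) ->
  (forall j, {ae leb, forall t, (x j : X -> R[i]) t = 0}) -> copies_norm x = 0.
Proof.
move=> mx x0; apply: big1 => j _; rewrite /schrodinger_norm /Rintegral.
by have /norm2_eq0 := x0 j; rewrite /norm2 => ->.
Qed.

(** Linearity may fail at points whose slices are not square-integrable, where the coefficient can
    be a default value; these points form a null set. *)
Lemma theta_linear c f g : rspace f -> rspace g ->
  copies_norm (theta (c *: f + g) - (c *: theta f + theta g)) = 0.
Proof.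
move=> fs gs; have [mf fL ff] := fs; have [mg gL gg] := gs.
have mcfg : cmeasurable ((c *: f + g : rvec (Ind phi nu)) : G -> R[i]).
  by apply: cmeasurableD => //; apply: cmeasurableM => //; exact: cmeasurable_cst.
have E j : (theta (c *: f + g) - (c *: theta f + theta g)) j = (fun x : X =>
    (theta (c *: f + g) j : X -> R[i]) x - (c * (theta f j : X -> R[i]) x + (theta g j : X -> R[i]) x)).
  by apply/funext => x; rewrite !ffunE.
apply: copies_norm_ae0 => j; rewrite E.
  apply: cmeasurableB; first exact: (cmeasurable_theta j mcfg).
  apply: cmeasurableD; last exact: (cmeasurable_theta j mg).
  by apply: cmeasurableM; [exact: cmeasurable_cst|exact: (cmeasurable_theta j mf)].
have Lf := ae_translate lebP (- alpha j) (L2_hsecl M_sym AE phiE e_bij C_gt0 nuE mf fL ff).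
have Lg := ae_translate lebP (- alpha j) (L2_hsecl M_sym AE phiE e_bij C_gt0 nuE mg gL gg).
have FF := ae_filter_ringOfSetsType leb.
apply: filterS2 Lf Lg => x Lf Lg.
rewrite !thetaE -[LHS]/((Num.sqrt C)%:C * scoef (a j) (fun g0 => c * f g0 + g g0) (x - alpha j) -
  (c * ((Num.sqrt C)%:C * scoef (a j) f (x - alpha j)) + (Num.sqrt C)%:C * scoef (a j) g (x - alpha j))).
rewrite /section_coef coefD ?coefZ//; first by ring.
exact: L2Z.
Qed.

Lemma coef_translate k (h : X -> R[i]) (w : R[i]) (t : M_) : L2 q h ->
  (forall (u : M_) l, h (u + intm l) = h u) ->
  coef k (fun u : X => w * h (u + t)) = w * chr (intm k) t * coef k h.
Proof.
move=> Lh hper; rewrite /fourier_coef -cintegralZ; last exact: coef_cintegrable.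
rewrite -[RHS](cintegral_translate lebP e_bij t).
- apply: eq_cintegral => u; rewrite chr_addr.
  set c := chr _ t; set d := chr _ u; set y := h _.
  have cc : c * conjc c = 1 by exact: expi2pi_conj.
  have -> : conjc (d * c) = conjc d * conjc c by rewrite rmorphM.
  rewrite [RHS](_ : _ = w * y * conjc d * (c * conjc c)); last by ring.
  by rewrite cc mulr1.
- apply: cmeasurableM; first exact: cmeasurable_cst.
  apply: cmeasurableM; first exact: Lh.1.
  by apply: cmeasurableJ; exact: cmeasurable_chr.
- by move=> u l; rewrite hper chr_periodic.
Qed.

(** Measurability of the defect is recorded too: the later passage to the model induced from [K]
    transfers norms of measurable families. *)
Lemma theta_act g0 f : rspace f ->
  let d := theta (ract g0 f) - ract g0 (theta f) in
  (forall j, cmeasurable (d j : X -> R[i])) /\ copies_norm d = 0.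
Proof.
move=> fs d; have [mf fL ff] := fs.
pose W (x : M_) := expi2pi (\tr (M *m (hkap g0 + hmu g0 *m (hlam g0)^T + 2 *: (x *m (hmu g0)^T)))).
have mW : cmeasurable (W : X -> R[i]).
  apply: cmeasurable_expi2pi; apply: measurable_mxtrace; apply: measurable_mulmx.
    by move=> i j; exact: measurable_cst.
  move=> i j; under eq_fun do rewrite mxE [X in _ + X]mxE.
  apply: measurable_funD; first exact: measurable_cst.
  apply: measurable_funM; first exact: measurable_cst.
  by apply: measurable_mulmx => ? ?; [exact: measurable_coord|exact: measurable_cst].
(* The right translate is expressed through [phase], [hlam] and [hmu], whose measurability is
   known. *)
have mact : cmeasurable (fun g : G => f (g * g0)%g).
  rewrite (_ : (fun _ => _) = fun g : G =>
      phase M g *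
      (W (hlam g) * f (hsec (hlam g + hlam g0) (hmu g + hmu g0)))); last first.
    apply/funext => g; rewrite -(hsec_mulr M_sym phiE fL).
    rewrite -[LHS]/((fun g => f (g * g0)%g) g) (phase_dec (M := M) phiE).
      by [].
    by move=> h g1 hL; rewrite -mulgA fL.
  apply: cmeasurableM; first exact: cmeasurable_phase.
  apply: cmeasurableM.
    exact: (cmeasurable_comp (@measurable_hlamX R m n) mW).
  have mp : measurable_fun setT (fun g : G => (hlam g + hlam g0 : X, hmu g + hmu g0 : X)).
    apply: measurable_fun_pair.
      exact: (measurableT_comp (measurable_translate (hlam g0)) (@measurable_hlamX R m n)).
    exact: (measurableT_comp (measurable_translate (hmu g0)) (@measurable_hmuX R m n)).
  exact: (cmeasurable_comp mp (cmeasurable_hsec mf)).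
have E j : d j = (fun x : X =>
    (theta (ract g0 f) j : X -> R[i]) x - W x * (theta f j : X -> R[i]) ((x : M_) + hlam g0)).
  by apply/funext => x; rewrite /d !ffunE.
have md j : cmeasurable (d j : X -> R[i]).
  rewrite E; apply: cmeasurableB; first exact: (cmeasurable_theta j mact).
  apply: cmeasurableM => //.
  by apply: (cmeasurable_translate (hlam g0)); exact: cmeasurable_theta.
split => //; apply: copies_norm_ae0 => // j; rewrite E.
have := ae_translate lebP (hlam g0 - alpha j) (L2_hsecl M_sym AE phiE e_bij C_gt0 nuE mf fL ff).
have FF := ae_filter_ringOfSetsType leb.
apply: filterS => x Lx.
have E2 : scoef (a j) (fun g => f (g * g0)%g) (x - alpha j) =
    W x * scoef (a j) f (x + hlam g0 - alpha j).
  rewrite -addrA /section_coef.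
  transitivity (coef (a j) (fun u : X => W (x - alpha j) * f (hsec (x + (hlam g0 - alpha j)) (u + hmu g0)))).
    apply: eq_cintegral => u; rewrite (hsec_mulr M_sym phiE fL).
    by rewrite -[x - alpha j + _]addrA [- _ + _]addrC.
  rewrite (coef_translate _ _ _ Lx) => [|u l]; last exact: (hsec_perr M_sym AE phiE fL).
  (* As [(2 *: M) *m alpha j = intm (a j)], the character at [hmu g0] turns the multiplier at
     [x - alpha j] into the multiplier at [x]. *)
  congr (_ * _); rewrite /chr -(shift_vecE M_unit) -expi2piD; congr expi2pi.
  rewrite -mulmxA -scalemxAl mxtraceZ mulmxBl scalerBr !mulmxDr mulmxN !mxtraceD.
  by rewrite raddfN/= -!scalemxAr !mxtraceZ; ring.
rewrite !thetaE -[X in X - _]/((Num.sqrt C)%:C * scoef (a j) (fun g => f (g * g0)%g) (x - alpha j)).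
by rewrite E2; ring.
Qed.

(** The target dictates every coefficient: an index [A *m l + a j] must receive [z j] moved by
    [intm l + alpha j]. Synthesis gives a function on the cubes, and [automorphic] extends it. *)
Lemma theta_surj (z : rvec (copies N (schrodinger M leb))) : rspace z ->
  exists2 f, rspace f & copies_norm (theta f - z) = 0.
Proof.
move=> zs.
have Lz j : L2 leb (z j : X -> R[i]) by exact: zs.
have mz j (t : M_) : cmeasurable (fun x : X => ((Num.sqrt C)^-1)%:C * (z j : X -> R[i]) (x + t)).
  apply: cmeasurableM; first exact: cmeasurable_cst.
  by apply: (cmeasurable_translate t); exact: (Lz j).1.
have [b bK Kb] := a_bij; have [e' eK Ke] := e_bij.
pose c k (x : X) : R[i] := ((Num.sqrt C)^-1)%:C *
  (z (b k).1 : X -> R[i]) (x + (intm (b k).2 + alpha (b k).1)).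
have mc k : cmeasurable (c k) by exact: mz.
have cE j i : c (A *m e i + a j) =
    fun x : X => ((Num.sqrt C)^-1)%:C * (z j : X -> R[i]) (x + intm (e i) + alpha j).
  by apply/funext => x; rewrite /c (bK (j, e i)) addrA.
have csum : (\sum_(i <oo) norm2 q (c (e i)) < +oo)%E.
  rewrite -(nneseries_lattice e_bij (G := fun k => norm2 q (c k)) a_bij); last first.
    by move=> k; exact: norm2_ge0.
  apply: lte_sum_pinfty => j _.
  (* For fixed [j] the series is the unfolding of a single integral over [X]. *)
  rewrite (_ : limn _ = norm2 leb (fun x : X => ((Num.sqrt C)^-1)%:C * (z j : X -> R[i]) (x + alpha j))).
    exact: (L2Z ((Num.sqrt C)^-1)%:C (conj (cmeasurable_translate (alpha j) (Lz j).1)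
      (eq_ind_r (fun r => r < +oo)%E (Lz j).2 (norm2_translate lebP (alpha j) (Lz j).1)))).2.
  rewrite (norm2_unfold lebP e_bij (mz j (alpha j))); apply: eq_eseriesr => i _.
  by rewrite cE.
have [F [LF cF _]] := fourier_synthesis e_bij (c := fun i => c (e i)) (fun i => mc (e i)) csum.
pose f := autf F.
have mf : cmeasurable f := cmeasurable_automorphic AE LF.1.
have fL := automorphicM M_sym AE phiE F.
have ff : (\int[nu]_x (sqnormC (f (repr x)))%:E < +oo)%E.
  rewrite (Ind_norm2 nuE mf fL) (norm2_automorphic AE lebP LF.1).
  by rewrite lte_mul_pinfty ?LF.2// lee_fin ltW.
exists f => //.
pose D j (x : X) := (theta f j : X -> R[i]) x - (z j : X -> R[i]) x.
have DE j : (theta f - z) j = D j by apply/funext => x; rewrite /D !ffunE.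
have mD j : cmeasurable (D j) by apply: cmeasurableB; [exact: cmeasurable_theta|exact: (Lz j).1].
apply: copies_norm_ae0 => j; rewrite DE//.
have mDa := cmeasurable_translate (alpha j) (mD j).
(* The coefficients of [f] are known on the unit cube only, so the claim is moved by [alpha j] and
   unfolded to the cube. *)
apply/(norm2_eq0 leb (mD j)); rewrite -(norm2_translate lebP (alpha j) (mD j)) (norm2_unfold lebP e_bij mDa).
apply: eseries0 => i _ _.
have mDi := cmeasurable_translate (intm (e i)) mDa.
apply/(norm2_eq0 q mDi).
have Fi := cF (e' (A *m e i + a j)).
apply: filterS2 (cubeP_ae lebP) Fi => x Qx; rewrite Ke cE => Fx.
rewrite /D thetaE addrK (section_coef_shift M_sym AE phiE lebP fL) (section_coef_automorphic AE lebP LF.1 _ Qx) Fx mulrA.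
rewrite -rmorphM/= mulfV ?mul1r ?subrr//.
by rewrite gt_eqF// sqrtr_gt0.
Qed.

End intertwiner.

(** * The representation induced from K *)

Section line_model.
Context (R : realType) (m n : nat).
Local Notation X := (borelM R m n).
Local Notation M_ := 'M[R]_(m, n).
Local Notation G := (heis R m n).
Variable M : 'M[R]_m.
Hypothesis M_sym : M^T = M.
Variable leb : {measure set X -> \bar R}.
Variable nu : {measure set (cosets (@K R m n)) -> \bar R}.
Variable C : R.
Hypothesis C_gt0 : 0 < C.
Hypothesis nuE : forall f : G -> \bar R, measurable_fun setT f -> (forall g, (0 <= f g)%E) ->
  (forall h g, h \in (@K R m n) -> f (h * g)%g = f g) ->
  (\int[nu]_x f (repr x) = C%:E * \int[leb]_x f (hsec x 0))%E.
Variable N : nat.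

(** Inverse, up to the isometric scaling, of restriction to the elements [hsec x 0]; [phase] is the
    factor that [K]-equivariance forces. *)
Definition line_extend (f : X -> R[i]) (g : G) : R[i] :=
  ((Num.sqrt C)^-1)%:C * phase M g * f (hlam g).

Lemma phaseK h (g : G) : h \in (@K R m n) -> phase M (h * g)%g = sigma n M h * phase M g.
Proof.
rewrite inE => /andP[/eqP l0 _]; rewrite -[sigma n M h]/(expi2pi (\tr (M *m hkap h))).
rewrite -expi2piD /phase; congr expi2pi; rewrite -mxtraceD -mulmxDr; congr (\tr (M *m _)).
rewrite hkapM hlamM hmuM l0 !add0r mul0mx addr0 mulmxDl.
do ![move: (_ *m _) => ?].
by apply/matrixP => i j; rewrite !mxE; ring.
Qed.

Lemma sqnormC_phase (g : G) : sqnormC (phase M g) = 1.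
Proof. exact: sqnormC_expi2pi. Qed.

Lemma cmeasurable_line_extend f : cmeasurable f -> cmeasurable (line_extend f).
Proof.
move=> mf; apply: cmeasurableM.
  by apply: cmeasurableM; [exact: cmeasurable_cst|exact: cmeasurable_phase].
exact: (cmeasurable_comp (@measurable_hlamX R m n) mf).
Qed.

Lemma line_extendK f h g : h \in (@K R m n) ->
  line_extend f (h * g)%g = sigma n M h * line_extend f g.
Proof.
move=> hK; rewrite /line_extend phaseK// hlamM.
by move: hK; rewrite inE => /andP[/eqP -> _]; rewrite add0r; ring.
Qed.

Lemma Ind_line (F : G -> R[i]) : cmeasurable F ->
  (forall h g, h \in (@K R m n) -> F (h * g)%g = sigma n M h * F g) ->
  (\int[nu]_x (sqnormC (F (repr x)))%:E = C%:E * norm2 leb (fun x : X => F (hsec x 0)))%E.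
Proof.
move=> mF FK; apply: (nuE (f := fun g => (sqnormC (F g))%:E)).
- exact: measurable_sqnormC.
- by move=> g; rewrite lee_fin sqnormC_ge0.
- by move=> h g hK; rewrite (Ind_sqnormC_inv FK).
Qed.

Lemma integral_line_extend f : cmeasurable f ->
  (\int[nu]_x (sqnormC (line_extend f (repr x)))%:E = norm2 leb f)%E.
Proof.
move=> mf; rewrite (Ind_line (cmeasurable_line_extend mf) (line_extendK f)).
transitivity (C%:E * ((sqnormC ((Num.sqrt C)^-1)%:C)%:E * norm2 leb f))%E.
  rewrite -(norm2Z leb ((Num.sqrt C)^-1)%:C mf); apply: (congr1 (fun z => C%:E * z)%E).
  apply: eq_integral => x _; rewrite /line_extend hlam_hsec !sqnormCM sqnormC_phase.
  by rewrite mulr1.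
rewrite muleA -EFinM /sqnormC/= expr0n addr0 exprVn sqr_sqrtr ?ltW//.
by rewrite mulfV ?gt_eqF// mul1e.
Qed.

Definition line_copies (x : rvec (copies N (schrodinger M leb))) :
    rvec (copies N (Ind (sigma n M) nu)) :=
  [ffun k => line_extend (x k) : G -> R[i]^o].

Lemma line_copies_space x : rspace x -> rspace (line_copies x).
Proof.
move=> xs k; rewrite ffunE; have [mx nx] := xs k; split.
- exact: cmeasurable_line_extend.
- by move=> h g hK; exact: line_extendK.
- by rewrite integral_line_extend.
Qed.

Lemma line_copies_linear a x y :
  line_copies (a *: x + y) = a *: line_copies x + line_copies y.
Proof.
apply/ffunP => k; rewrite !ffunE; apply/funext => g.
have H (p b c : R[i]) : p * (a * b + c) = a * (p * b) + p * c by ring.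
exact: H.
Qed.

Lemma line_copies_act g x : line_copies (ract g x) = ract g (line_copies x).
Proof.
apply/ffunP => k; rewrite !ffunE; apply/funext => g1.
rewrite -[RHS]/(line_extend (x k) (g1 * g)%g) /line_extend (phaseMr M_sym) hlamM.
by rewrite !mulrA.
Qed.

Lemma line_copies_norm (x : rvec (copies N (schrodinger M leb))) :
  (forall k, cmeasurable (x k : X -> R[i])) ->
  \sum_k Ind_norm (line_copies x k : rvec (Ind (sigma n M) nu)) =
  \sum_k schrodinger_norm (x k : rvec (schrodinger M leb)).
Proof.
move=> mx; apply: eq_bigr => k _; rewrite ffunE; congr fine.
exact: integral_line_extend.
Qed.

Lemma line_copies_surj z : rspace z -> exists2 x, rspace x & line_copies x = z.
Proof.
move=> zs.
have hx : measurable_fun setT (fun x : X => hsec x 0 : G).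
  have mp : measurable_fun setT (fun x : X => (x, 0 : X)).
    by apply: measurable_fun_pair; [exact: measurable_id|exact: measurable_cst].
  exact: (measurableT_comp (@measurable_hsec R m n) mp).
pose x : rvec (copies N (schrodinger M leb)) :=
  [ffun k => (fun t : X => (Num.sqrt C)%:C * (z k : G -> R[i]) (hsec t 0)) : X -> R[i]^o].
exists x.
  move=> k; rewrite ffunE; have [mz zK nz] := zs k.
  apply: (L2Z (mu := leb)); split; first exact: (cmeasurable_comp hx mz).
  move: nz; rewrite (Ind_line mz zK) !ltey => /negP Cf; apply/negP => /eqP fy; apply: Cf.
  by rewrite fy gt0_muley// lte_fin.
apply/ffunP => k; rewrite !ffunE; apply/funext => g; have [mz zK nz] := zs k.
have H (r p t w : R[i]) : r * p * (t * w) = r * t * (p * w) by ring.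
rewrite /line_extend H -rmorphM/= mulVf ?mul1r; last by rewrite gt_eqF// sqrtr_gt0.
have hK : (g * (hsec (hlam g) 0)^-1)%g \in (@K R m n).
  rewrite inE hlamM hlamV hlam_hsec subrr eqxx/=.
  have := heis_sym (g * (hsec (hlam g) 0)^-1)%g.
  by rewrite hlamM hlamV hlam_hsec subrr trmx0 mulmx0 addr0 => ->.
(* The element of [K] that carries [hsec (hlam g) 0] to [g] has [hkap] equal to the symmetric
   coordinate of [g], the argument of [phase]. *)
have -> : phase M g = sigma n M (g * (hsec (hlam g) 0)^-1)%g.
  rewrite -[sigma n M _]/(expi2pi (\tr (M *m hkap _))); congr (expi2pi (\tr (M *m _))).
  rewrite hkapM hkapV hlamV hmuV hkap_hsec hlam_hsec hmu_hsec oppr0 trmx0 !mul0mx !mulmx0.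
  by rewrite !oppr0 !addr0 trmx_opp mulmxN opprK.
by rewrite -zK// mulgVK.
Qed.

End line_model.

(** * Assembly of the two equivalences *)

Theorem theorem7p4 (R : realType) (m n : nat) (m_gt0 : (0 < m)%N)
    (n_gt0 : (0 < n)%N) (M : 'M[R]_m)
    (M_sym : M^T = M) (M_posdef : posdef M) (M_half : half_integral M)
    (phi : @unitary_character R m n GammaL)
    (phiE : forall g : heis R m n, g \in GammaL ->
      phi g = expi2pi (\tr (M *m hkap g)))
    (nuL : {measure set (@cosets R m n GammaL) -> \bar R})
    (nuL_inv : invariant_measure nuL)
    (nuK : {measure set (@cosets R m n K) -> \bar R})
    (nuK_inv : invariant_measure nuK)
    (leb : {measure set (borelM R m n) -> \bar R})
    (leb_lebesgue : is_lebesgue leb) :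
  exists2 N : nat, N%:R = (\det (2 *: M)) ^+ n &
    unitarily_equivalent (Ind phi nuL) (copies N (Ind (sigma n M) nuK)) /\
    unitarily_equivalent (Ind phi nuL) (copies N (schrodinger M leb)).
Proof.
(* Half-integrality makes the floor exact, so [A] is [2 *: M] over the integers. *)
pose A : 'M[int]_m := map_mx Num.floor (2 *: M).
have AE : map_mx intr A = 2 *: M.
  apply/matrixP => i j; rewrite !mxE; apply/eqP; rewrite -intrEfloor; exact: M_half.2.
have det2M : 0 < \det (2 *: M).
  apply: posdef_det_gt0 => v v0; rewrite -scalemxAr -scalemxAl mxE.
  by rewrite mulr_gt0// M_posdef.
have detA : 0 < \det A by rewrite -(ltr0z R) -det_map_mx AE.
have M_unit : 2 *: M \in unitmx by rewrite unitmxE unitfE gt_eqF.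
have [e e_bij] := exists_enum m_gt0 n_gt0.
have [N [a [NE a_bij]]] := lattice_cosets n (lt0r_neq0 detA).
have [C C_gt0 nuLE] := torus_integral m_gt0 n_gt0 leb_lebesgue nuL_inv.
have [D D_gt0 nuKE] := line_integral leb_lebesgue nuK_inv.
exists N.
  by rewrite NE natrX natr_absz ger0_norm ?ltW// -det_map_mx AE.
pose T := @theta_coefs R m n M phi leb leb_lebesgue N a nuL C.
have hQ := Ind_hilb phi nuL.
have hQ' := hilb_copies N (schrodinger_hilb M leb).
have hQ'' := hilb_copies N (Ind_hilb (sigma n M) nuK).
have Tsp f : rspace f -> rspace (T f).
  by move=> fs j; exact: (L2_theta M_sym AE phiE e_bij a_bij C_gt0 nuLE j fs).
have Tlin := theta_linear M_sym AE phiE e_bij a C_gt0 nuLE.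
have TQ := copies_norm_theta M_sym AE phiE e_bij a_bij C_gt0 nuLE.
have Tsurj := theta_surj M_sym AE phiE e_bij a_bij C_gt0 nuLE.
have Tact := theta_act M_sym AE M_unit phiE e_bij a C_gt0 nuLE.
split.
  (* Measurability suffices for [line_copies] to preserve norms, and [theta_act] provides it for the
     equivariance defect. *)
  pose P : set (rvec (copies N (schrodinger M leb))) :=
    [set x | forall j, cmeasurable ((x : {ffun 'I_N -> rvec (schrodinger M leb)}) j : borelM R m n -> _)].
  exists (@line_copies R m n M leb nuK D N \o T).
  apply: (hilb_intertwiner_comp (P := P) hQ hQ' hQ'' Tsp Tlin TQ Tsurj).
  - by move=> g f fs; exact: Tact.
  - exact: line_copies_linear.
  - exact: line_copies_space.
  - by move=> x xs j; exact: (xs j).1.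
  - exact: line_copies_norm.
  - exact: line_copies_surj.
  - exact: line_copies_act.
exists T; apply: (hilb_intertwiner hQ hQ' Tsp Tlin TQ Tsurj) => g f fs.
exact: (Tact g f fs).2.
Qed.
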